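(* For every integer $n\ge 3$, let $\Delta_n:=\max\{d(T): T \text{ a tree with } |V(T)|=n\}$, where $d(T):=\operatorname{dist}_T(\mathcal S(T),\mathcal C(T))$ is the distance between the adjacency spectral center $\mathcal S(T)$ and the characteristic set $\mathcal C(T)$ of $T$. Then \[ \Delta_n=\begin{cases}0,& 3\le n\le 11,\\ 1,& n=12,\\ \left\lfloor\dfrac{n-11}{2}\right\rfloor,& n\ge 13.\end{cases} \] Moreover, for every $n\ge12$ the broom $B(n-5,4)$ is extremal, i.e. $d(B(n-5,4))=\Delta_n$.
   Context: All graphs are finite, simple and undirected. For a tree $T$ with at least two vertices, $\lambda_1(T)\ge\lambda_2(T)\ge\cdots$ are the eigenvalues of its adjacency matrix $A(T)$ and $0=\mu_1(T)<\mu_2(T)\le\cdots$ those of its Laplacian $L(T)$. Adjacency spectral center: $\mathcal S(T)$ is (the vertex set of) the unique minimal subtree $Y$ of $T$ such that every connected component of $T-Y$ has adjacency spectral radius at most $\lambda_2(T)$. It is known that this is well defined and consists of either one vertex or the two endpoints of one edge. Characteristic set: let $f$ be a Fiedler vector of $T$, i.e. an eigenvector of $L(T)$ for $\mu_2(T)$. It is known that exactly one of the following happens: (1) some entry of $f$ is zero, and then there is a unique vertex $v$ with $f_v=0$ that is adjacent to a vertex $w$ with $f_w\ne0$; in this case $\mathcal C(T)=\{v\}$; (2) no entry of $f$ is zero, and then there is a unique edge $uv$ with $f_u>0>f_v$; in this case $\mathcal C(T)=\{u,v\}$ (a characteristic edge). The set $\mathcal C(T)$ does not depend on the choice of $f$.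 For nonempty $X,Y\subseteq V(T)$, $\operatorname{dist}_T(X,Y):=\min\{d_T(x,y):x\in X,y\in Y\}$, where $d_T$ is the graph distance. Broom: for integers $k,\ell\ge1$, $B(k,\ell)$ is the tree obtained from a path of length $k$ (with $k+1$ vertices) by adjoining $\ell$ additional leaves at one endpoint; thus $|V(B(k,\ell))|=k+\ell+1$. *)

(* Defs.v *)
From HB Require Import structures.
From mathcomp Require Import all_boot all_order all_algebra.
From mathcomp Require Import boolp classical_sets reals.

Set Implicit Arguments.
Unset Strict Implicit.
Unset Printing Implicit Defensive.

Import Order.TTheory GRing.Theory Num.Theory.

(* A simple graph on the vertex set T is a symmetric irreflexive e : rel T. *)
Section Graphs.
Variables (T : finType) (e : rel T).

Definition connected_graph : bool :=
  (0 < #|T|) && [forall x, forall y, connect e x y].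

(* In a simple graph, a ucycle of size at most 2 is empty or one edge
   traversed back and forth. *)
Definition acyclic : Prop := forall c : seq T, ucycle e c -> size c <= 2.

Definition is_tree : Prop :=
  [/\ symmetric e, irreflexive e, connected_graph & acyclic].

Definition induced (A : {set T}) : rel {x : T | x \in A} := relpre val e.

(* Length of a shortest walk from x to y; the default value #|T| is only
   reached when there is no such walk. *)
Definition gdist (x y : T) : nat :=
  \big[Order.min/#|T|]_(k < #|T|
      | [exists p : k.-tuple T, path e x p && (last x p == y)]) (k : nat).

Definition set_dist (X Y : {set T}) : nat :=
  \big[Order.min/#|T|]_(x in X) \big[Order.min/#|T|]_(y in Y) gdist x y.

End Graphs.
Arguments induced {T} e A.

Definition is_component (T : finType) (e : rel T) (A K : {set T}) : bool :=
  maxset [pred B : {set T} | (B \subset A) && connected_graph (induced e B)]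
    K.

(* Vertices 0, ..., k form the path; k.+1, ..., k + l are the leaves attached
   to its endpoint k. *)
Definition broom (k l : nat) : rel 'I_(k + l + 1) :=
  let arc (i j : nat) :=
    ((j == i.+1) && (j <= k)) || ((i == k) && (k < j)) in
  [rel i j : 'I_(k + l + 1) | arc i j || arc j i].
Arguments broom k l : clear implicits.

Local Open Scope classical_set_scope.
Local Open Scope ring_scope.

Section Spectra.
Variable R : realType.

(* The eigenvalues of M in nonincreasing order, with multiplicity, provided
   they are all real (as for a symmetric matrix). *)
Definition eigenvalues n (M : 'M[R]_n) : seq R :=
  xget [::] [set s | sorted >=%R s /\
                     char_poly M = \prod_(a <- s) ('X - a%:P)].

Definition spectral_radius n (M : 'M[R]_n) : R :=
  \big[Num.max/0]_(a <- eigenvalues M) `|a|.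

Section OneGraph.
Variables (T : finType) (e : rel T).

Definition adjacency : 'M[R]_#|T| :=
  \matrix_(i, j) (e (enum_val i) (enum_val j))%:R.

Definition laplacian : 'M[R]_#|T| :=
  diag_mx (\row_i #|[set y | e (enum_val i) y]%SET|%:R) - adjacency.

(* Entry number k (counting from 0) of the sequence is the eigenvalue of
   index k.+1. *)
Definition lambda2 : R := nth 0 (eigenvalues adjacency) 1.
Definition mu2 : R := nth 0 (rev (eigenvalues laplacian)) 1.

Definition is_fiedler (f : 'cV[R]_#|T|) : Prop :=
  f != 0 /\ laplacian *m f = mu2 *: f.

Definition char_set_of (f : 'cV[R]_#|T|) : {set T} :=
  let val_at v := f (enum_rank v) 0 in
  if [exists v, val_at v == 0] then
    [set v | (val_at v == 0) && [exists w, e v w && (val_at w != 0)]]%SET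
  else
    (\bigcup_(u | 0 < val_at u) \bigcup_(v | e u v && (val_at v < 0))
       [set u; v])%SET.

(* xget selects an unspecified Fiedler vector; for a tree the resulting set
   does not depend on which one. *)
Definition char_set : {set T} := char_set_of (xget 0 [set f | is_fiedler f]).

End OneGraph.

Section Centers.
Variables (T : finType) (e : rel T).

(* In a tree, the subtrees are the nonempty vertex sets inducing a connected
   graph. *)
Definition center_condition (Y : {set T}) : bool :=
  connected_graph (induced e Y) &&
  [forall K : {set T}, is_component e (~: Y)%SET K ==>
     (spectral_radius (adjacency (induced e K)) <= lambda2 e)].

(* For a tree with at least two vertices there is exactly one such Y. *)
Definition adj_center : {set T} :=
  odflt finset.set0 [pick Y | minset center_condition Y].

Definition center_dist : nat := set_dist e adj_center (char_set e).

End Centers.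

Definition center_dists (n : nat) : set nat :=
  [set d | exists (T : finType) (e : rel T),
     [/\ is_tree e, #|T| = n & d = center_dist e]].

End Spectra.

Definition is_maximum (A : set nat) (m : nat) : Prop :=
  A m /\ forall d, A d -> (d <= m)%N.

(* Main.v *)
(* Both centers are located by test functions.  Let s in the adjacency center
   and c in the characteristic set be at minimal distance d > 0, and root the
   tree at c.  On the adjacency side, the component K of T - s that contains c
   has spectral radius at most lambda_2; if every other component of T - s had a
   smaller one, a combination of two eigenvectors vanishing at s would contradict
   Perron-Frobenius.  So some branch A' below s has spectral radius at least that
   of K.  On the Laplacian side, the part of a Fiedler vector of one sign on a
   branch D at c that avoids s has Dirichlet quotient at most mu_2, hence every
   function on the branch of s has quotient at least mu_2.

   Rearranging the first function makes it live on a path with #|D| vertices; the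
   second inequality is tested on functions that only depend on the projection
   to the path from c to A'.  Comparing both with the solution of the
   one-dimensional eigenvalue equation gives #|D| >= d + 4 when #|A'| >= 5
   (#|D| >= d + 5 when moreover d >= 2), while for #|A'| <= 4 the bipartite bound
   rho(A')^2 < #|A'| makes K, and hence D, too small.

   In the broom B(k, 4) the adjacency center is the edge {k - 1, k}, and the same
   one-dimensional comparison shows that the characteristic set lies in
   {0, ..., b} with b = (k + 5) / 2, or b = 5 when k = 7. *)

Require Import Defs.
From mathcomp Require Import all_boot all_order all_algebra.
From mathcomp Require Import boolp classical_sets reals.
From mathcomp Require Import complex ring lra zify.

Set Implicit Arguments.
Unset Strict Implicit.
Unset Printing Implicit Defensive.

Import Order.TTheory GRing.Theory Num.Theory.

(** * Spectral theory of real symmetric matrices *)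

Section Spectral.
Local Open Scope ring_scope.
Variable R : realType.

(** The two spectral conditions concern opposite sides of the tree and meet only in a count of
    vertices: K contains D and the d vertices from c to the neighbour of s, while s and A' lie
    outside K, so |T| >= d + |D| + 1 + |A'|. With |A'| >= 5 and |D| >= d + 5 this is 2d + 11; for d
    = 1 only |D| >= 5 is available, which gives 12 and explains the exceptional value at n = 12. The
    threshold |A'| = 5 comes from sqrt 3 < 7/4: a branch with at most 4 vertices has radius at most
    sqrt 3, while every K with at least 6 vertices has radius at least 7/4. In the broom the star
    around the hub has radius 2, which no path reaches; this pins the adjacency center to the leaf
    end. If the handle is cut at b and k = b + j, the characteristic set stays in {0, ..., b} as
    soon as j + 4 <= b, so the distance is at least j - 1. The largest such j matches the upper
    bound except at n = 12, where b = 5, j = 2 needs a test function of its own. *)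

Lemma dotvE n (x y : 'cV[R]_n) : (x^T *m y) 0 0 = \sum_i x i 0 * y i 0.
Proof. by rewrite mxE; apply: eq_bigr => i _; rewrite mxE. Qed.

Lemma dotvv_eq0 n (x : 'cV[R]_n) : (x^T *m x == 0) = (x == 0).
Proof.
apply/eqP/eqP => [x0|->]; last by rewrite mulmx0.
have /eqP : \sum_i x i 0 * x i 0 = 0 by rewrite -dotvE x0 mxE.
rewrite psumr_eq0 => [/allP xz|i _]; last by rewrite -expr2 sqr_ge0.
apply/colP => i; rewrite mxE; apply/eqP.
by have := xz i (mem_index_enum _); rewrite mulf_eq0 orbb.
Qed.

(** An eigenvalue exists over the algebraically closed field [R[i]]. By the spectral theorem for
    Hermitian matrices it is an entry of a real diagonal matrix, hence a root of the real
    characteristic polynomial, and so has a real eigenvector. *)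
Lemma sym_eigenvector n (M : 'M[R]_n.+1) : M^T = M ->
  exists (a : R) (v : 'cV[R]_n.+1), v != 0 /\ M *m v = a *: v.
Proof.
move=> Msym; pose f := real_complex R.
pose A : 'M[R[i]]_n.+1 := map_mx f M.
have [a] := eigenvalue_closed A (ltn0Sn n).
rewrite eigenvalue_root_char => ra.
have Areal : A \is a mxOver Num.real.
  by apply/mxOverP => i j; rewrite mxE complex_real.
have Aherm : A \is hermsymmx.
  apply: realsym_hermsym => //; apply/is_hermitianmxP.
  rewrite expr0 scale1r map_mx_id //; apply/matrixP => i j; rewrite !mxE.
  by rewrite -[in LHS]Msym mxE.
have dreal := hermitian_spectral_diag_real Aherm.
have /orthomx_spectralP Aeq := hermitian_normalmx Aherm.
have ad : exists i, a = spectral_diag A 0 i.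
  move: ra; rewrite -eigenvalue_root_char => /eigenvalueP [v vA v0].
  pose w := v *m invmx (spectralmx A).
  have w0 : w != 0.
    apply: contra v0 => /eqP w0; have : w *m spectralmx A = 0 by rewrite w0 mul0mx.
    by rewrite /w mulmxKV ?spectral_unit // => ->.
  have wd : w *m diag_mx (spectral_diag A) = a *: w.
    have := vA; rewrite {1}Aeq => /(congr1 (mulmx^~ (invmx (spectralmx A)))).
    by rewrite !mulmxA mulmxK ?spectral_unit // -scalemxAl.
  move: w w0 wd => w w0 wd.
  have [i wi] : exists i, w 0 i != 0.
    apply: contrapT => H; move/negP: w0; apply; apply/eqP/rowP => i; rewrite mxE.
    by apply/eqP/negPn/negP => wi; apply: H; exists i.
  exists i; have /rowP/(_ i) := wd; rewrite mul_mx_diag !mxE => /eqP.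
  by rewrite mulrC (inj_eq (mulIf wi)) => /eqP.
case: ad => i ai.
have : a \is Num.real by rewrite ai; apply: (mxOverP dreal).
case: a ra {ai} => x y ra /complex_realP [z] [] xz y0; subst x y.
have : root (char_poly M) z.
  by rewrite -(fmorph_root f) map_char_poly; exact: ra.
rewrite -eigenvalue_root_char => /eigenvalueP [v vM v0].
exists z, v^T; split; first by rewrite -(inj_eq trmx_inj) trmxK trmx0.
by apply: trmx_inj; rewrite trmx_mul trmxK Msym vM linearZ /= trmxK.
Qed.

(** [H] is the Householder reflection exchanging the unit vectors e and u = a v; along w = u - e one
    has |w|^2 = 2(1 - t) with t = <u, e>. In the degenerate case u = e the identity serves. *)
Lemma orthogonal_first_col n (v : 'cV[R]_n.+1) : v != 0 ->
  exists (H : 'M[R]_n.+1) (a : R),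
    [/\ H^T = H, H *m H = 1%:M & H *m delta_mx 0 0 = a *: v].
Proof.
move=> v0; pose c := (v^T *m v) 0 0.
have vv : v^T *m v = c%:M.
  by apply/matrixP => i j; rewrite !ord1 !mxE eqxx mulr1n /c mxE.
have c_gt0 : 0 < c.
  rewrite lt_def; apply/andP; split.
    by apply: contra v0 => /eqP c0; rewrite -dotvv_eq0 vv c0 raddf0.
  by rewrite /c dotvE sumr_ge0 // => i _; rewrite -expr2 sqr_ge0.
pose a := (Num.sqrt c)^-1.
have a2 : a ^+ 2 * c = 1.
  by rewrite /a exprVn sqr_sqrtr ?ltW // mulVf ?gt_eqF.
pose e : 'cV[R]_n.+1 := delta_mx 0 0.
pose u := a *: v; pose w := u - e.
have uu : u^T *m u = 1%:M.
  have -> : u^T = a *: v^T by rewrite /u linearZ.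
  by rewrite -scalemxAl -scalemxAr scalerA -expr2 vv scale_scalar_mx a2.
have ee : e^T *m e = 1%:M.
  rewrite /e trmx_delta mul_delta_mx; apply/matrixP => i j.
  by rewrite !ord1 !mxE.
have eu : e^T *m u = u^T *m e.
  by apply: trmx_inj; rewrite trmx_mul trmxK; apply/matrixP => i j; rewrite !ord1 !mxE; apply: eq_bigr => k _; rewrite !mxE mulrC.
have wT : w^T = u^T - e^T by rewrite /w linearB.
have ww : w^T *m w = ((1 - (u^T *m e) 0 0) *+ 2)%:M.
  rewrite wT /w mulmxBl !mulmxBr uu ee eu.
  by move: (u^T *m e) => t; apply/matrixP => i j; rewrite !ord1 !mxE /=; ring.
have we : w^T *m e = ((u^T *m e) 0 0 - 1)%:M.
  rewrite wT mulmxBl ee.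
  by move: (u^T *m e) => t; apply/matrixP => i j; rewrite !ord1 !mxE /=; ring.
case: (eqVneq w 0) => [w0|w0].
  exists 1%:M, a; rewrite trmx1 !mul1mx; split=> //.
  by apply/esym/eqP; rewrite -subr_eq0; apply/eqP.
set t := (u^T *m e) 0 0 in ww we.
have t1 : 1 - t != 0.
  apply: contra w0 => /eqP t1; rewrite -dotvv_eq0 ww t1 mul0rn; apply/eqP.
  exact: raddf0.
exists (1%:M - (1 - t)^-1 *: (w *m w^T)), a; split.
- rewrite raddfB /= trmx1; congr (_ - _); apply/matrixP => i j.
  by rewrite ![in LHS]mxE ![in RHS]mxE; congr (_ * _); apply: eq_bigr => k _; rewrite !mxE mulrC.
- rewrite mulmxBl !mulmxBr !mul1mx mulmx1 -scalemxAl -scalemxAr scalerA.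
  rewrite mulmxA -[w *m w^T *m w]mulmxA ww mul_mx_scalar -scalemxAl scalerA.
  have -> : (1 - t)^-1 / (1 - t) * ((1 - t) *+ 2) = (1 - t)^-1 + (1 - t)^-1.
    by field.
  rewrite scalerDl; move: (_ *: (w *m w^T)) => X.
  by apply/matrixP => i j; rewrite !mxE; move: (X i j) => x; ring.
- rewrite mulmxBl mul1mx -scalemxAl -mulmxA we mul_mx_scalar scalerA.
  have -> : (1 - t)^-1 * (t - 1) = -1 by rewrite -[t - 1]opprB mulrN mulVf.
  by rewrite scaleN1r opprK /w -/e addrC subrK.
Qed.

(** Deflation: conjugation by the reflection makes the first basis vector an eigenvector; by
    symmetry the first row then also vanishes off the diagonal, and induction applies to the
    remaining block. *)
Lemma sym_diagonalization n (M : 'M[R]_n) : M^T = M ->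
  exists (P : 'M[R]_n) (d : 'rV[R]_n),
    P *m P^T = 1%:M /\ M = P^T *m diag_mx d *m P.
Proof.
elim: n M => [|n IHn] M Msym.
  by exists 0, 0; split; apply/matrixP => -[].
have [a [v [v0 Mv]]] := sym_eigenvector Msym.
have [H [b [Hs HH He]]] := orthogonal_first_col v0.
have [N defN] : exists N : 'M[R]_n.+1, N = H *m M *m H by eexists.
have Ns : N^T = N by rewrite defN !trmx_mul Hs Msym mulmxA.
have Ne : N *m delta_mx 0 0 = a *: delta_mx 0 0 :> 'cV_n.+1.
  rewrite defN -2!mulmxA He -[M *m _]scalemxAr Mv scalerA mulrC -scalerA -He.
  by rewrite -scalemxAr mulmxA HH mul1mx.
have Ncol i : N i 0 = a * (i == 0)%:R.
  have /colP/(_ i) := Ne; rewrite !mxE eqxx andbT => <-.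
  rewrite (bigD1 0) //= !mxE !eqxx mulr1 big1 ?addr0 // => k /negPf kn.
  by rewrite mxE kn mulr0.
have dl : @dlsubmx _ 1 n 1 n N = 0.
  by apply/matrixP => i j; rewrite !mxE !ord1 (_ : lshift n 0 = 0) ?Ncol ?mulr0 //; apply: val_inj.
have ul : @ulsubmx _ 1 n 1 n N = a%:M.
  by apply/matrixP => i j; rewrite !mxE !ord1 (_ : lshift n 0 = 0) ?Ncol ?mulr1 //; apply: val_inj.
have ur : @ursubmx _ 1 n 1 n N = 0.
  by apply: trmx_inj; rewrite -[LHS]/((@ursubmx _ 1 n 1 n N)^T) trmx_ursub Ns dl trmx0.
have drs : (@drsubmx _ 1 n 1 n N)^T = @drsubmx _ 1 n 1 n N by rewrite trmx_drsub Ns.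
have [P [d [PP Neq]]] := IHn _ drs.
pose Q : 'M[R]_(1 + n) := block_mx 1%:M 0 0 P.
have QT : Q^T = block_mx 1%:M 0 0 P^T :> 'M_(1 + n) by rewrite /Q tr_block_mx !trmx0 trmx1.
have QQ : Q *m (Q^T : 'M_(1 + n)) = 1%:M.
  rewrite QT /Q mulmx_block.
  by rewrite !mulmx0 !mul0mx !addr0 add0r mulmx1 PP -scalar_mx_block.
have Nb : N = (Q^T : 'M_(1 + n)) *m diag_mx (row_mx (a%:M : 'M_1) d) *m Q.
  rewrite QT diag_mx_row /Q !mulmx_block.
  rewrite !mulmx0 !mul0mx !addr0 !add0r !mul1mx !mulmx1 -Neq.
  rewrite -[LHS](@submxK _ 1 n 1 n) ul ur dl ?mulmx0 ?mul0mx.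
  suff -> : diag_mx (a%:M : 'M_1) = a%:M by [].
  by apply/matrixP => i j; rewrite !ord1 !mxE eqxx.
exists (Q *m H), (row_mx (a%:M : 'M_1) d); split.
  by rewrite trmx_mul Hs mulmxA -[Q *m H *m H]mulmxA HH mulmx1.
transitivity (H *m N *m H).
  by rewrite defN !mulmxA HH mul1mx -mulmxA HH mulmx1.
by rewrite Nb trmx_mul Hs !mulmxA.
Qed.
End Spectral.

(** * Sorted eigenvalues and their variational characterization *)

Section EigenvalueSequence.
Local Open Scope ring_scope.
Variable R : realType.

Definition dotv n (x y : 'cV[R]_n) : R := \sum_i x i 0 * y i 0.

Section Diagonalized.
Variables (n : nat) (M P : 'M[R]_n) (d : 'rV[R]_n).
Hypotheses (PP : P *m P^T = 1%:M) (MP : M = P^T *m diag_mx d *m P).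

Let PtP : P^T *m P = 1%:M. Proof. exact: mulmx1C. Qed.

Lemma char_poly_diagonalized : char_poly M = \prod_i ('X - (d 0 i)%:P).
Proof.
have mPP : map_mx polyC P^T *m map_mx polyC P = 1%:M.
  by rewrite -map_mxM PtP map_mx1.
have -> : char_poly M = char_poly (diag_mx d).
  rewrite /char_poly /char_poly_mx MP !map_mxM.
  set D := map_mx polyC (diag_mx d).
  have -> : 'X%:M - map_mx polyC P^T *m D *m map_mx polyC P =
     map_mx polyC P^T *m ('X%:M - D) *m map_mx polyC P.
    by rewrite mulmxBr mulmxBl mul_mx_scalar -scalemxAl mPP scalemx1.
  rewrite !det_mulmx mulrC mulrA -det_mulmx.
  by rewrite -map_mxM PP map_mx1 det1 mul1r.
rewrite char_poly_trig ?diag_mx_is_trig //.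
by apply: eq_bigr => i _; rewrite mxE eqxx mulr1n.
Qed.

(** [xget] has a single candidate: a product of linear factors determines the multiset of its roots,
    and sorting fixes their order. *)
Lemma eigenvalues_diagonalized :
  eigenvalues M = sort >=%R [seq d 0 i | i <- enum 'I_n].
Proof.
have charP (s : seq R) : perm_eq s [seq d 0 i | i <- enum 'I_n] ->
    char_poly M = \prod_(a <- s) ('X - a%:P).
  move=> ps; rewrite (perm_big _ ps) /= big_map char_poly_diagonalized.
  by rewrite big_enum.
have tot : total (>=%R : rel R) by move=> x y; exact: le_total.
rewrite /eigenvalues; apply: xget_unique => [|s [ss cs]].
  by split; [exact: sort_sorted | apply: charP; rewrite perm_sort].
apply: (sorted_eq (leT := >=%R)) => //.
- by move=> y x z /= xy yz; exact: le_trans yz xy.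
- by move=> x y /andP[xy yx]; apply/eqP; rewrite eq_le; apply/andP; split.
- exact: sort_sorted.
apply: prod_XsubC_eq; rewrite -cs; apply: charP; rewrite perm_sort.
by apply: perm_refl.
Qed.

Lemma dotv_diagonalized (x y : 'cV[R]_n) : dotv x y = dotv (P *m x) (P *m y).
Proof.
by rewrite /dotv -!dotvE trmx_mul mulmxA -[x^T *m _ *m P]mulmxA PtP mulmx1.
Qed.

Lemma dotvM_diagonalized (x : 'cV[R]_n) :
  dotv x (M *m x) = \sum_i d 0 i * (P *m x) i 0 ^+ 2.
Proof.
rewrite dotv_diagonalized MP !mulmxA PP mul1mx -mulmxA /dotv.
by apply: eq_bigr => i _; rewrite mul_diag_mx [in X in _ * X]mxE; ring.
Qed.

(** The eigenvectors are rows of [P]. The two indices are chosen by the caller, so that the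
    statement serves both ends of the spectrum, the lower one through -M. *)
Lemma two_eigenvectors (i1 i2 : 'I_n) : i1 != i2 -> d 0 i2 <= d 0 i1 ->
  (forall i, i != i1 -> d 0 i <= d 0 i2) ->
  exists u1 u2 : 'cV[R]_n,
    [/\ M *m u1 = d 0 i1 *: u1, M *m u2 = d 0 i2 *: u2,
      dotv u1 u1 = 1, dotv u2 u2 = 1 & dotv u1 u2 = 0] /\
    forall x, dotv u1 x = 0 -> dotv x (M *m x) <= d 0 i2 * dotv x x.
Proof.
move=> i12 d12 dmax; pose u i : 'cV[R]_n := P^T *m delta_mx i 0.
have Pu i : P *m u i = delta_mx i 0 by rewrite /u mulmxA PP mul1mx.
have Mu i : M *m u i = d 0 i *: u i.
  rewrite MP -!mulmxA Pu /u scalemxAr; congr (_ *m _).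
  apply/matrixP => a b; rewrite mul_diag_mx !mxE.
  by case: eqVneq => [->|] //=; rewrite !mulr0.
have dd i y : dotv (u i) y = (P *m y) i 0.
  rewrite dotv_diagonalized Pu /dotv (bigD1 i) //= big1 => [|k /negPf ki].
    by rewrite mxE !eqxx mul1r addr0.
  by rewrite mxE ki mul0r.
exists (u i1), (u i2); split; first split=> //.
- by rewrite dd Pu mxE !eqxx.
- by rewrite dd Pu mxE !eqxx.
- by rewrite dd Pu mxE (negPf i12).
move=> x; rewrite dd dotvM_diagonalized dotv_diagonalized => x0.
rewrite /dotv mulr_sumr; apply: ler_sum => i _; rewrite -expr2.
have [->|ii1] := eqVneq i i1; first by rewrite x0 expr0n /= !mulr0.
by rewrite ler_wpM2r ?sqr_ge0 ?dmax.
Qed.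

Lemma dotvM_le_radius (x : 'cV[R]_n) :
  dotv x (M *m x) <= spectral_radius M * dotv x x.
Proof.
rewrite dotvM_diagonalized dotv_diagonalized /dotv mulr_sumr.
apply: ler_sum => i _; rewrite -expr2 ler_wpM2r ?sqr_ge0 //.
apply: le_trans (ler_norm _) _; rewrite /spectral_radius.
rewrite eigenvalues_diagonalized; apply: le_bigmax_seq => //.
by rewrite mem_sort; apply: map_f; rewrite mem_enum.
Qed.

Lemma radius_attained : (0 < n)%N ->
  exists2 x : 'cV[R]_n, x != 0 &
    `|dotv x (M *m x)| = spectral_radius M * dotv x x.
Proof.
move=> n0; rewrite /spectral_radius eigenvalues_diagonalized.
set s := sort _ _.
have sP a : a \in s -> exists i, a = d 0 i.
  by rewrite mem_sort => /mapP[i _ ->]; exists i.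
have sE i : d 0 i \in s by rewrite mem_sort map_f ?mem_enum.
have [i ->] : exists i, \big[Num.max/0]_(a <- s) `|a| = `|d 0 i|.
  have [r0|//] : \big[Num.max/0]_(a <- s) `|a| = 0 \/
      exists i, \big[Num.max/0]_(a <- s) `|a| = `|d 0 i|.
    rewrite big_seq_cond.
    apply: (big_ind (fun x : R => x = 0 \/ exists i, x = `|d 0 i|)); first by left.
      by move=> x y; rewrite /Num.max; case: ifP.
    by move=> a; rewrite andbT => /sP[i ->]; right; exists i.
  (* The value 0 of the maximum may be its default; then every eigenvalue is 0 and any index will
     do. *)
  exists (Ordinal n0); rewrite r0; apply/esym/eqP; rewrite eq_le normr_ge0 andbT.
  by rewrite -r0; apply: le_bigmax_seq.
exists (P^T *m delta_mx i 0).
  apply/eqP => /(congr1 (mulmx P)); rewrite mulmxA PP mul1mx mulmx0.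
  by move=> /colP/(_ i); rewrite !mxE !eqxx => /eqP; rewrite oner_eq0.
rewrite dotvM_diagonalized dotv_diagonalized mulmxA PP mul1mx.
have -> : dotv (delta_mx i 0 : 'cV[R]_n) (delta_mx i 0) = 1.
  rewrite /dotv (bigD1 i) //= big1 => [|k /negPf ki].
    by rewrite !mxE !eqxx mulr1 addr0.
  by rewrite mxE ki mul0r.
rewrite mulr1 (bigD1 i) //= big1 => [|k /negPf ki].
  by rewrite mxE !eqxx expr1n mulr1 addr0.
by rewrite mxE ki expr0n mulr0.
Qed.

End Diagonalized.

Lemma second_largest n (M : 'M[R]_n) : M^T = M -> (1 < n)%N ->
  let l2 := nth 0 (eigenvalues M) 1 in
  exists (u1 u2 : 'cV[R]_n) (l1 : R),
    [/\ M *m u1 = l1 *: u1, M *m u2 = l2 *: u2 & l2 <= l1] /\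
    [/\ dotv u1 u1 = 1, dotv u2 u2 = 1, dotv u1 u2 = 0 &
    forall x, dotv u1 x = 0 -> dotv x (M *m x) <= l2 * dotv x x].
Proof.
move=> /sym_diagonalization [P [d [PP MP]]] n1 l2.
have El2 : l2 = nth 0 (eigenvalues M) 1 by [].
move: El2; rewrite (eigenvalues_diagonalized PP MP) sort_map.
set r := relpre _ _; have rP : perm_eq (sort r (enum 'I_n)) (enum 'I_n).
  exact/permPl/perm_sort.
have rt : transitive r by move=> y x z /= xy yz; exact: le_trans yz xy.
have rT : total r by move=> x y; exact: le_total.
have := sort_sorted rT (enum 'I_n); have := perm_size rP; have := perm_mem rP.
have := perm_uniq rP; rewrite enum_uniq size_enum_ord.
case: (sort r (enum 'I_n)) => [|i1 [|i2 s]] /= us ms ss; try by exfalso; move: n1; rewrite -ss.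
rewrite (path_sortedE rt) => /and3P[/= i21 /allP si _] El2.
case/andP: us; rewrite inE negb_or => /andP[i12 i1s] /andP[i2s us].
have [|u1 [u2 [[M1 M2 u11 u22 u12] H]]] := two_eigenvectors PP MP i12 i21.
  move=> i ii1; have := ms i; rewrite mem_enum !inE (negPf ii1) /=.
  by case: eqVneq => [->//|_ /= iS]; exact: (si i).
by exists u1, u2, (d 0 i1); rewrite El2.
Qed.

Lemma second_smallest n (M : 'M[R]_n) : M^T = M -> (1 < n)%N ->
  let l2 := nth 0 (rev (eigenvalues M)) 1 in
  exists (u1 u2 : 'cV[R]_n) (l1 : R),
    [/\ M *m u1 = l1 *: u1, M *m u2 = l2 *: u2 & l1 <= l2] /\
    [/\ dotv u1 u1 = 1, dotv u2 u2 = 1, dotv u1 u2 = 0 &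
    forall x, dotv u1 x = 0 -> l2 * dotv x x <= dotv x (M *m x)].
Proof.
move=> /sym_diagonalization [P [d [PP MP]]] n1 l2.
have El2 : l2 = nth 0 (rev (eigenvalues M)) 1 by [].
have NP : - M = P^T *m diag_mx (- d) *m P.
  by rewrite raddfN /= mulmxN mulNmx MP.
move: El2; rewrite (eigenvalues_diagonalized PP MP) sort_map -map_rev.
set r := relpre _ _; have rP : perm_eq (rev (sort r (enum 'I_n))) (enum 'I_n).
  by rewrite perm_rev; exact/permPl/perm_sort.
have rt : transitive r by move=> y x z /= xy yz; exact: le_trans yz xy.
have rT : total r by move=> x y; exact: le_total.
have := sort_sorted rT (enum 'I_n).
rewrite -rev_sorted; have := perm_size rP; have := perm_mem rP.
have := perm_uniq rP; rewrite enum_uniq size_enum_ord.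
have rt' : transitive (fun y x => r x y) by move=> y x z xy yz; exact: rt yz xy.
case: (rev _) => [|i1 [|i2 s]] us ms ss; try by exfalso; move: n1; rewrite -ss.
rewrite /= (path_sortedE rt') => /and3P[/= i21 /allP si _] El2.
case/andP: us; rewrite inE negb_or => /andP[i12 i1s] /andP[i2s us].
have [||u1 [u2 [[M1 M2 u11 u22 u12] H]]] := two_eigenvectors PP NP i12.
- by rewrite !mxE lerN2.
- move=> i ii1; have := ms i; rewrite mem_enum !inE (negPf ii1) /= !mxE lerN2.
  by case: eqVneq => [->//|_ /= iS]; exact: (si i).
exists u1, u2, (d 0 i1); rewrite El2; split; split=> //.
- by apply: oppr_inj; rewrite -mulNmx M1 mxE scaleNr.
- by apply: oppr_inj; rewrite -mulNmx M2 mxE scaleNr.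
move=> x /H; rewrite mulNmx mxE mulNr -lerN2 opprK; congr (_ <= _).
by rewrite /dotv -sumrN; apply: eq_bigr => i _; rewrite !mxE mulrN opprK.
Qed.

Lemma dotv_le_radius n (M : 'M[R]_n) (x : 'cV[R]_n) : M^T = M ->
  dotv x (M *m x) <= spectral_radius M * dotv x x.
Proof.
by move=> /sym_diagonalization [P [d [PP MP]]]; exact: (dotvM_le_radius PP MP).
Qed.

Lemma spectral_radius_attained n (M : 'M[R]_n) : M^T = M -> (0 < n)%N ->
  exists2 x : 'cV[R]_n, x != 0 &
    `|dotv x (M *m x)| = spectral_radius M * dotv x x.
Proof.
by move=> /sym_diagonalization [P [d [PP MP]]]; exact: (radius_attained PP MP).
Qed.

End EigenvalueSequence.

(** * Quadratic forms of a graph *)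

Section Forms.
Local Open Scope ring_scope.
Variables (R : realType) (T : finType) (e : rel T).

(** The forms of the adjacency matrix and of the Laplacian. The sums run over ordered pairs, so each
    edge counts twice; hence the factor 1/2 in [lform]. *)
Definition aform (x : T -> R) := \sum_u \sum_v (e u v)%:R * (x u * x v).
Definition lform (x : T -> R) := 2^-1 * \sum_u \sum_v (e u v)%:R * (x u - x v) ^+ 2.
Definition nsq (x : T -> R) := \sum_u x u ^+ 2.
Definition colf (x : T -> R) : 'cV[R]_#|T| := \col_i x (enum_val i).

Lemma colf_surj (c : 'cV[R]_#|T|) : exists x, c = colf x.
Proof.
exists (fun t => c (enum_rank t) 0); apply/colP => i.
by rewrite mxE enum_valK.
Qed.

Lemma colf_inj x y : colf x = colf y -> x =1 y.
Proof. by move=> /colP H t; have := H (enum_rank t); rewrite !mxE enum_rankK. Qed.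

Lemma sum_enum_val (F : T -> R) : \sum_(i < #|T|) F (enum_val i) = \sum_t F t.
Proof. by rewrite [RHS]big_enum_val. Qed.

Lemma dotv_colf x y : dotv (colf x) (colf y) = \sum_t x t * y t.
Proof. by rewrite -sum_enum_val; apply: eq_bigr => i _; rewrite !mxE. Qed.

Lemma nsqE x : nsq x = dotv (colf x) (colf x).
Proof. by rewrite dotv_colf; apply: eq_bigr => t _; rewrite expr2. Qed.

Lemma nsq_ge0 x : 0 <= nsq x.
Proof. by apply: sumr_ge0 => t _; exact: sqr_ge0. Qed.

Lemma nsq_gt0 x t : x t != 0 -> 0 < nsq x.
Proof.
move=> xt; rewrite /nsq (bigD1 t) //= ltr_pwDl ?exprn_even_gt0 //.
by apply: sumr_ge0 => u _; exact: sqr_ge0.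
Qed.

Lemma nsq_eq0 x : nsq x = 0 -> forall t, x t = 0.
Proof.
move=> x0 t; apply/eqP/negPn/negP => /nsq_gt0; by rewrite x0 ltxx.
Qed.

Lemma adjacency_colf x :
  adjacency R e *m colf x = colf (fun t => \sum_v (e t v)%:R * x v).
Proof.
by apply/colP => i; rewrite !mxE -sum_enum_val; apply: eq_bigr => j _; rewrite !mxE.
Qed.

Lemma laplacian_colf x :
  laplacian R e *m colf x = colf (fun t => \sum_v (e t v)%:R * (x t - x v)).
Proof.
rewrite /laplacian mulmxBl adjacency_colf; apply/colP => i.
rewrite mul_diag_mx !mxE; under [RHS]eq_bigr => v _ do rewrite mulrBr.
rewrite sumrB -mulr_suml; congr (_ * _ - _); rewrite -natr_sum; congr _%:R.
by rewrite -sum1dep_card big_mkcond; apply: eq_bigr => v _; case: (e _ v).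
Qed.

Lemma aformE x : aform x = dotv (colf x) (adjacency R e *m colf x).
Proof.
rewrite adjacency_colf dotv_colf; apply: eq_bigr => u _; rewrite mulr_sumr.
by apply: eq_bigr => v _; rewrite mulrCA.
Qed.

Lemma aform_sum x : aform x = \sum_u x u * \sum_v (e u v)%:R * x v.
Proof. by rewrite aformE adjacency_colf dotv_colf. Qed.

Hypothesis e_sym : symmetric e.

Lemma lform_sum x : lform x = \sum_u x u * \sum_v (e u v)%:R * (x u - x v).
Proof.
pose F u v := (e u v)%:R * (x u * (x u - x v)).
have -> : \sum_u x u * \sum_v (e u v)%:R * (x u - x v) = \sum_u \sum_v F u v.
  apply: eq_bigr => u _; rewrite mulr_sumr; apply: eq_bigr => v _.
  by rewrite /F mulrCA.
have E : \sum_u \sum_v F u v = \sum_u \sum_v F v u by exact: exchange_big.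
rewrite /lform; apply: (mulfI (x := 2)); rewrite ?pnatr_eq0 //.
rewrite mulVKf ?pnatr_eq0 // mulr_natl mulr2n {2}E -big_split /=.
apply: eq_bigr => u _; rewrite -big_split /=; apply: eq_bigr => v _.
by rewrite /F (e_sym v u); ring.
Qed.

Lemma lformE x : lform x = dotv (colf x) (laplacian R e *m colf x).
Proof. by rewrite laplacian_colf dotv_colf lform_sum. Qed.

Lemma lform_ge0 x : 0 <= lform x.
Proof.
rewrite mulr_ge0 ?invr_ge0 ?ler0n //; apply: sumr_ge0 => u _; apply: sumr_ge0 => v _.
by rewrite mulr_ge0 ?ler0n ?sqr_ge0.
Qed.

Lemma trmx_adjacency : (adjacency R e)^T = adjacency R e.
Proof. by apply/matrixP => i j; rewrite !mxE e_sym. Qed.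

Lemma trmx_laplacian : (laplacian R e)^T = laplacian R e.
Proof. by rewrite /laplacian raddfB /= tr_diag_mx trmx_adjacency. Qed.

Lemma adjacency_eigen x (l : R) : adjacency R e *m colf x = l *: colf x ->
  forall t, \sum_v (e t v)%:R * x v = l * x t.
Proof.
have -> : l *: colf x = colf (fun t => l * x t) by apply/colP => i; rewrite !mxE.
by rewrite adjacency_colf => /colf_inj.
Qed.

Lemma laplacian_eigen x (l : R) : laplacian R e *m colf x = l *: colf x ->
  forall t, \sum_v (e t v)%:R * (x t - x v) = l * x t.
Proof.
have -> : l *: colf x = colf (fun t => l * x t) by apply/colP => i; rewrite !mxE.
by rewrite laplacian_colf => /colf_inj.
Qed.

Lemma lambda2_vectors : (1 < #|T|)%N ->
  exists (u1 u2 : T -> R) (l1 : R),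
    [/\ forall t, \sum_v (e t v)%:R * u1 v = l1 * u1 t,
        forall t, \sum_v (e t v)%:R * u2 v = lambda2 R e * u2 t &
        lambda2 R e <= l1] /\
    [/\ nsq u1 = 1, nsq u2 = 1, \sum_t u1 t * u2 t = 0 &
     forall x, \sum_t u1 t * x t = 0 -> aform x <= lambda2 R e * nsq x].
Proof.
move=> T1; have [c1 [c2 [l1]]] := second_largest trmx_adjacency T1.
have [u1 ->] := colf_surj c1; have [u2 ->] := colf_surj c2.
rewrite -/(lambda2 R e) -!nsqE dotv_colf => -[[M1 M2 l12] [n1 n2 u12 H]].
exists u1, u2, l1; split; split=> //; try exact: adjacency_eigen.
by move=> x x0; rewrite aformE nsqE; apply: H; rewrite dotv_colf.
Qed.

Lemma mu2_vectors : (1 < #|T|)%N ->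
  exists (u1 u2 : T -> R) (l1 : R),
    [/\ forall t, \sum_v (e t v)%:R * (u1 t - u1 v) = l1 * u1 t,
        forall t, \sum_v (e t v)%:R * (u2 t - u2 v) = mu2 R e * u2 t &
        l1 <= mu2 R e] /\
    [/\ nsq u1 = 1, nsq u2 = 1, \sum_t u1 t * u2 t = 0 &
     forall x, \sum_t u1 t * x t = 0 -> mu2 R e * nsq x <= lform x].
Proof.
move=> T1; have [c1 [c2 [l1]]] := second_smallest trmx_laplacian T1.
have [u1 ->] := colf_surj c1; have [u2 ->] := colf_surj c2.
rewrite -/(mu2 R e) -!nsqE dotv_colf => -[[M1 M2 l12] [n1 n2 u12 H]].
exists u1, u2, l1; split; split=> //; try exact: laplacian_eigen.
by move=> x x0; rewrite lformE nsqE; apply: H; rewrite dotv_colf.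
Qed.

Lemma aform_le_radius x : aform x <= spectral_radius (adjacency R e) * nsq x.
Proof. by rewrite aformE nsqE dotv_le_radius ?trmx_adjacency. Qed.

Lemma norm_aform x : `|aform x| <= aform (fun t => `|x t|).
Proof.
apply: le_trans (ler_norm_sum _ _ _) _; apply: ler_sum => u _.
apply: le_trans (ler_norm_sum _ _ _) _; apply: ler_sum => v _.
by rewrite !normrM ger0_norm ?ler0n.
Qed.

Lemma nsq_norm x : nsq (fun t => `|x t|) = nsq x.
Proof. by apply: eq_bigr => t _; rewrite real_normK ?num_real. Qed.

(** The eigenvalue of largest modulus could be negative. Passing from x to |x| keeps the norm and
    turns the bound on the modulus into one on the form itself. *)
Lemma radius_attained_nonneg : (0 < #|T|)%N ->
  exists x : T -> R, [/\ forall t, 0 <= x t, 0 < nsq x &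
    spectral_radius (adjacency R e) * nsq x <= aform x].
Proof.
move=> T0; have [c c0] := spectral_radius_attained trmx_adjacency T0.
have [x cx] := colf_surj c; rewrite cx -nsqE -aformE => ax.
exists (fun t => `|x t|); rewrite nsq_norm; split=> //; last by rewrite -ax norm_aform.
rewrite lt_def nsq_ge0 andbT; apply: contra c0 => /eqP/nsq_eq0 x0.
by apply/eqP/colP => i; rewrite cx !mxE x0.
Qed.

Lemma lform_norm x : lform (fun t => `|x t|) <= lform x.
Proof.
rewrite ler_wpM2l ?invr_ge0 ?ler0n //; apply: ler_sum => u _; apply: ler_sum => v _.
rewrite ler_wpM2l ?ler0n //.
rewrite -[_ ^+ 2]real_normK ?num_real // -[leRHS]real_normK ?num_real //.
by rewrite lerXn2r ?nnegrE ?normr_ge0 // ler_dist_dist.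
Qed.

(** Disjoint supports with no edge between them, so that all cross terms vanish in the three
    forms. *)
Definition separated (x y : T -> R) :=
  (forall u, x u * y u = 0) /\ (forall u v, e u v -> x u * y v = 0).

Lemma nsq_separated x y (a b : R) : separated x y ->
  nsq (fun t => a * x t + b * y t) = a ^+ 2 * nsq x + b ^+ 2 * nsq y.
Proof.
move=> [xy _]; rewrite /nsq !mulr_sumr -big_split /=; apply: eq_bigr => t _.
have xy0 : a * b * (x t * y t) = 0 by rewrite xy mulr0.
by lra.
Qed.

Lemma aform_separated x y (a b : R) : separated x y ->
  aform (fun t => a * x t + b * y t) = a ^+ 2 * aform x + b ^+ 2 * aform y.
Proof.
move=> [_ xy]; rewrite /aform !mulr_sumr -big_split /=; apply: eq_bigr => u _.
rewrite !mulr_sumr -big_split /=; apply: eq_bigr => v _.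
case euv: (e u v); last by rewrite !mul0r !mulr0 addr0.
have vu := euv; rewrite e_sym in vu.
have H1 : a * b * (x u * y v) = 0 by rewrite xy // mulr0.
have H2 : a * b * (x v * y u) = 0 by rewrite xy // mulr0.
by rewrite !mul1r; lra.
Qed.

Lemma lform_separated x y (a b : R) : separated x y ->
  lform (fun t => a * x t + b * y t) = a ^+ 2 * lform x + b ^+ 2 * lform y.
Proof.
move=> [xx xy]; rewrite /lform ![_ ^+ 2 * (_ * _)]mulrCA -mulrDr; congr (_ * _).
rewrite !mulr_sumr -big_split /=; apply: eq_bigr => u _.
rewrite !mulr_sumr -big_split /=; apply: eq_bigr => v _.
case euv: (e u v); last by rewrite !mul0r !mulr0 addr0.
have vu := euv; rewrite e_sym in vu.
have H1 : a * b * (x u * y v) = 0 by rewrite xy // mulr0.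
have H2 : a * b * (x v * y u) = 0 by rewrite xy // mulr0.
have H3 : a * b * (x u * y u) = 0 by rewrite xx mulr0.
have H4 : a * b * (x v * y v) = 0 by rewrite xx mulr0.
by rewrite !mul1r; lra.
Qed.

End Forms.

Section Induced.
Local Open Scope ring_scope.
Variables (R : realType) (T : finType) (e : rel T) (K : {set T}).
Hypothesis e_sym : symmetric e.

Let eK := induced e K.

Lemma sum_induced (F : T -> R) : (forall t, t \notin K -> F t = 0) ->
  \sum_t F t = \sum_(t : {t | t \in K}) F (val t).
Proof.
move=> F0; rewrite -big_sub [RHS]big_mkcond; apply: eq_bigr => t _.
by case: ifPn => // /F0.
Qed.

Lemma nsq_induced (x : T -> R) : (forall t, t \notin K -> x t = 0) ->
  nsq x = nsq (fun t : {t | t \in K} => x (val t)).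
Proof. by move=> x0; rewrite /nsq sum_induced // => t /x0 ->; rewrite expr0n. Qed.

Lemma aform_induced (x : T -> R) : (forall t, t \notin K -> x t = 0) ->
  aform e x = aform eK (fun t : {t | t \in K} => x (val t)).
Proof.
move=> x0; rewrite /aform sum_induced => [|t /x0 xt].
  apply: eq_bigr => u _; rewrite sum_induced // => v /x0 ->.
  by rewrite !mulr0.
by rewrite big1 // => v _; rewrite xt mul0r mulr0.
Qed.

Lemma aform_le_component (x : T -> R) : (forall t, t \notin K -> x t = 0) ->
  aform e x <= spectral_radius (adjacency R eK) * nsq x.
Proof.
move=> x0; rewrite aform_induced // nsq_induced //; apply: aform_le_radius.
by move=> u v; exact: e_sym.
Qed.

Lemma component_radius_attained : K != finset.set0 ->
  exists x : T -> R, [/\ forall t, 0 <= x t, forall t, t \notin K -> x t = 0,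
    0 < nsq x & spectral_radius (adjacency R eK) * nsq x <= aform e x].
Proof.
move=> K0; have sK : symmetric eK by move=> u v; exact: e_sym.
have [|x [x_ge0 x_gt0 xr]] := radius_attained_nonneg R sK.
  by rewrite card_sig card_gt0.
pose y t : R := oapp x 0 (insub t).
have yK t : t \notin K -> y t = 0 by move=> tK; rewrite /y insubN.
have yE : (fun t : {t | t \in K} => y (val t)) = x.
  by apply/funext => t; rewrite /y valK.
exists y; rewrite aform_induced // nsq_induced // yE; split=> // t.
by rewrite /y; case: insub => /=.
Qed.
End Induced.

(** * Second eigenvalues *)

Section SecondEigenvalue.
Local Open Scope ring_scope.
Variables (R : realType) (T : finType) (e : rel T).
Hypothesis e_sym : symmetric e.
Implicit Types x y g h : T -> R.

Lemma separated_card x y t u : separated e x y -> x t != 0 -> y u != 0 ->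
  (1 < #|T|)%N.
Proof.
move=> [xx _] xt yu; have tu : t != u.
  apply: contra_neq yu => tu; apply: (mulfI xt).
  by rewrite mulr0 -tu xx.
by rewrite (cardD1 t) (cardD1 u) !inE eq_sym tu.
Qed.

Lemma nsq_neq0 x : 0 < nsq x -> exists t, x t != 0.
Proof.
move=> x0; apply: contrapT => H; move: x0; rewrite /nsq big1 ?ltxx // => t _.
apply/eqP; rewrite sqrf_eq0; apply/negPn/negP => xt; apply: H; by exists t.
Qed.

(** Min-max: all combinations of x and y have quotient at least tau, and the plane they span
    contains a nonzero vector orthogonal to the top eigenvector. *)
Lemma lambda2_ge x y (tau : R) : separated e x y -> 0 < nsq x -> 0 < nsq y ->
  tau * nsq x <= aform e x -> tau * nsq y <= aform e y -> tau <= lambda2 R e.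
Proof.
move=> xy x0 y0 ax ay.
have [t xt] := nsq_neq0 x0; have [u yu] := nsq_neq0 y0.
have [u1 [u2 [l1 [_ [_ _ _ H]]]]] := lambda2_vectors R e_sym (separated_card xy xt yu).
pose a := \sum_t u1 t * x t; pose b := \sum_t u1 t * y t.
have key p q : p * a + q * b = 0 -> 0 < p ^+ 2 * nsq x + q ^+ 2 * nsq y ->
    tau <= lambda2 R e.
  move=> pq pos; have := H (fun t => p * x t + q * y t).
  rewrite (aform_separated e_sym) // (nsq_separated _ _ xy) => /(_ _) H'.
  have {}H' : p ^+ 2 * aform e x + q ^+ 2 * aform e y <=
      lambda2 R e * (p ^+ 2 * nsq x + q ^+ 2 * nsq y).
    apply: H'; rewrite -[RHS]pq /a /b !mulr_sumr -big_split /=.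
    by apply: eq_bigr => i _; ring.
  rewrite -(ler_pM2r pos); apply: le_trans H'.
  rewrite mulrDr !(mulrCA tau); apply: lerD; by rewrite ler_wpM2l ?sqr_ge0.
have [b0|b0] := eqVneq b 0.
  by apply: (key 0 1); rewrite ?b0 ?mul0r ?mulr0 ?addr0 // expr0n expr1n /= mul0r mul1r add0r.
apply: (key b (- a)); first by ring.
apply: ltr_pwDl; last by rewrite mulr_ge0 ?sqr_ge0 ?nsq_ge0.
by rewrite mulr_gt0 // exprn_even_gt0.
Qed.

Section Connected.
Hypothesis e_conn : forall u v, connect e u v.
Hypothesis T_gt1 : (1 < #|T|)%N.

Lemma lform_eq0_const x : lform e x <= 0 -> forall u v, x u = x v.
Proof.
move=> x0; have step u v : e u v -> x u = x v.
  move=> euv; apply/eqP; rewrite -subr_eq0 -sqrf_eq0 eq_le sqr_ge0 andbT.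
  apply: le_trans x0; rewrite /lform; set S := \sum_u _.
  have : (x u - x v) ^+ 2 + (x u - x v) ^+ 2 <= S.
    have nn a b : 0 <= (e a b)%:R * (x a - x b) ^+ 2 :> R.
      by rewrite mulr_ge0 ?ler0n ?sqr_ge0.
    have ss a : 0 <= \sum_b (e a b)%:R * (x a - x b) ^+ 2 by apply: sumr_ge0 => b _.
    have [->|uv] := eqVneq u v.
      by rewrite subrr expr0n /= addr0; apply: sumr_ge0 => a _.
    rewrite /S (bigD1 u) //=; apply: lerD.
      by rewrite (bigD1 v) //= euv mul1r ler_wpDr // sumr_ge0.
    rewrite (bigD1 v) ?[v == u]eq_sym //=; apply: ler_wpDr; first exact: sumr_ge0.
    rewrite (bigD1 u) //= e_sym euv mul1r -[x u - x v]opprB sqrrN ler_wpDr //.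
    by rewrite sumr_ge0.
  lra.
move=> u v; have /connectP[p pp ->] := e_conn u v.
by elim: p u pp => [|w p IH] u //= /andP[/step -> /IH].
Qed.

(** Otherwise both orthonormal eigenvectors have nonpositive form, hence are constant on the
    connected graph, and two nonzero constants are not orthogonal. *)
Lemma mu2_gt0 : 0 < mu2 R e.
Proof.
have [u1 [u2 [l1 [[E1 E2 l12] [n1 n2 u12 _]]]]] := mu2_vectors R e_sym T_gt1.
rewrite ltNge; apply/negP => m0.
have eig (u : T -> R) l : (forall t, \sum_v (e t v)%:R * (u t - u v) = l * u t) ->
    lform e u = l * nsq u.
  move=> E; rewrite lform_sum // /nsq mulr_sumr; apply: eq_bigr => t _.
  by rewrite E; ring.
have /lform_eq0_const c1 : lform e u1 <= 0.
  by rewrite (eig _ _ E1) n1 mulr1 (le_trans l12).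
have /lform_eq0_const c2 : lform e u2 <= 0 by rewrite (eig _ _ E2) n2 mulr1.
have /card_gt0P[t _] : (0 < #|T|)%N by exact: ltnW.
have N1 : nsq u1 = u1 t ^+ 2 * #|T|%:R.
  by rewrite /nsq (eq_bigr (fun=> u1 t ^+ 2)) ?sumr_const ?mulr_natr // => v _; rewrite (c1 v t).
have N2 : nsq u2 = u2 t ^+ 2 * #|T|%:R.
  by rewrite /nsq (eq_bigr (fun=> u2 t ^+ 2)) ?sumr_const ?mulr_natr // => v _; rewrite (c2 v t).
have N12 : u1 t * u2 t * #|T|%:R = 0.
  rewrite -u12 (eq_bigr (fun=> u1 t * u2 t)) ?sumr_const ?mulr_natr // => v _.
  by rewrite (c1 v t) (c2 v t).
have : nsq u1 * nsq u2 = 0.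
  transitivity ((u1 t * u2 t * #|T|%:R) ^+ 2); first by rewrite N1 N2; ring.
  by rewrite N12 expr0n.
by rewrite n1 n2 mulr1 => /eqP; rewrite oner_eq0.
Qed.

(** The vector [u1] is not known to be constant, so x is moved into its orthogonal complement as p -
    q x. The added constant leaves the Dirichlet form unchanged and, since x has sum 0, can only
    increase the norm. *)
Lemma mu2_rayleigh x : \sum_t x t = 0 -> mu2 R e * nsq x <= lform e x.
Proof.
move=> x0; have m0 := mu2_gt0.
have [u1 [u2 [l1 [_ [_ _ _ H]]]]] := mu2_vectors R e_sym T_gt1.
pose p := \sum_t u1 t * x t; pose q := \sum_t u1 t.
have := H (fun t => p - q * x t).
have -> : lform e (fun t => p - q * x t) = q ^+ 2 * lform e x.
  rewrite /lform mulrCA; congr (_ * _); rewrite mulr_sumr; apply: eq_bigr => u _.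
  by rewrite mulr_sumr; apply: eq_bigr => v _; ring.
have -> : nsq (fun t => p - q * x t) = p ^+ 2 * #|T|%:R + q ^+ 2 * nsq x.
  rewrite /nsq; transitivity (\sum_t (p ^+ 2 - (p * q *+ 2) * x t + q ^+ 2 * x t ^+ 2)).
    by apply: eq_bigr => t _; ring.
  rewrite big_split sumrB /= -!mulr_sumr x0 mulr0 subr0 sumr_const; congr (_ + _).
  by rewrite -[#|xpredT|]/#|T| mulr_natr mulrnAr expr2.
have H0 : \sum_t u1 t * (p - q * x t) = 0.
  under eq_bigr => t _ do rewrite mulrBr mulrCA.
  by rewrite sumrB -mulr_suml -mulr_sumr -/p -/q mulrC subrr.
move=> /(_ H0) {H0} H0; have T0 : 0 < #|T|%:R :> R by rewrite ltr0n ltnW.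
have [p0|p0] := eqVneq p 0; first exact: (H x p0).
have pp : 0 < mu2 R e * (p ^+ 2 * #|T|%:R).
  apply: mulr_gt0 => //; apply: mulr_gt0 => //; by rewrite exprn_even_gt0.
rewrite leNgt; apply/negP => lt; have := sqr_ge0 q; have := nsq_ge0 x; nra.
Qed.

Lemma fiedler_sum0 x : (forall t, \sum_v (e t v)%:R * (x t - x v) = mu2 R e * x t) ->
  \sum_t x t = 0.
Proof.
move=> E; apply: (mulfI (x := mu2 R e)); first by rewrite gt_eqF ?mu2_gt0.
rewrite mulr0 mulr_sumr; under eq_bigr => t _ do rewrite -E.
set S := \sum_t _; have SN : S = - S.
  rewrite {1}/S exchange_big /= /S -sumrN; apply: eq_bigr => t _.
  by rewrite -sumrN; apply: eq_bigr => v _; rewrite e_sym; ring.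
by move: SN => /eqP; rewrite -addr_eq0 -mulr2n mulrn_eq0 => /eqP.
Qed.

Lemma fiedler_exists : exists f : 'cV[R]_#|T|, is_fiedler e f.
Proof.
have [u1 [u2 [l1 [[E1 E2 l12] [n1 n2 u12 _]]]]] := mu2_vectors R e_sym T_gt1.
exists (colf u2); split.
  apply/eqP => c0; have : nsq u2 = 0.
    by rewrite nsqE c0 /dotv big1 // => i _; rewrite mxE mul0r.
  by rewrite n2 => /eqP; rewrite oner_eq0.
rewrite laplacian_colf; apply/colP => i; rewrite !mxE.
by rewrite -E2; apply: eq_bigr.
Qed.

(** Otherwise a g - b |h|, with a and b chosen to make its sum 0, has quotient below mu_2. The
    absolute value makes the total of h positive, hence a nonzero, without raising the form. *)
Lemma mu2_separated g h : separated e g h -> (forall t, 0 <= g t) ->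
  0 < nsq g -> lform e g <= mu2 R e * nsq g -> mu2 R e * nsq h <= lform e h.
Proof.
move=> gh g_ge0 g0 lg; rewrite leNgt; apply/negP => lh.
have h0 : 0 < nsq h.
  rewrite lt_def nsq_ge0 andbT; apply: contraTneq lh => h0.
  by rewrite h0 mulr0 -leNgt lform_ge0.
pose h' t := `|h t|.
have gh' : separated e g h'.
  have nn u v : g u * h v = 0 -> g u * h' v = 0.
    by move=> uv; rewrite /h' -[g u]ger0_norm // -normrM uv normr0.
  by split=> [u|u v euv]; apply: nn; [exact: gh.1 | exact: gh.2].
pose a := \sum_t h' t; pose b := \sum_t g t.
have a0 : 0 < a.
  have [t ht] := nsq_neq0 h0; rewrite /a (bigD1 t) //= ltr_pwDl ?normr_gt0 //.
  by apply: sumr_ge0 => u _; exact: normr_ge0.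
have := mu2_rayleigh (x := fun t => a * g t + (- b) * h' t).
rewrite (lform_separated e_sym) // (nsq_separated _ _ gh') nsq_norm => H.
have {}H : mu2 R e * (a ^+ 2 * nsq g + (- b) ^+ 2 * nsq h) <=
    a ^+ 2 * lform e g + (- b) ^+ 2 * lform e h'.
  by apply: H; rewrite big_split /= -!mulr_sumr -/a -/b; ring.
have lh' := lform_norm e h; rewrite -/h' in lh'.
have b0 : 0 < b.
  have [t ht] := nsq_neq0 g0; rewrite /b (bigD1 t) //= ltr_pwDl ?lt_def ?ht ?g_ge0 //.
  by apply: sumr_ge0.
have A := exprn_gt0 2 a0; have B : 0 < (- b) ^+ 2 by rewrite sqrrN exprn_gt0.
have : (- b) ^+ 2 * lform e h' < (- b) ^+ 2 * (mu2 R e * nsq h).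
  by rewrite ltr_pM2l // (le_lt_trans lh').
have : a ^+ 2 * lform e g <= a ^+ 2 * (mu2 R e * nsq g) by rewrite ler_pM2l.
lra.
Qed.

End Connected.

Section Cut.
Variables (K : {set T}) (s p : T) (rho : R).
Hypotheses (T_gt1 : (1 < #|T|)%N) (sK : s \notin K) (pK : p \in K) (esp : e s p).
Hypothesis s_nbr : forall v, v \in K -> e s v -> v = p.
(** Connectedness of K in the form in which it is used: the zero set of an eigenvector contains p
    and propagates along edges into K. *)
Hypothesis K_conn : forall Z : {set T}, p \in Z ->
  (forall u v, u \in Z -> v \in K -> e u v -> v \in Z) -> K \subset Z.
Hypothesis K_sep : forall u v, u \in K -> v \notin K -> v != s -> ~~ e u v.
Hypothesis K_form : forall x, (forall t, t \notin K -> x t = 0) ->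
  aform e x <= rho * nsq x.
Hypothesis rest_form : forall x, x s = 0 -> (forall t, t \in K -> x t = 0) ->
  0 < nsq x -> aform e x < rho * nsq x.

(* Otherwise some combination of the first two eigenvectors that vanishes at s
   attains rho; it is then an eigenvector supported on K, of constant sign
   there by Perron-Frobenius, while its value at p, the only neighbour of s in
   K, is 0. *)
Lemma lambda2_lt_cut : lambda2 R e < rho.
Proof.
rewrite ltNge; apply/negP => rho_le.
have [u1 [u2 [l1 [[E1 E2 l12] [n1 n2 u12 _]]]]] := lambda2_vectors R e_sym T_gt1.
have [a [b [abs ab0]]] : exists a b : R, a * u1 s + b * u2 s = 0 /\ 0 < a ^+ 2 + b ^+ 2.
  have [u1s|u1s] := eqVneq (u1 s) 0.
    have [u2s|u2s] := eqVneq (u2 s) 0.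
      by exists 0, 1; rewrite u2s; split; [ring | rewrite expr0n expr1n add0r].
    by exists 1, 0; rewrite u1s; split; [ring | rewrite expr0n expr1n addr0].
  exists (u2 s), (- u1 s); split; first by ring.
  by rewrite ltr_wpDl ?sqr_ge0 // exprn_even_gt0 //= oppr_eq0.
pose x t := a * u1 t + b * u2 t.
have nx : nsq x = a ^+ 2 + b ^+ 2.
  transitivity (a ^+ 2 * nsq u1 + b ^+ 2 * nsq u2 + (a * b *+ 2) * \sum_t u1 t * u2 t).
    by rewrite /nsq !mulr_sumr -!big_split /=; apply: eq_bigr => t _; rewrite /x; ring.
  by rewrite n1 n2 u12; ring.
have Ax t : \sum_v (e t v)%:R * x v = a * l1 * u1 t + b * lambda2 R e * u2 t.
  rewrite -!mulrA -E1 -E2 !mulr_sumr -big_split /=; apply: eq_bigr => v _.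
  by rewrite /x; ring.
have ax : aform e x = a ^+ 2 * l1 + b ^+ 2 * lambda2 R e.
  rewrite aform_sum; under eq_bigr => t _ do rewrite Ax.
  transitivity (a ^+ 2 * l1 * nsq u1 + b ^+ 2 * lambda2 R e * nsq u2 +
     (a * b * (l1 + lambda2 R e)) * \sum_t u1 t * u2 t).
    by rewrite /nsq !mulr_sumr -!big_split /=; apply: eq_bigr => t _; rewrite /x; ring.
  by rewrite n1 n2 u12; ring.
have xs : x s = 0 by [].
pose xK t := if t \in K then x t else 0; pose xR t := if t \in K then 0 else x t.
have sepKR : separated e xK xR.
  split=> [u|u v euv]; rewrite /xK /xR; first by case: ifP; rewrite ?mulr0 ?mul0r.
  case: ifP => uK; rewrite ?mul0r //; case: ifP => vK; rewrite ?mulr0 //.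
  have [->|vs] := eqVneq v s; first by rewrite xs mulr0.
  by have := K_sep uK (negbT vK) vs; rewrite euv.
have xKR : x = (fun t => 1 * xK t + 1 * xR t).
  by apply/funext => t; rewrite !mul1r /xK /xR; case: ifP; rewrite ?addr0 ?add0r.
have nKR : nsq x = nsq xK + nsq xR.
  by rewrite {1}xKR (nsq_separated _ _ sepKR) expr1n !mul1r.
have aKR : aform e x = aform e xK + aform e xR.
  by rewrite {1}xKR (aform_separated e_sym _ _ sepKR) expr1n !mul1r.
have aK : aform e xK <= rho * nsq xK.
  by apply: K_form => t /negbTE tK; rewrite /xK tK.
have la : lambda2 R e * nsq x <= aform e x.
  rewrite nx ax; have : a ^+ 2 * lambda2 R e <= a ^+ 2 * l1 by rewrite ler_wpM2l ?sqr_ge0.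
  lra.
have rx : rho * nsq x <= lambda2 R e * nsq x by rewrite ler_wpM2r ?nsq_ge0.
have nR0 : nsq xR = 0.
  apply/eqP; rewrite eq_le nsq_ge0 andbT leNgt; apply/negP => nR.
  have : aform e xR < rho * nsq xR.
    by apply: rest_form => // [|t tK]; rewrite /xR ?(negbTE sK) ?tK.
  by rewrite nKR in la rx; rewrite aKR in la; lra.
have xR0 := nsq_eq0 nR0.
have x_out t : t \notin K -> x t = 0.
  by move=> tK; have := xR0 t; rewrite /xR (negbTE tK).
have ex : aform e x = rho * nsq x.
  apply/eqP; rewrite eq_le K_form //=; exact: le_trans rx la.
have nx0 : 0 < nsq x by rewrite nx.
(* Equality throughout forces a = 0 or l1 = lambda_2, so x is an eigenvector for lambda_2; its
   equation at s, where x vanishes, reduces to the single term x p. *)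
have xp : x p = 0.
  have al : a * (l1 - lambda2 R e) = 0.
    have : a ^+ 2 * (l1 - lambda2 R e) = 0.
      have : a ^+ 2 * l1 + b ^+ 2 * lambda2 R e <= lambda2 R e * (a ^+ 2 + b ^+ 2).
        by rewrite -ax -nx ex.
      have : 0 <= a ^+ 2 * (l1 - lambda2 R e) by rewrite mulr_ge0 ?sqr_ge0 ?subr_ge0.
      lra.
    by move=> /eqP; rewrite mulf_eq0 sqrf_eq0 -mulf_eq0 => /eqP.
  have := Ax s; rewrite (bigD1 p) //= esp mul1r big1 => [|v vp].
    rewrite addr0 => ->; move: xs; rewrite /x => xs.
    transitivity (a * (l1 - lambda2 R e) * u1 s + lambda2 R e * (a * u1 s + b * u2 s)).
      by ring.
    by rewrite al xs; ring.
  have [vK|/x_out ->] := boolP (v \in K); last by rewrite mulr0.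
  by case esv: (e s v); rewrite ?mul0r //; rewrite (s_nbr vK esv) eqxx in vp.
pose Z := [set v | x v == 0]%SET.
have : K \subset Z.
  apply: K_conn => [|u v]; rewrite !inE ?xp // => /eqP xu vK euv.
  (* A zero u next to a nonzero v: raising |x| by t at u gains at least 2 t |x v| in the form but
     costs only t^2 in the norm. This t is small enough that rho t < |x v|, so the bound on K
     fails. *)
  apply/negPn/negP => xv; pose t := `|x v| / (`|rho| + 1).
  have [uK|uK] := boolP (u \in K); last first.
    have us : u != s -> False.
      by move=> us; have := K_sep vK uK us; rewrite e_sym euv.
    have /eqP us' : u == s by apply/negPn/negP => /us.
    by move: xv; rewrite us' in euv; rewrite (s_nbr vK euv) xp eqxx.
  pose y w := `|x w| + t * (w == u)%:R.
  have t0 : 0 < t by rewrite divr_gt0 ?normr_gt0 // ltr_wpDl ?normr_ge0.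
  have ny : nsq y = nsq x + t ^+ 2.
    rewrite -[nsq x]nsq_norm /nsq (bigD1 u) //= [in RHS](bigD1 u) //= /y xu normr0 eqxx.
    rewrite mulr1 (eq_bigr (fun w => `|x w| ^+ 2)) => [|w /negbTE ->]; first by ring.
    by rewrite mulr0 addr0.
  have ay : aform e x + 2 * t * `|x v| <= aform e y.
    apply: (@le_trans _ _ (aform e (fun w => `|x w|) + 2 * t * `|x v|)).
      by rewrite lerD2r (le_trans (ler_norm _)) ?norm_aform.
    pose S1 := \sum_c \sum_d (e c d)%:R * (t * (c == u)%:R * `|x d|).
    pose S2 := \sum_c \sum_d (e c d)%:R * (t * (d == u)%:R * `|x c|).
    have S21 : S2 = S1.
      rewrite /S2 /S1 exchange_big /=; apply: eq_bigr => c _; apply: eq_bigr => d _.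
      by rewrite [e d c]e_sym.
    have nn c d : 0 <= (e c d)%:R * (t * (c == u)%:R * `|x d|).
      apply: mulr_ge0; first exact: ler0n.
      apply: mulr_ge0 => //; apply: mulr_ge0; [exact: ltW | exact: ler0n].
    have S1ge : t * `|x v| <= S1.
      apply: (@le_trans _ _ (\sum_d (e u d)%:R * (t * (u == u)%:R * `|x d|))).
        rewrite (bigD1 v) //= euv eqxx mul1r mulr1 ler_wpDr // sumr_ge0 // => d _.
        by have := nn u d; rewrite eqxx mulr1.
      by rewrite /S1 [in leRHS](bigD1 u) //= ler_wpDr // sumr_ge0 // => c _; apply: sumr_ge0.
    apply: (@le_trans _ _ (aform e (fun w => `|x w|) + (S1 + S2))).
      by rewrite S21 lerD2l; move: S1ge; lra.
    rewrite /aform /S1 /S2 -!big_split /=; apply: ler_sum => c _.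
    rewrite -!big_split /=; apply: ler_sum => d _.
    rewrite -!mulrDr ler_wpM2l ?ler0n // /y -subr_ge0.
    rewrite [X in 0 <= X](_ : _ = t * t * (c == u)%:R * (d == u)%:R); last by ring.
    by do 2 (apply: mulr_ge0; last exact: ler0n); apply: mulr_ge0; exact: ltW.
  have : aform e y <= rho * nsq y.
    apply: K_form => w wK; rewrite /y x_out // normr0 add0r.
    by have [wu|] := eqVneq w u; rewrite ?mulr0 //; rewrite wu uK in wK.
  rewrite ny ex in ay *; move=> ay'.
  have H : 2 * `|x v| <= rho * t by rewrite -(ler_pM2r t0); lra.
  have : rho * t <= `|rho| * t by rewrite ler_pM2r ?ler_norm.
  have : (`|rho| + 1) * t = `|x v| by rewrite /t mulrC divfK // gt_eqF // ltr_wpDl ?normr_ge0.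
  have : 0 < `|x v| by rewrite normr_gt0.
  lra.
move=> /fintype.subsetP KZ; move: nx0; rewrite /nsq big1 ?ltxx // => t _.
have [/KZ|/x_out ->] := boolP (t \in K); last by rewrite expr0n.
by rewrite inE => /eqP ->; rewrite expr0n.
Qed.
End Cut.
End SecondEigenvalue.

(** * Distances and rooted trees *)

Lemma bigmin_attained (I : finType) (P : pred I) (F : I -> nat) (m : nat) :
  \big[Order.min/m]_(i | P i) F i = m \/
  exists2 i, P i & \big[Order.min/m]_(i | P i) F i = F i.
Proof.
elim/big_ind: _ => [|a b Ha Hb|i Pi]; first by left.
  by rewrite minEle; case: ifP.
by right; exists i.
Qed.

Section Distance.
Variables (T : finType) (e : rel T).

(** A walk shortens to one without repetitions, whose length is below #|T| and so lies in the range
    of the minimum defining [gdist]. *)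
Lemma gdist_le x p : path e x p -> gdist e x (last x p) <= size p.
Proof.
move=> pp; case: (shortenP pp) => p' pp' up' sub.
have sp' : size p' <= size p by rewrite uniq_leq_size //; case/andP: up'.
have lt : size p' < #|T| by have := max_card (mem (x :: p')); rewrite (card_uniqP up').
apply: leq_trans sp'; rewrite /gdist -leEnat.
apply: (@bigmin_inf _ _ _ _ (Ordinal lt)); last exact: lexx.
by apply/existsP; exists (in_tuple p'); rewrite pp' eqxx.
Qed.

Lemma gdist_walk x y : connect e x y ->
  exists p, [/\ path e x p, last x p = y & size p = gdist e x y].
Proof.
move=> /connectP[p0 pp0 ->].
have [E|[k /existsP[p /andP[pp /eqP pl]] E]] := bigmin_attained
   (fun k : 'I_#|T| => [exists p : k.-tuple T, path e x p && (last x p == last x p0)])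
   (fun k => k : nat) #|T|; last by exists p; rewrite size_tuple /gdist E.
case: (shortenP pp0) E => p' pp' up' _ E.
have : size p' < #|T| by have := max_card (mem (x :: p')); rewrite (card_uniqP up').
by move=> lt; have := gdist_le pp'; rewrite /gdist E leqNgt lt.
Qed.

Lemma gdistC x y : symmetric e -> connect e x y -> gdist e x y = gdist e y x.
Proof.
move=> e_sym cxy; have cyx : connect e y x by rewrite (sym_connect_sym e_sym).
have le u v : connect e u v -> gdist e v u <= gdist e u v.
  move=> /gdist_walk [p [pp lp <-]].
  have : path e v (rev (belast u p)) by rewrite -lp rev_path; under eq_path => a b do rewrite e_sym.
  move=> /gdist_le; rewrite size_rev size_belast; case: p pp lp => [|z p] /= _ <- //.
  by rewrite rev_cons last_rcons.
by apply/eqP; rewrite eqn_leq !le.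
Qed.

Lemma gdist_lipschitz x y (f : T -> nat) :
  (forall u v, e u v -> f v <= (f u).+1) -> connect e x y ->
  f y <= f x + gdist e x y.
Proof.
move=> f1 /gdist_walk [p [pp <- sp]]; rewrite -{}sp; elim: p x pp => [|z p IH] x //=.
  by rewrite addn0.
by move=> /andP[/f1 xz /IH]; lia.
Qed.

End Distance.

(* The value of [par] at the root r is irrelevant. *)
Definition rooted (T : finType) (e : rel T) (r : T) (par : T -> T) (dep : T -> nat) :=
  [/\ dep r = 0, forall x, x != r -> dep x = (dep (par x)).+1 &
   forall x y, e x y = ((x != r) && (par x == y)) || ((y != r) && (par y == x))].

(** Two distinct neighbours of x joined by a walk avoiding x would close a cycle of length at least
    3. *)
Lemma acyclic_nbr_eq (T : finType) (e : rel T) x y z p :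
  symmetric e -> acyclic e -> e x y -> e x z ->
  path e y p -> last y p = z -> x \notin y :: p -> y = z.
Proof.
move=> e_sym acyc exy exz pp; case: (shortenP pp) => p' pp' up' sub lp xp.
have xp' : x \notin y :: p'.
  by apply: contra xp; rewrite !inE => /orP[->//|/sub ->]; rewrite orbT.
case: p' pp' up' lp xp' {sub} => [//|w p'] pp' up' lp xp'.
have : ucycle e (x :: y :: w :: p').
  apply/andP; split; last by rewrite cons_uniq xp'.
  rewrite -[cycle _ _]/(path e x (rcons (y :: w :: p') x)) rcons_path /=.
  by move: pp' lp => /= /andP[-> ->] ->; rewrite exy e_sym exz.
by move=> /acyc.
Qed.

(** The parent is the neighbour of smaller depth. It is unique because two neighbours no deeper than
    x are joined through r by shortest walks, which avoid x. *)
Lemma tree_rooted (T : finType) (e : rel T) (r : T) : is_tree e ->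
  exists par, rooted e r par (gdist e r).
Proof.
move=> [e_sym e_irr /andP[_ /forallP conn'] acyc].
have conn x y : connect e x y by have /forallP := conn' x.
pose dep := gdist e r; rewrite -/dep.
have dep_step x y : e x y -> dep y <= (dep x).+1.
  move=> exy; have [p [pp lp sp]] := gdist_walk (conn r x).
  have : path e r (rcons p y) by rewrite rcons_path pp lp.
  by move=> /gdist_le; rewrite last_rcons size_rcons sp.
have dep_r : dep r = 0 by have := @gdist_le _ e r [::] isT; rewrite leqn0 => /eqP.
have dep0 x : dep x = 0 -> x = r.
  by have [p [_ <- sp]] := gdist_walk (conn r x) => /eqP; rewrite -/dep in sp; rewrite -sp size_eq0 => /eqP ->.
have up x : x != r -> exists2 y, e x y & dep x = (dep y).+1.
  have [p] := gdist_walk (conn r x); case/lastP: p => [|p w] [].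
    by move=> _ <-; rewrite eqxx.
  rewrite last_rcons rcons_path size_rcons => /andP[pp ex] wx sp xr; subst w.
  exists (last r p); first by rewrite e_sym.
  have := gdist_le pp; have := dep_step _ _ ex; rewrite -/dep; rewrite -/dep in sp; lia.
have avoid x y : e x y -> dep y <= dep x ->
    exists p, [/\ path e r p, last r p = y & x \notin r :: p].
  move=> exy yx; have [p [pp lp sp]] := gdist_walk (conn r y).
  exists p; split=> //; apply/negP => xp.
  case/splitPl: xp pp lp sp => p1 p2 lp1; rewrite cat_path last_cat size_cat lp1.
  move=> /andP[pp1 pp2] lp2 sp; have := gdist_le pp1; rewrite lp1 -/dep.
  rewrite -/dep in sp; case: p2 pp2 lp2 sp => [|w p2] /= _ lp2 sp; last lia.
  by rewrite lp2 e_irr in exy.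
have uniq_up x y z : e x y -> e x z -> dep y <= dep x -> dep z <= dep x -> y = z.
  move=> exy exz yx zx; have [p [pp lp xp]] := avoid x y exy yx.
  have [q [qq lq xq]] := avoid x z exz zx.
  apply: (acyclic_nbr_eq (p := rev (belast r p) ++ q) e_sym acyc exy exz).
  - rewrite cat_path -lp rev_path; under eq_path => a b do rewrite e_sym.
    rewrite pp /=; case: p {pp lp xp} => [|w p] //=.
    by rewrite rev_cons last_rcons.
  - rewrite last_cat -lp; case: p {pp lp xp} => [|w p] //=.
    by rewrite rev_cons last_rcons.
  - rewrite inE negb_or mem_cat mem_rev negb_or.
    move: xp; rewrite lastI mem_rcons inE negb_or lp => /andP[-> ->] /=.
    by move: xq; rewrite inE negb_or => /andP[].
pose par x := odflt x [pick y | e x y && (dep y < dep x)].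
have parP x : x != r -> e x (par x) /\ dep x = (dep (par x)).+1.
  move=> xr; rewrite /par; case: pickP => [y /andP[exy yx]|H].
    by split=> //=; have := dep_step y x; rewrite e_sym exy => /(_ isT) /=; lia.
  by have [y exy yx] := up x xr; have := H y; rewrite exy yx ltnSn.
(* Equal depths are allowed here, so this also excludes edges inside a level. *)
have par_uniq x y : e x y -> dep y <= dep x -> (x != r) && (par x == y).
  move=> exy yx; have xr : x != r.
    apply/eqP => xr; subst x; rewrite dep_r leqn0 in yx; move/eqP/dep0: yx => yr.
    by rewrite yr e_irr in exy.
  have [exp dxp] := parP x xr; rewrite xr /=; apply/eqP.
  by apply: (uniq_up x) => //; rewrite dxp.
exists par; split=> // [x xr|x y]; first by have [] := parP x xr.
apply/idP/idP => [exy|/orP[] /andP[/parP[exp _] /eqP <-] //]; last by rewrite e_sym.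
case: (leqP (dep y) (dep x)) => [/(par_uniq _ _ exy) -> //|/ltnW xy].
by rewrite orbC par_uniq // e_sym.
Qed.

Section Rooted.
Variables (T : finType) (e : rel T) (r : T) (par : T -> T) (dep : T -> nat).
Hypothesis rt : rooted e r par dep.

Let dep_r : dep r = 0. Proof. by case: rt. Qed.
Lemma dep_par x : x != r -> dep x = (dep (par x)).+1.
Proof. by case: rt => _ H _; exact: H. Qed.
Lemma rootedE x y :
  e x y = ((x != r) && (par x == y)) || ((y != r) && (par y == x)).
Proof. by case: rt => _ _ H; exact: H. Qed.

Lemma rooted_ind (P : T -> Prop) :
  P r -> (forall x, x != r -> P (par x) -> P x) -> forall x, P x.
Proof.
move=> Pr Pp x; have [k] := ubnP (dep x); elim: k x => // k IH x dx.
have [->//|xr] := eqVneq x r; apply: Pp => //; apply: IH.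
by move: dx; rewrite (dep_par xr).
Qed.

Lemma rooted_sym : symmetric e.
Proof. by move=> x y; rewrite !rootedE orbC. Qed.

Lemma rooted_irr : irreflexive e.
Proof.
move=> x; rewrite rootedE orbb; apply/negP => /andP[xr /eqP px].
by have := dep_par xr; rewrite px; lia.
Qed.

Lemma par_edge x : x != r -> e x (par x).
Proof. by move=> xr; rewrite rootedE xr eqxx. Qed.

Lemma rooted_connect x y : connect e x y.
Proof.
have H z : connect e z r.
  elim/rooted_ind: z => [|z zr]; first exact: connect0.
  exact: connect_trans (connect1 (par_edge zr)).
apply: connect_trans (H x) _; by rewrite (sym_connect_sym rooted_sym).
Qed.

(** On a cycle, both neighbours of a deepest vertex would have to be its parent. *)
Lemma rooted_tree : is_tree e.
Proof.
split; [exact: rooted_sym | exact: rooted_irr | |].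
  apply/andP; split; first by apply/card_gt0P; exists r.
  by apply/forallP => x; apply/forallP => y; exact: rooted_connect.
move=> c uc; rewrite leqNgt; apply/negP => c3.
have [x0 x0c] : exists x0, x0 \in c.
  by case: c {uc} c3 => [//|x0 c] _; exists x0; rewrite inE eqxx.
have [x xc xmax] := @arg_maxnP _ x0 (mem c) dep x0c.
have par_of y : e x y -> y \in c -> y = par x.
  rewrite rootedE => /orP[] /andP[nr /eqP pe] // yc.
  by have := xmax _ yc; have := dep_par nr; rewrite pe /=; lia.
have [i c' rc] := rot_to xc.
have mc y : y \in x :: c' -> y \in c by rewrite -rc mem_rot.
move: uc; rewrite -(rot_ucycle i) rc => /andP[]; have : 3 <= size (x :: c').
  by rewrite -rc size_rot.
case: c' mc {rc} => [//|y [//|w s]] mc _ /=.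
rewrite rcons_path /= => /andP[exy /and3P[_ _ ezx]] /and4P[_ yw _ _].
have yp := par_of y exy; have zp := par_of (last w s).
move: yw; rewrite {1}yp; last by apply: mc; rewrite !inE eqxx orbT.
rewrite -zp ?mem_last //; first by rewrite rooted_sym.
by apply: mc; rewrite 2!inE mem_last !orbT.
Qed.

(** The subtree below x, x included. The depths dictate the number of parent steps, and the guard
    keeps the subtraction from truncating; [par] is never applied at the root. *)
Definition desc x : {set T} := [set y | (dep x <= dep y) && (iter (dep y - dep x) par y == x)].

Lemma desc_refl x : x \in desc x.
Proof. by rewrite inE leqnn subnn /= eqxx. Qed.

Lemma dep_desc x y : y \in desc x -> dep x <= dep y.
Proof. by rewrite inE => /andP[]. Qed.

Lemma dep_eq0 x : dep x = 0 -> x = r.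
Proof. by move=> x0; apply/eqP/negPn/negP => /dep_par; rewrite x0. Qed.

Lemma dep_iter_par i y : i <= dep y -> dep (iter i par y) = dep y - i.
Proof.
elim: i => [|i IH] iy; first by rewrite subn0.
have {}IH := IH (ltnW iy); have xr : iter i par y != r.
  by apply/eqP => xr; move: IH; rewrite xr dep_r; lia.
by have := dep_par xr; rewrite IH /=; lia.
Qed.

Lemma desc_root x : (r \in desc x) = (x == r).
Proof.
apply/idP/eqP => [/dep_desc|->]; last exact: desc_refl.
by rewrite dep_r leqn0 => /eqP /dep_eq0.
Qed.

Lemma desc_par x y : y != r -> (y \in desc x) = (y == x) || (par y \in desc x).
Proof.
move=> yr; have dy := dep_par yr; rewrite !inE.
case: (leqP (dep x) (dep (par y))) => [le|gt].
  have /negPf -> : y != x by apply/eqP => yx; move: le; rewrite -yx dy ltnn.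
  by rewrite dy leqW //= subSn // iterSr.
rewrite orbF; case: (leqP (dep x) (dep y)) => [le|lt] /=.
  by have -> : dep y - dep x = 0 by lia.
by apply/esym/negP => /eqP yx; subst y; rewrite ltnn in lt.
Qed.

Lemma desc_trans x y : y \in desc x -> desc y \subset desc x.
Proof.
move=> yx; apply/fintype.subsetP => z; elim/rooted_ind: z => [|z zr IH].
  by rewrite desc_root => /eqP <-.
by rewrite desc_par // => /orP[/eqP ->//|/IH]; rewrite [in X in _ -> X]desc_par // orbC => ->.
Qed.

Lemma desc_comparable x y z : z \in desc x -> z \in desc y ->
  x \in desc y \/ y \in desc x.
Proof.
elim/rooted_ind: z => [|z zr IH].
  by rewrite !desc_root => /eqP -> /eqP ->; left; exact: desc_refl.
move=> zx zy; move: (zx) (zy); rewrite (desc_par x zr) (desc_par y zr) => /orP[/eqP <-|zx'].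
  by left.
by case/orP => [/eqP <-|zy']; [right | exact: IH].
Qed.

Lemma par_notin_desc x : x != r -> par x \notin desc x.
Proof. by move=> /dep_par dx; apply/negP => /dep_desc; rewrite dx ltnn. Qed.

Lemma desc_siblings x y z : x != r -> y != r -> par x = par y -> x != y ->
  z \in desc x -> z \notin desc y.
Proof.
move=> xr yr pxy xy zx; apply/negP => zy.
have [xy'|yx] := desc_comparable zx zy.
  by move: xy'; rewrite desc_par // (negPf xy) pxy (negPf (par_notin_desc yr)).
by move: yx; rewrite desc_par // eq_sym (negPf xy) -pxy (negPf (par_notin_desc xr)).
Qed.

Lemma desc_boundary x y z : e y z -> y \in desc x -> z \notin desc x ->
  [/\ x != r, y = x & z = par x].
Proof.
rewrite rootedE => /orP[] /andP[nr /eqP <-] yx; last first.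
  by rewrite desc_par // yx orbT.
move=> px; move: yx; rewrite desc_par // (negPf px) orbF => /eqP yx.
by rewrite -yx.
Qed.

Local Open Scope ring_scope.

(** Each edge joins exactly one non-root vertex to its parent, since depth excludes that both ends
    are parents of each other. *)
Lemma edge_sum (R : realType) (F : T -> T -> R) :
  \sum_u \sum_v (e u v)%:R * F u v = \sum_(x | x != r) (F x (par x) + F (par x) x).
Proof.
rewrite big_split /=.
have -> : \sum_(x | x != r) F x (par x) =
    \sum_u \sum_v ((u != r) && (par u == v))%:R * F u v.
  rewrite big_mkcond; apply: eq_bigr => u _; case: eqVneq => [_|ur] /=.
    by rewrite big1 // => v _; rewrite mul0r.
  rewrite (bigD1 (par u)) //= eqxx mul1r big1 ?addr0 // => v /negPf vp.
  by rewrite eq_sym vp mul0r.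
have -> : \sum_(x | x != r) F (par x) x =
    \sum_u \sum_v ((v != r) && (par v == u))%:R * F u v.
  rewrite exchange_big /= big_mkcond; apply: eq_bigr => u _; case: eqVneq => [_|ur] /=.
    by rewrite big1 // => v _; rewrite mul0r.
  rewrite (bigD1 (par u)) //= eqxx mul1r big1 ?addr0 // => v /negPf vp.
  by rewrite eq_sym vp mul0r.
rewrite -big_split /=; apply: eq_bigr => u _; rewrite -big_split /=.
apply: eq_bigr => v _; rewrite -mulrDl; congr (_ * _); rewrite rootedE -natrD.
congr _%:R; case A: (_ && _); case B: (_ && _) => //; exfalso.
case/andP: A => ur /eqP uv; case/andP: B => vr /eqP vu.
by have := dep_par ur; have := dep_par vr; rewrite uv vu; lia.
Qed.

Lemma lform_rooted (R : realType) (x : T -> R) :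
  lform e x = \sum_(y | y != r) (x y - x (par y)) ^+ 2.
Proof.
rewrite /lform edge_sum mulr_sumr; apply: eq_bigr => y _.
by field.
Qed.

Lemma aform_rooted (R : realType) (x : T -> R) :
  aform e x = 2 * \sum_(y | y != r) x y * x (par y).
Proof. by rewrite /aform edge_sum mulr_sumr; apply: eq_bigr => y _; ring. Qed.

End Rooted.

(** * Functions on a path *)

Section OneDimensional.
Local Open Scope ring_scope.
Variable R : realType.
Implicit Types (mu : R) (v : nat -> R).

(* [useq mu] solves the eigenvalue equation [2 u_n - u_(n-1) - u_(n+1) = mu u_n]
   of the Laplacian of a path, with [u_0 = 0] and [u_1 = 1]. *)
Fixpoint dpair_seq mu n : R * R :=
  if n is n'.+1 then let: (a, b) := dpair_seq mu n' in (b, (2 - mu) * b - a)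
  else (0, 1).
Definition useq mu n := (dpair_seq mu n).1.

Lemma useq0 mu : useq mu 0 = 0. Proof. by []. Qed.
Lemma useq1 mu : useq mu 1 = 1. Proof. by []. Qed.
Lemma useqS mu n : useq mu n.+2 = (2 - mu) * useq mu n.+1 - useq mu n.
Proof. by rewrite /useq /=; case: (dpair_seq mu n). Qed.

(** The path 0, ..., m with a fixed end at 0, where v is to vanish, and a free end at m. *)
Definition dirichlet v m := \sum_(i < m) (v i.+1 - v i) ^+ 2.
Definition mass v m := \sum_(i < m) v i.+1 ^+ 2.

Lemma mass_ge0 v m : 0 <= mass v m.
Proof. by apply: sumr_ge0 => i _; exact: sqr_ge0. Qed.

Lemma dirichletS v m : dirichlet v m.+1 = dirichlet v m + (v m.+1 - v m) ^+ 2.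
Proof. by rewrite /dirichlet big_ord_recr. Qed.

Lemma massS v m : mass v m.+1 = mass v m + v m.+1 ^+ 2.
Proof. by rewrite /mass big_ord_recr. Qed.

(** Discrete Picone inequality: comparison with the positive solution [useq] discards one square
    (v_(m+1) b - v_(m+2) a)^2 / (a b) per step and leaves a boundary term at the free end. *)
Lemma picone mu v m : v 0%N = 0 -> (forall i, (0 < i <= m.+1)%N -> 0 < useq mu i) ->
  mu * mass v m.+1 + v m.+1 ^+ 2 * (useq mu m.+2 / useq mu m.+1 - 1)
    <= dirichlet v m.+1.
Proof.
move=> v0; elim: m => [|m IH] u_gt0.
  by rewrite /mass /dirichlet !big_ord1 v0 useqS useq1 useq0; lra.
have H : mu * mass v m.+1 + v m.+1 ^+ 2 * (useq mu m.+2 / useq mu m.+1 - 1)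
    <= dirichlet v m.+1.
  by apply: IH => i /andP[i0 im]; apply: u_gt0; rewrite i0 leqW.
rewrite (massS _ m.+1) (dirichletS _ m.+1).
have a0 : 0 < useq mu m.+1 by apply: u_gt0; lia.
have b0 : 0 < useq mu m.+2 by apply: u_gt0; lia.
rewrite useqS; set a := useq mu m.+1 in a0 H *; set b := useq mu m.+2 in b0 H *.
have ab := mulr_gt0 a0 b0.
have -> : ((2 - mu) * b - a) / b - 1 = 1 - mu - a / b by field; rewrite gt_eqF.
have : 0 <= (v m.+1 * b - v m.+2 * a) ^+ 2 / (a * b).
  by rewrite divr_ge0 ?sqr_ge0 ?ltW.
have -> : (v m.+1 * b - v m.+2 * a) ^+ 2 / (a * b) =
   v m.+1 ^+ 2 * (b / a) - 2 * v m.+1 * v m.+2 + v m.+2 ^+ 2 * (a / b).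
  by field; rewrite !gt_eqF.
lra.
Qed.

Lemma useq_increasing_gt0 mu m : (forall i, (0 < i <= m)%N -> useq mu i < useq mu i.+1) ->
  forall i, (0 < i <= m.+1)%N -> 0 < useq mu i.
Proof.
move=> H; elim=> [//|[_ _|i IH im]]; first by rewrite useq1.
by apply: lt_trans (H i.+1 _); [apply: IH; lia | lia].
Qed.

(** While [useq] increases, the boundary term of [picone] is positive unless the last value of v is
    0; in that case the last vertex is dropped. *)
Lemma dirichlet_gt mu v m : v 0%N = 0 ->
  (forall i, (0 < i <= m)%N -> useq mu i < useq mu i.+1) ->
  (exists2 i, (i <= m)%N & v i != 0) -> mu * mass v m < dirichlet v m.
Proof.
move=> v0; elim: m => [|m IH] u_inc [i im vi].
  by move: im vi; rewrite leqn0 => /eqP ->; rewrite v0 eqxx.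
have u_gt0 := useq_increasing_gt0 u_inc.
have H := picone (mu := mu) (m := m) v0 _.
have {}H : mu * mass v m.+1 + v m.+1 ^+ 2 * (useq mu m.+2 / useq mu m.+1 - 1)
    <= dirichlet v m.+1.
  by apply: H => k /andP[k0 km]; apply: u_gt0; rewrite k0 leqW.
have um : 1 < useq mu m.+2 / useq mu m.+1.
  by rewrite ltr_pdivlMr ?mul1r ?u_inc ?u_gt0 ?ltnS ?leqnn ?leqW.
have [vm|vm] := eqVneq (v m.+1) 0; last first.
  apply: lt_le_trans H; rewrite ltrDl mulr_gt0 ?subr_gt0 //.
  by rewrite exprn_even_gt0.
rewrite massS dirichletS vm expr0n addr0 sub0r sqrrN.
apply: ltr_wpDr; first exact: sqr_ge0.
apply: IH; first by move=> k /andP[k0 km]; apply: u_inc; rewrite k0 leqW.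
exists i => //; move: im; rewrite leq_eqVlt => /orP[/eqP im|]; last by rewrite ltnS.
by rewrite im vm eqxx in vi.
Qed.

Lemma dirichlet_useq mu m :
  dirichlet (useq mu) m - mu * mass (useq mu) m =
  useq mu m * (useq mu m.+1 - useq mu m).
Proof.
elim: m => [|m IH]; first by rewrite /dirichlet /mass !big_ord0 useq0; ring.
by rewrite dirichletS massS useqS; move: IH; lra.
Qed.

(** Functions frozen from i on transfer a bound for the path of length j to its initial segments. *)
Lemma dirichlet_stop v i j : (i <= j)%N ->
  dirichlet (fun k => v (minn k i)) j = dirichlet v i.
Proof.
elim: j => [|j IH]; first by rewrite leqn0 => /eqP ->; rewrite /dirichlet !big_ord0.
rewrite leq_eqVlt => /orP[/eqP ->|]; last first.
  rewrite ltnS => ij; rewrite dirichletS IH // !(minn_idPr _) ?leqW //.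
  by rewrite subrr expr0n addr0.
apply: eq_bigr => k _; rewrite !(minn_idPl _) //; apply: ltnW; exact: (ltn_ord k).
Qed.

Lemma mass_stop v i j : (i <= j)%N ->
  mass v i <= mass (fun k => v (minn k i)) j.
Proof.
elim: j => [|j IH]; first by rewrite leqn0 => /eqP ->; rewrite /mass !big_ord0.
rewrite leq_eqVlt => /orP[/eqP ->|]; last first.
  rewrite ltnS => ij; rewrite massS; apply: ler_wpDr; first exact: sqr_ge0.
  exact: IH.
by apply: ler_sum => k _; rewrite (minn_idPl (ltn_ord k)) lexx.
Qed.

(** The test function is [useq] frozen from i on: by [dirichlet_useq] its slack is u_i (u_(i+1) -
    u_i), which must pay for mu N u_i^2. The growth found keeps u positive at the next index. *)
Lemma useq_growth mu (N : R) j : 0 < mu -> 0 <= N ->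
  (forall v, v 0%N = 0 -> mu * (mass v j + N * v j ^+ 2) <= dirichlet v j) ->
  forall i, (0 < i <= j)%N ->
    0 < useq mu i /\ mu * N * useq mu i <= useq mu i.+1 - useq mu i.
Proof.
move=> mu0 N0 H; have key i : (0 < i <= j)%N -> 0 < useq mu i ->
    mu * N * useq mu i <= useq mu i.+1 - useq mu i.
  move=> /andP[i0 ij] ui; have := H (fun k => useq mu (minn k i)).
  rewrite min0n useq0 => /(_ erefl); rewrite dirichlet_stop // (minn_idPr ij) => H1.
  have := mass_stop (useq mu) ij; rewrite -(ler_pM2l mu0) => H2.
  have := dirichlet_useq mu i => H3.
  rewrite -(ler_pM2l ui); lra.
elim=> [//|[_ j1|i IH ij]]; first by split; [rewrite useq1 | apply: key; rewrite ?useq1].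
suff ui : 0 < useq mu i.+2 by split=> //; apply: key.
have [|ui1 H1] := IH; first by move: ij; lia.
have : 0 <= mu * N * useq mu i.+1.
  by apply: mulr_ge0; [apply: mulr_ge0; [exact: ltW | ] | exact: ltW].
lra.
Qed.

(* The test functions take the values [v] on a path of [j] vertices and [l] on 4
   leaves at its end. *)
Definition broom_bound mu j := forall v (l : R), v 0%N = 0 ->
  (l - v j) ^+ 2 <= mu * l ^+ 2 ->
  mu * (mass v j + 4 * l ^+ 2) <= dirichlet v j + 4 * (l - v j) ^+ 2.

Lemma broom_bound_tied mu j : 0 < mu -> broom_bound mu j ->
  forall v, v 0%N = 0 -> mu * (mass v j + 4 * v j ^+ 2) <= dirichlet v j.
Proof.
move=> mu0 H v v0; have := H v (v j) v0.
rewrite subrr expr0n mulr0 addr0; apply; rewrite mulr_ge0 ?sqr_ge0 ?ltW //.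
Qed.

Lemma mass_pred v j : mass (fun k => v k.-1) j.+1 = v 0%N ^+ 2 + mass v j.
Proof. by rewrite /mass big_ord_recl. Qed.

Lemma dirichlet_pred v j : dirichlet (fun k => v k.-1) j.+1 = dirichlet v j.
Proof. by rewrite /dirichlet big_ord_recl /= subrr expr0n add0r. Qed.

Lemma broom_bound_pred mu j : broom_bound mu j.+1 -> broom_bound mu j.
Proof.
move=> H v l v0 lv; have := H (fun k => v k.-1) l v0 lv.
by rewrite mass_pred dirichlet_pred v0 expr0n add0r.
Qed.

(** The last inequality is the balance at the hub: the continued solution must rise by at least 4 mu
    l, the total rise into four leaves of value l = u_j / (1 - mu). *)
Lemma broom_bound_hub mu j : 0 < mu -> (0 < j)%N -> broom_bound mu j ->
  [/\ mu <= 5^-1, 0 < useq mu j,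
   forall i, (0 < i < j)%N -> useq mu i < useq mu i.+1 &
    4 * mu * useq mu j <= (1 - mu) * (useq mu j.+1 - useq mu j)].
Proof.
move=> mu0 j0 H; have tied := broom_bound_tied mu0 H.
have mu5 : mu <= 5^-1.
  (* The indicator of the hub and its leaves: mass 5, one boundary edge. *)
  have := tied (fun k => (k == j)%:R); rewrite eq_sym gtn_eqF //= => /(_ erefl).
  case: j j0 {H tied} => [//|j] _; rewrite massS dirichletS eqxx.
  have z (k : nat) : (k < j.+1)%N -> (k == j.+1)%:R = 0 :> R.
    by move=> kj; rewrite ltn_eqF.
  rewrite /mass /dirichlet !big1 => [|k _|k _].
  - rewrite (z j) // !add0r subr0 expr1n; lra.
  - by have kj := ltn_ord k; rewrite !z ?subrr ?expr0n //; lia.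
  - by have kj := ltn_ord k; rewrite !z ?subrr ?expr0n //; lia.
have gr := useq_growth mu0 (ler0n R 4) tied.
have [uj _] : 0 < useq mu j /\ mu * 4 * useq mu j <= useq mu j.+1 - useq mu j.
  by apply: gr; rewrite j0 leqnn.
split=> //.
  move=> i /andP[i0 ij]; have [|ui] := gr i; first by rewrite i0 ltnW.
  by rewrite -subr_gt0; apply: lt_le_trans; rewrite !mulr_gt0.
have mu1 : 0 < 1 - mu by lra.
(* The leaf value solving the eigenvalue equation (1 - mu) l = u_j at a leaf. *)
have := H (useq mu) (useq mu j / (1 - mu)) (useq0 mu).
set l := _ / _; have lu : useq mu j = l * (1 - mu) by rewrite /l divfK ?gt_eqF.
have l0 : 0 < l by rewrite divr_gt0.
have -> : (l - useq mu j) ^+ 2 = mu ^+ 2 * l ^+ 2 by rewrite lu; ring.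
have mu2 : mu ^+ 2 * l ^+ 2 <= mu * l ^+ 2.
  by rewrite ler_wpM2r ?sqr_ge0 // expr2 ler_piMl ?ltW //; lra.
move=> /(_ mu2) H1.
have := dirichlet_useq mu j => H2.
have H3 : 4 * mu * l * useq mu j <= useq mu j * (useq mu j.+1 - useq mu j).
  rewrite -H2 {1}lu; lra.
have H4 : 4 * mu * l <= useq mu j.+1 - useq mu j by rewrite -(ler_pM2l uj); lra.
by rewrite {1}lu; have := ler_wpM2l (ltW mu1) H4; lra.
Qed.

(** Beyond the hub, four leaves restrict mu enough that the solution goes on increasing as if on a
    path with four further vertices. *)
Lemma broom_bound_useq mu j : 0 < mu -> (2 < j)%N -> broom_bound mu j ->
  forall i, (0 < i <= j + 3)%N -> useq mu i < useq mu i.+1.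
Proof.
move=> mu0 j3 H; have j0 : (0 < j)%N by lia.
have [mu5 uj inc hub] := broom_bound_hub mu0 j0 H.
have H3 : broom_bound mu 3.
  elim: j j3 H {inc hub uj j0} => [//|j IH]; rewrite ltnS leq_eqVlt.
  by move=> /orP[/eqP <- //|j3 /broom_bound_pred]; exact: IH.
have [_ _ _] := broom_bound_hub mu0 (isT : (0 < 3)%N) H3.
rewrite !useqS useq1 useq0 => hub3.
(* This is where j >= 3 enters: the hub inequality for a handle of 3 is (1 - mu) times this cubic
   being nonnegative. *)
have cubic : 0 <= 1 - 18 * mu + 9 * mu ^+ 2 - mu ^+ 3.
  have : 0 <= (1 - mu) * (1 - 18 * mu + 9 * mu ^+ 2 - mu ^+ 3) by lra.
  by rewrite pmulr_rge0 //; lra.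
have mu10 : mu <= 10^-1 by rewrite leNgt; apply/negP => mu10; nra.
set w := useq mu j in uj hub *; pose d := useq mu j.+1 - w.
have dE : d = useq mu j.+1 - w by [].
have A : 0 < 1 - 6 * mu + 5 * mu ^+ 2 - mu ^+ 3 by nra.
have d0 : 0 < d.
  have : 0 < (1 - mu) * d by apply: lt_le_trans hub; rewrite !mulr_gt0.
  by rewrite pmulr_rgt0 //; lra.
(* This is u_(j+3) < u_(j+4) in terms of w = u_j and d = u_(j+1) - u_j. After the hub inequality the
   coefficient of mu w is the cubic above plus mu + 6 mu^2 - 2 mu^3. *)
have key : 0 < (1 - 6 * mu + 5 * mu ^+ 2 - mu ^+ 3) * d -
     (3 * mu - 4 * mu ^+ 2 + mu ^+ 3) * w.
  have : 0 < (1 - mu) * ((1 - 6 * mu + 5 * mu ^+ 2 - mu ^+ 3) * d -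
     (3 * mu - 4 * mu ^+ 2 + mu ^+ 3) * w); last by rewrite pmulr_rgt0 //; lra.
  have := ler_wpM2l (ltW A) hub; rewrite -dE.
  have : 0 < mu * (1 - 17 * mu + 15 * mu ^+ 2 - 3 * mu ^+ 3) * w.
    apply: mulr_gt0 => //; apply: mulr_gt0 => //; nra.
  lra.
have u2 : useq mu j.+2 = (2 - mu) * useq mu j.+1 - w by rewrite useqS.
have u3 : useq mu j.+3 = (2 - mu) * useq mu j.+2 - useq mu j.+1 by rewrite useqS.
have u4 : useq mu j.+4 = (2 - mu) * useq mu j.+3 - useq mu j.+2 by rewrite useqS.
have u1 : useq mu j.+1 = w + d by rewrite dE; ring.
have i4 : useq mu j.+3 < useq mu j.+4 by rewrite u4 u3 u2 u1; lra.
have w1 : 0 < useq mu j.+1 by rewrite u1; lra.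
have B : 0 < 1 - 3 * mu + mu ^+ 2 by nra.
have i3 : useq mu j.+2 < useq mu j.+3.
  have C1 : 0 <= (3 * mu - 4 * mu ^+ 2 + mu ^+ 3) * d.
    by apply: mulr_ge0; [nra | exact: ltW].
  have C2 : 0 <= (mu - 3 * mu ^+ 2 + mu ^+ 3) * w.
    by apply: mulr_ge0; [nra | exact: ltW].
  by rewrite u3 u2 u1; lra.
have i2 : useq mu j.+1 < useq mu j.+2.
  have C1 : 0 <= (5 * mu - 5 * mu ^+ 2 + mu ^+ 3) * d.
    by apply: mulr_ge0; [nra | exact: ltW].
  have C2 : 0 <= (2 * mu - 4 * mu ^+ 2 + mu ^+ 3) * w.
    by apply: mulr_ge0; [nra | exact: ltW].
  by rewrite u2 u1; lra.
have i1 : useq mu j < useq mu j.+1 by rewrite -subr_gt0 -dE.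
move=> i /andP[i0 ij]; have [ij'|ij'] := ltnP i j; first by apply: inc; rewrite i0.
have := subnKC ij'; have : (i - j <= 3)%N by rewrite leq_subLR.
case: (i - j)%N => [|[|[|[|//]]]] _ <-; rewrite ?addn0 ?addn1 ?addn2 ?addn3 //.
Qed.

(** The case N = 0 of [useq_growth]. Growth is strict before b because each increment exceeds the
    next, nonnegative one by mu times a positive value; mu b <= 1 comes from the function equal to 1
    on 1, ..., b. *)
Lemma path_bound_useq mu b : 0 < mu ->
  (forall v, v 0%N = 0 -> mu * mass v b <= dirichlet v b) ->
  [/\ mu * b%:R <= 1, forall i, (0 < i <= b)%N -> 0 < useq mu i,
   forall i, (0 < i <= b)%N -> useq mu i <= useq mu i.+1 &
   forall i, (0 < i < b)%N -> useq mu i < useq mu i.+1].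
Proof.
move=> mu0 H; have H0 v : v 0%N = 0 -> mu * (mass v b + 0 * v b ^+ 2) <= dirichlet v b.
  by move=> v0; rewrite mul0r addr0 H.
have gr := useq_growth mu0 (lexx 0) H0.
have inc i : (0 < i <= b)%N -> useq mu i <= useq mu i.+1.
  by move=> /gr[_]; rewrite mulr0 mul0r subr_ge0.
split=> // [|i /gr[]//|i /andP[i0 ib]]; last first.
  have : 0 < mu * useq mu i.+1 by rewrite mulr_gt0 //; case: (gr i.+1).
  have := inc i.+1 ib; rewrite useqS; lra.
case: b H {H0 gr inc} => [|b] H; first by rewrite mulr0.
have := H (fun k => (0 < k)%N%:R) erefl.
rewrite /mass (eq_bigr (fun=> 1)) => [|i _]; last by rewrite expr1n.
rewrite sumr_const card_ord => /le_trans; apply.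
rewrite /dirichlet big_ord_recl /= subr0 expr1n big1 ?addr0 // => i _.
by rewrite subrr expr0n.
Qed.

(** Four nonnegative increments beyond j + 1 force u_(j+1) - u_j >= mu (u_(j+1) + ... + u_(j+4)) >=
    4 mu u_(j+1), which is stronger than the balance at the hub. *)
Lemma path_bound_hub mu b j : 0 < mu -> (0 < j)%N -> (j + 4 <= b)%N ->
  (forall v, v 0%N = 0 -> mu * mass v b <= dirichlet v b) ->
  4 * mu * useq mu j < (1 - mu) * (useq mu j.+1 - useq mu j).
Proof.
move=> mu0 j0 jb H; have [mub pos inc sinc] := path_bound_useq mu0 H.
have [i1 i2 i3 i4] : [/\ useq mu j.+1 <= useq mu j.+2, useq mu j.+2 <= useq mu j.+3,
    useq mu j.+3 <= useq mu j.+4 & useq mu j.+4 <= useq mu j.+4.+1].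
  by split; apply: inc; lia.
have u0 := pos j; have u1 := pos j.+1.
have {}u0 : 0 < useq mu j by apply: u0; lia.
have {}u1 : 0 < useq mu j.+1 by apply: u1; lia.
have e2 := useqS mu j; have e3 := useqS mu j.+1; have e4 := useqS mu j.+2.
have e5 := useqS mu j.+3.
have m1 := ler_wpM2l (ltW mu0) i1; have m2 := ler_wpM2l (ltW mu0) i2.
have m3 := ler_wpM2l (ltW mu0) i3.
have H4 : 4 * mu * useq mu j.+1 <= useq mu j.+1 - useq mu j by lra.
have d0 : 0 < useq mu j.+1 - useq mu j.
  by have : 0 < mu * useq mu j.+1 := mulr_gt0 mu0 u1; lra.
by have : 0 < mu * (useq mu j.+1 - useq mu j) := mulr_gt0 mu0 d0; lra.
Qed.

(** The values 1, 2, 3, 4, 4 have mass 46 and Dirichlet sum 4, so mu <= 2/23; the claim is 1 - 12 mu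
    + 8 mu^2 - mu^3 > 0, which holds there with little to spare. *)
Lemma path5_bound_hub mu : 0 < mu ->
  (forall v, v 0%N = 0 -> mu * mass v 5 <= dirichlet v 5) ->
  4 * mu * useq mu 2 < (1 - mu) * (useq mu 3 - useq mu 2).
Proof.
move=> mu0 H; have := H (fun k => nth 0 [:: 0; 1; 2; 3; 4; 4] k) erefl.
rewrite /mass /dirichlet !big_ord_recr !big_ord0 /= => mu46.
rewrite !useqS useq1 useq0.
have {}mu46 : 46 * mu <= 4 by lra.
nra.
Qed.

End OneDimensional.

(** * Test functions on rooted trees *)

Section RootedForms.
Local Open Scope ring_scope.
Variables (R : realType) (T : finType) (e : rel T) (r : T) (par : T -> T) (dep : T -> nat).
Hypothesis rt : rooted e r par dep.
Let e_sym := rooted_sym rt.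
Local Notation desc := (desc par dep).

(** On its support g equals -f, and g >= -f at all neighbours, including the only outside one,
    [par y], where g = 0 <= f. So the Laplacian of g is at most mu g on the support. *)
Lemma lform_negative_part (f : T -> R) (mu : R) y :
  (forall t, \sum_v (e t v)%:R * (f t - f v) = mu * f t) ->
  y != r -> 0 <= f (par y) -> f y < 0 ->
  exists g : T -> R, [/\ forall t, 0 <= g t, forall t, t \notin desc y -> g t = 0,
    0 < g y & lform e g <= mu * nsq g].
Proof.
move=> fE yr fp fy; pose g t := if (t \in desc y) && (f t < 0) then - f t else 0.
have g_ge0 t : 0 <= g t by rewrite /g; case: ifP => // /andP[_]; lra.
exists g; split=> // [t /negPf ty||]; first by rewrite /g ty.
  by rewrite /g desc_refl fy /=; lra.
rewrite lform_sum // /nsq mulr_sumr; apply: ler_sum => t _.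
have [->|gt] := eqVneq (g t) 0; first by rewrite expr0n mulr0 mul0r.
have [ty ft] : t \in desc y /\ f t < 0.
  by apply/andP; move: gt; rewrite /g; case: ifP; rewrite ?eqxx.
have gE : g t = - f t by rewrite /g ty ft.
rewrite [leRHS](_ : _ = g t * (mu * g t)); last by ring.
rewrite ler_wpM2l // gE mulrN -fE -sumrN; apply: ler_sum => v _.
case etv: (e t v); last by rewrite !mul0r oppr0.
rewrite !mul1r; suff : - f v <= g v by lra.
have [vy|vy] := boolP (v \in desc y).
  by rewrite /g vy /=; case: ltP; lra.
by have [_ _ ->] := desc_boundary rt etv ty vy; have := g_ge0 (par y); lra.
Qed.

Lemma sum_sqr_le (v : nat -> R) (a b m : nat) : (a <= b <= m)%N ->
  (forall k, (k < m)%N -> v k <= v k.+1) ->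
  \sum_(k < m) ((a <= k < b)%N)%:R * (v k.+1 - v k) ^+ 2 <= (v b - v a) ^+ 2.
Proof.
move=> /andP[ab bm] mono; elim: b ab bm => [|b IH] ab bm.
  rewrite big1 ?sqr_ge0 // => k _; by rewrite ltn0 andbF mul0r.
move: ab; rewrite leq_eqVlt => /orP[/eqP ->|].
  rewrite subrr expr0n big1 // => k _.
  by rewrite (_ : _ && _ = false) ?mul0r //; lia.
rewrite ltnS => ab; have {}IH := IH ab (ltnW bm).
rewrite (eq_bigr (fun k : 'I_m => ((a <= k < b)%N)%:R * (v k.+1 - v k) ^+ 2 +
   ((k : nat) == b)%:R * (v k.+1 - v k) ^+ 2)); last first.
  move=> k _; rewrite -mulrDl -natrD; congr (_%:R * _).
  by case: eqVneq => [->|kb]; [rewrite ltnSn ltnn ab | rewrite addn0; congr nat_of_bool; lia].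
rewrite big_split /= [X in _ + X](bigD1 (Ordinal bm)) //= eqxx mul1r.
rewrite [X in _ + (_ + X)]big1 ?addr0 => [|k kb]; last first.
  by rewrite (_ : _ == _ = false) ?mul0r //; apply/negbTE; rewrite -val_eqE in kb.
have vab : v a <= v b.
  elim: b ab bm {IH} => [|b IHb]; first by rewrite leqn0 => /eqP ->.
  rewrite leq_eqVlt => /orP[/eqP -> //|]; rewrite ltnS => ab bm.
  by apply: le_trans (mono _ (ltnW bm)); apply: IHb => //; exact: ltnW.
by have := mono _ bm; nra.
Qed.

(* Sorting the values of g makes it a function on a path: every gap between
   consecutive values is crossed by some edge. *)
Lemma rearrangement (g : T -> R) : (forall t, 0 <= g t) -> g r = 0 ->
  exists v : nat -> R, let m := #|[set t | g t != 0]%SET| in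
    [/\ v 0%N = 0, mass v m = nsq g, dirichlet v m <= lform e g &
        forall k, (0 < k <= m)%N -> v k != 0].
Proof.
move=> g_ge0 gr; pose S := [set t | g t != 0]%SET.
pose leg := fun x y : T => g x <= g y.
pose s := sort leg (enum S); pose m := #|S|.
have sz : size s = m by rewrite size_sort -cardE.
have ms t : (t \in s) = (g t != 0) by rewrite mem_sort mem_enum inE.
have us : uniq s by rewrite sort_uniq enum_uniq.
have ss : sorted leg s by apply: sort_sorted => x y; exact: le_total.
pose v k := nth 0 (0 :: map g s) k.
have vE k : (k < m)%N -> v k.+1 = g (nth r s k).
  by move=> km; rewrite /v /= (nth_map r) // sz.
have mono k : (k < m)%N -> v k <= v k.+1.
  move=> km; rewrite vE //; case: k km => [|k] km; first exact: g_ge0.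
  rewrite vE ?(ltnW km) //; have /(sortedP r) := ss; apply; by rewrite sz.
pose rk t := if g t == 0 then 0%N else (index t s).+1.
have rkm t : (rk t <= m)%N.
  by rewrite /rk; case: ifP => // /negbT; rewrite -ms -sz index_mem.
have vrk t : v (rk t) = g t.
  rewrite /rk; case: ifP => [/eqP ->//|/negbT]; rewrite -ms => ts.
  by rewrite vE ?nth_index // -sz index_mem.
exists v; split=> //.
- rewrite /mass -/S -/m (eq_bigr (fun k : 'I_m => g (nth r s k) ^+ 2)); last first.
    by move=> k _; rewrite vE.
  rewrite -sz -(big_mkord xpredT (fun k => g (nth r s k) ^+ 2)).
  rewrite -(big_nth r xpredT (fun t => g t ^+ 2)) /nsq.
  rewrite (perm_big (enum S)); last by rewrite perm_sort.
  rewrite big_enum /= [RHS](bigID (mem S)) /= [X in _ = _ + X]big1 ?addr0 // => t.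
  by rewrite inE negbK => /eqP ->; rewrite expr0n.
- rewrite (lform_rooted rt) /dirichlet -/S -/m.
  (* The edge from y to its parent passes over the gap between the values of rank k and k + 1. *)
  pose cross (k : nat) y := (rk y <= k)%N != (rk (par y) <= k)%N.
  have edge y : \sum_(k < m) (cross k y)%:R * (v k.+1 - v k) ^+ 2 <= (g y - g (par y)) ^+ 2.
    rewrite -!vrk.
    have [lr|lr] := leqP (rk y) (rk (par y)).
      rewrite -sqrrN opprB; apply: le_trans (sum_sqr_le (m := m) _ mono); last first.
        by rewrite lr rkm.
      by apply: ler_sum => k _; rewrite ler_wpM2r ?sqr_ge0 // ler_nat /cross; lia.
    apply: le_trans (sum_sqr_le (m := m) _ mono); last by rewrite (ltnW lr) rkm.
    by apply: ler_sum => k _; rewrite ler_wpM2r ?sqr_ge0 // ler_nat /cross; lia.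
  apply: le_trans (_ : \sum_(y | y != r) \sum_(k < m) (cross k y)%:R * (v k.+1 - v k) ^+ 2 <= _).
    rewrite exchange_big /=; apply: ler_sum => k _; rewrite -mulr_suml.
    rewrite ler_peMl ?sqr_ge0 //.
    (* If no edge crossed this gap, rank at most k would propagate from the root, of rank 0, to
       every vertex, although rank m occurs. *)
    have [y yr cy] : exists2 y, y != r & cross k y.
      apply: contrapT => H; have low t : (rk t <= k)%N.
        elim/(rooted_ind rt): t => [|t tr IH]; first by rewrite /rk gr eqxx.
        apply: contrapT => kt; apply: H; exists t => //; rewrite /cross IH.
        by move/negP: kt => /negPf ->.
      have m0 : (0 < m)%N by apply: leq_ltn_trans (ltn_ord k).
      have := low (nth r s m.-1); have ins : nth r s m.-1 \in s.
        by rewrite mem_nth // sz prednK.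
      rewrite /rk -[g _ == 0]negbK -ms ins /= index_uniq ?sz ?prednK //.
      by rewrite leqNgt ltn_ord.
    rewrite (bigD1 y) //= cy ler_wpDr // sumr_ge0 // => z _; exact: ler0n.
  by apply: ler_sum => y _; exact: edge.
- by move=> [//|k] /= km; rewrite vE // -ms mem_nth // sz.
Qed.

Section Chain.
Variable t : T.
Let j := dep t.
Let q i := iter (j - i) par t.

Let dep_q i : (i <= j)%N -> dep (q i) = i.
Proof.
by move=> ij; rewrite /q (dep_iter_par rt) ?leq_subr ?subKn.
Qed.

Let par_q i : (i < j)%N -> par (q i.+1) = q i.
Proof. by move=> ij; rewrite /q -iterS -subSn // subSS. Qed.

Let q0 : q 0 = r.
Proof. by apply: (dep_eq0 rt); rewrite dep_q. Qed.

Let qj : q j = t. Proof. by rewrite /q subnn. Qed.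

Let q_neq_r i : (i < j)%N -> q i.+1 != r.
Proof. by move=> ij; apply/eqP => qr; have := dep_q ij; rewrite qr; case: rt => -> . Qed.

(** The depth of the projection of y to the path from r to t, as the number of path vertices below r
    that have y as descendant. *)
Let lev y := (\sum_(i < j) (y \in desc (q i.+1)))%N.

Let lev_par y : y != r -> lev y = (lev (par y) + \sum_(i < j) (y == q i.+1))%N.
Proof.
move=> yr; rewrite /lev -big_split /=; apply: eq_bigr => i _.
rewrite (desc_par rt) //; case: eqVneq => [->|_]; last by rewrite addn0.
by rewrite (negPf (par_notin_desc rt (q_neq_r (ltn_ord i)))).
Qed.

Let sum_q (V : nmodType) (F : nat -> V) y :
  (forall k, (k < j)%N -> y = q k.+1 -> \sum_(i < j) F i *+ (y == q i.+1) = F k) /\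
  ((forall k, (k < j)%N -> y != q k.+1) -> \sum_(i < j) F i *+ (y == q i.+1) = 0).
Proof.
split=> [k kj ->|H]; last by rewrite big1 // => i _; rewrite (negPf (H _ (ltn_ord i))).
rewrite (bigD1 (Ordinal kj)) //= eqxx mulr1n big1 ?addr0 // => i ik.
case: eqP => // /(congr1 dep); rewrite !dep_q ?ltn_ord // => -[ki].
by rewrite -val_eqE /= ki eqxx in ik.
Qed.

Let lev_q i : (i <= j)%N -> lev (q i) = i.
Proof.
elim: i => [|i IH] ij.
  rewrite q0 /lev big1 // => i _; rewrite (desc_root rt).
  by rewrite (negPf (q_neq_r (ltn_ord i))).
rewrite lev_par ?q_neq_r // par_q // IH ?(ltnW ij) //.
have [H _] := sum_q (fun=> 1%N) (q i.+1); have := H i ij erefl.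
rewrite (eq_bigr (fun k : 'I_j => nat_of_bool (q i.+1 == q k.+1))) => [->|k _].
  by rewrite addn1.
exact: natn.
Qed.

(* v gives the values along the path from r to t (off the path, the value at
   the point where the branch leaves it), and l the value below t. *)
Lemma chain_form (v : nat -> R) (l : R) : v 0%N = 0 ->
  exists h : T -> R,
   [/\ forall y, y \notin desc (q 1) -> h y = 0,
       lform e h = dirichlet v j +
         #|[set y | (y != r) && (par y == t)]%SET|%:R * (l - v j) ^+ 2 &
       mass v j + #|desc t :\ t|%:R * l ^+ 2 <= nsq h].
Proof.
move=> v0; pose h y := if y \in desc t :\ t then l else v (lev y).
have q_desc i : (i <= j)%N -> t \in desc (q i).
  move=> ij; rewrite inE dep_q // ij /= /q -/j eqxx //.
have q1_sub i : (i < j)%N -> desc (q i.+1) \subset desc (q 1).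
  move=> ij; apply: (desc_trans rt).
  elim: i ij => [|i IH] ij; first exact: desc_refl.
  by rewrite (desc_par rt) ?q_neq_r // par_q // IH ?orbT // ltnW.
have t_notq y k : y \in desc t :\ t -> (k < j)%N -> y != q k.+1.
  rewrite !inE => /andP[yt /andP[le it]] kj; apply: contra_neq yt => yq.
  have dy : dep y = k.+1 by rewrite yq dep_q.
  move: it; have -> : (dep y - dep t = 0)%N by apply/eqP; rewrite subn_eq0 dy.
  by move=> /eqP.
exists h; split.
- move=> y yq; have lev0 : lev y = 0%N.
    rewrite /lev big1 // => i _; apply/eqP; rewrite eqb0.
    by apply: contra yq; apply/fintype.subsetP/q1_sub.
  have yt : y \notin desc t.
    apply: contra yq; case j0 : j => [|j'].
      have -> : q 1 = t by rewrite /q j0.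
      by [].
    by rewrite -{1}qj j0; apply/fintype.subsetP/q1_sub; rewrite j0.
  by rewrite /h finset.in_setD1 (negPf yt) andbF lev0.
- have dform : dirichlet v j = \sum_(y | y != r) \sum_(i < j)
      (v i.+1 - v i) ^+ 2 *+ (y == q i.+1).
    rewrite exchange_big /=; apply: eq_bigr => i _.
    rewrite (bigD1 (q i.+1)) ?q_neq_r //= eqxx mulr1n big1 ?addr0 // => y.
    by move=> /andP[_ /negPf ->].
  have cform : #|[set y | (y != r) && (par y == t)]%SET|%:R * (l - v j) ^+ 2 =
      \sum_(y | y != r) (l - v j) ^+ 2 *+ (par y == t).
    rewrite -sum1dep_card natr_sum mulr_suml big_mkcondr /=.
    by apply: eq_bigr => y _; case: eqP; rewrite ?mul1r.
  rewrite (lform_rooted rt) dform cform -big_split /=; apply: eq_bigr => y yr.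
  have [sq1 sq0] := sum_q (fun i => (v i.+1 - v i) ^+ 2) y.
  have [py|py] := boolP (par y \in desc t).
    have yt : y \in desc t :\ t.
      rewrite finset.in_setD1 (desc_par rt) // py orbT andbT.
      by apply: contraTneq py => yt; rewrite yt; apply: (par_notin_desc rt); rewrite -yt.
    rewrite sq0 => [|k kj]; last exact: t_notq.
    rewrite add0r {1}/h yt /h finset.in_setD1 py andbT.
    by case: eqVneq => [->|_] /=; rewrite ?subrr ?expr0n // -{1}qj lev_q.
  have pt : par y != t by apply: contraNneq py => ->; exact: desc_refl.
  rewrite (negPf pt) addr0 /h !finset.in_setD1 (desc_par rt) // (negPf py) orbF andbF.
  rewrite andNb lev_par //.
  have [/existsP[k /eqP yq]|/existsPn yq] := boolP [exists k : 'I_j, y == q k.+1].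
    rewrite (sq1 k) // yq; congr ((v _ - v _) ^+ 2); last by rewrite par_q ?lev_q // ltnW.
    by rewrite -lev_par ?q_neq_r // lev_q.
  rewrite sq0 => [|k kj]; last exact: (yq (Ordinal kj)).
  by rewrite big1 ?addn0 ?subrr ?expr0n // => k _; rewrite (negPf (yq k)).
- have mform : mass v j = \sum_y \sum_(i < j) v i.+1 ^+ 2 *+ (y == q i.+1).
    rewrite exchange_big /=; apply: eq_bigr => i _.
    by rewrite (bigD1 (q i.+1)) //= eqxx mulr1n big1 ?addr0 // => y /negPf ->.
  have lform : #|desc t :\ t|%:R * l ^+ 2 = \sum_y l ^+ 2 *+ (y \in desc t :\ t).
    rewrite -sum1_card natr_sum mulr_suml big_mkcond /=.
    by apply: eq_bigr => y _; case: ifP; rewrite ?mul1r.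
  rewrite mform lform -big_split /=; apply: ler_sum => y _.
  have [sq1 sq0] := sum_q (fun i => v i.+1 ^+ 2) y.
  have [yt|yt] := boolP (y \in desc t :\ t).
    by rewrite sq0 => [|k kj]; [rewrite add0r /h yt | exact: t_notq].
  rewrite addr0 /h (negPf yt).
  have [/existsP[k /eqP yq]|/existsPn yq] := boolP [exists k : 'I_j, y == q k.+1].
    by rewrite (sq1 k) // yq lev_q.
  by rewrite sq0 ?sqr_ge0 // => k kj; exact: (yq (Ordinal kj)).
Qed.
End Chain.

End RootedForms.

Section RootedBounds.
Local Open Scope ring_scope.
Variables (R : realType) (T : finType) (e : rel T) (r : T) (par : T -> T) (dep : T -> nat).
Hypothesis rt : rooted e r par dep.
Let e_sym := rooted_sym rt.
Local Notation desc := (desc par dep).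

Section ChainBounds.
Variables (t : T) (mu : R).
Hypothesis mu_ge0 : 0 <= mu.
Hypothesis lform_ge : forall h : T -> R,
  (forall y, y \notin desc (iter (dep t).-1 par t) -> h y = 0) ->
  mu * nsq h <= lform e h.

Lemma chain_tied_bound v : v 0%N = 0 ->
  mu * (mass v (dep t) + #|desc t :\ t|%:R * v (dep t) ^+ 2) <= dirichlet v (dep t).
Proof.
move=> v0; have [h [h0 lh nh]] := chain_form rt t (v (dep t)) v0.
have := lform_ge (h := h); rewrite lh subrr expr0n mulr0 addr0 => H.
apply: le_trans (H _); first exact: ler_wpM2l.
by move=> y yt; apply: h0; rewrite subn1.
Qed.

(** The a vertices below t carry the value l, but only the c <= a children of t contribute edges.
    Comparing with 4 leaves needs (c - 4)(l - v_j)^2 <= (a - 4) mu l^2, and this is the reason for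
    the side condition in [broom_bound]. *)
Lemma chain_broom_bound : (4 <= #|desc t :\ t|)%N -> broom_bound mu (dep t).
Proof.
move=> a4 v l v0 lv; have [h [h0 lh nh]] := chain_form rt t l v0.
have H : mu * nsq h <= lform e h by apply: lform_ge => y yt; apply: h0; rewrite subn1.
rewrite lh in H; have {nh} nh := ler_wpM2l mu_ge0 nh.
set a := #|desc t :\ t| in a4 nh; set c := #|_| in H.
have ca : (c <= a)%N.
  apply/subset_leq_card/fintype.subsetP => y; rewrite inE => /andP[yr /eqP yt].
  rewrite finset.in_setD1 (desc_par rt) // yt desc_refl orbT andbT.
  apply/eqP => ty; have := par_notin_desc rt yr.
  by rewrite yt ty desc_refl.
have x0 : 0 <= (l - v (dep t)) ^+ 2 by exact: sqr_ge0.
set x := (l - v _) ^+ 2 in lv H x0 *; rewrite mulrDr in nh; rewrite mulrDr.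
set y := mu * l ^+ 2 in lv; have y0 : 0 <= y by rewrite (le_trans x0).
have -> : mu * (4 * l ^+ 2) = 4 * y by rewrite /y; ring.
rewrite [mu * (a%:R * _)](_ : _ = a%:R * y) in nh; last by rewrite /y; ring.
suff : (c%:R - 4) * x <= (a%:R - 4) * y by lra.
have a4' : 0 <= a%:R - 4 :> R by rewrite subr_ge0 ler_nat.
have [c4|c4] := leP 4 (c%:R : R).
  apply: (@le_trans _ _ ((c%:R - 4) * y)); first by apply: ler_wpM2l => //; lra.
  by apply: ler_wpM2r => //; rewrite lerD2r ler_nat.
apply: (@le_trans _ _ 0); last exact: mulr_ge0.
by rewrite mulr_le0_ge0 //; lra.
Qed.
End ChainBounds.

(* Cauchy-Schwarz over the edges, then over the two colour classes of the
   bipartite graph. *)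
Lemma desc_radius_sq t (z : T -> R) (rho : R) : (forall y, y \notin desc t -> z y = 0) ->
  0 < nsq z -> 0 <= rho -> rho * nsq z <= aform e z -> rho ^+ 2 <= #|desc t :\ t|%:R.
Proof.
move=> z0 nz rho0 az; set D := desc t :\ t.
pose b y := z y * z (par y).
have bout y : y != r -> y \notin D -> b y = 0.
  move=> yr; rewrite finset.in_setD1 negb_and negbK => /orP[/eqP yt|yt].
    by rewrite /b yt [z (par t)]z0 ?mulr0 //; apply: (par_notin_desc rt); rewrite -yt.
  by rewrite /b z0 ?mul0r.
pose B := \sum_(y in D) b y; pose P := \sum_(y in D) b y ^+ 2.
have rD y : y \in D -> y != r.
  rewrite finset.in_setD1 => /andP[yt yd]; apply/eqP => yr.
  by move: yd yt; rewrite yr (desc_root rt) => /eqP ->; rewrite eqxx.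
have restrict (F : T -> R) : (forall y, y != r -> y \notin D -> F y = 0) ->
    \sum_(y | y != r) F y = \sum_(y in D) F y.
  move=> F0; rewrite (bigID (mem D)) /= [X in _ + X]big1 ?addr0; last first.
    by move=> y /andP[]; exact: F0.
  by apply: eq_bigl => y; rewrite andbC; case yD: (y \in D); rewrite //= rD.
have aB : aform e z = 2 * B.
  by rewrite (aform_rooted rt) restrict.
have BP : B ^+ 2 <= #|D|%:R * P.
  have [D0|D0] := posnP #|D|.
    rewrite /B big1 ?expr0n ?mulr_ge0 ?ler0n //; first by apply: sumr_ge0 => y _; exact: sqr_ge0.
    by move=> y; have /eqP := D0; rewrite cards_eq0 => /eqP ->; rewrite inE.
  have d0 : 0 < #|D|%:R :> R by rewrite ltr0n.
  have : 0 <= \sum_(y in D) (#|D|%:R * b y - B) ^+ 2.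
    by apply: sumr_ge0 => y _; exact: sqr_ge0.
  have -> : \sum_(y in D) (#|D|%:R * b y - B) ^+ 2 =
      \sum_(y in D) (#|D|%:R ^+ 2 * b y ^+ 2 - 2 * #|D|%:R * B * b y + B ^+ 2).
    by apply: eq_bigr => y _; ring.
  rewrite big_split sumrB /= [X in _ + X]sumr_const -!mulr_sumr -/B -/P -[B ^+ 2 *+ _]mulr_natl.
  have -> : #|D|%:R ^+ 2 * P - 2 * #|D|%:R * B * B + #|D|%:R * B ^+ 2 =
     #|D|%:R * (#|D|%:R * P - B ^+ 2) by ring.
  by rewrite pmulr_rge0 // subr_ge0.
have PS : 4 * P <= nsq z ^+ 2.
  pose S (c : bool) := \sum_u (odd (dep u) == c)%:R * z u ^+ 2.
  have SS : nsq z = S true + S false.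
    rewrite /nsq /S -big_split /=; apply: eq_bigr => u _.
    by case: (odd _); rewrite /= ?mul1r ?mul0r ?addr0 ?add0r.
  have : 2 * P <= 2 * (S true * S false).
    have -> : 2 * P = \sum_u \sum_v (e u v)%:R * (z u ^+ 2 * z v ^+ 2).
      rewrite (edge_sum rt) restrict.
        by rewrite /P mulr_sumr; apply: eq_bigr => y _; rewrite /b; ring.
      move=> y yr yD; have := bout y yr yD; rewrite /b => by0.
      transitivity (2 * (z y * z (par y)) ^+ 2); first by ring.
      by rewrite by0 expr0n mulr0.
    rewrite mulr_natl mulr2n {2}[S true * _]mulrC /S !big_distrlr -big_split /=.
    apply: ler_sum => u _; rewrite -big_split /=; apply: ler_sum => v _.
    set zu := z u ^+ 2; set zv := z v ^+ 2.
    have uv0 : 0 <= zu * zv by rewrite mulr_ge0 ?sqr_ge0.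
    have -> : (odd (dep u) == true)%:R * zu * ((odd (dep v) == false)%:R * zv) +
       (odd (dep u) == false)%:R * zu * ((odd (dep v) == true)%:R * zv) =
       (odd (dep u) != odd (dep v))%:R * (zu * zv).
      by case: (odd _); case: (odd _) => /=; rewrite ?mul1r ?mul0r ?mulr0 ?addr0 ?add0r.
    rewrite ler_wpM2r // ler_nat; case euv: (e u v) => //; apply: eq_leq.
    apply/esym; congr nat_of_bool; move: euv; rewrite (rootedE rt).
    move=> /orP[] /andP[nr /eqP <-]; rewrite (dep_par rt nr) /=; by case: (odd _).
  have := sqr_ge0 (S true - S false); rewrite SS; lra.
have rB : (rho * nsq z) ^+ 2 <= 4 * B ^+ 2.
  have -> : 4 * B ^+ 2 = (aform e z) ^+ 2 by rewrite aB; ring.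
  rewrite lerXn2r ?nnegrE //; first by rewrite mulr_ge0 // ltW.
  by apply: le_trans az; rewrite mulr_ge0 // ltW.
have nz2 : 0 < nsq z ^+ 2 by rewrite exprn_gt0.
rewrite -(ler_pM2r nz2) -exprMn; apply: le_trans rB _.
have := ler_wpM2l (ler0n R #|D|) PS; lra.
Qed.

(** * Lower bounds for the spectral radius of K *)

Section LowerRadius.
Variables (K : {set T}) (rho : R).
Hypotheses (rK : r \in K) (K_par : forall y, y != r -> y \in K -> par y \in K).
Hypothesis K_form : forall x : T -> R, (forall t, t \notin K -> x t = 0) ->
  aform e x <= rho * nsq x.

Lemma par_closed_boundary (X : {set T}) x y : x \in X -> x \in K -> y \in K -> y \notin X ->
  exists u v, [/\ u \in X, v \in K, v \notin X & e u v].
Proof.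
move=> xX xK yK yX; apply: contrapT => H.
have same z : z \in K -> (z \in X) = (r \in X).
  elim/(rooted_ind rt): z => [//|z zr IH zK]; have pK := K_par zr zK.
  rewrite -IH //; apply/idP/idP => zX; apply: contrapT => /negP pX; apply: H.
    by exists z, (par z); split=> //; exact: (par_edge rt).
  by exists (par z), z; split=> //; rewrite e_sym; exact: (par_edge rt).
by move: yX; rewrite same // -(same x xK) xX.
Qed.

Definition nbK u := #|[set v in K | e u v]|.

Let ind (A : {set T}) y : R := (y \in A)%:R.

Lemma nsq_ind A : nsq (ind A) = #|A|%:R.
Proof.
rewrite /nsq -sum1_card natr_sum [RHS]big_mkcond /=; apply: eq_bigr => y _.
by rewrite /ind; case: (y \in A); rewrite ?expr1n ?expr0n.
Qed.

Lemma aform_indK : aform e (ind K) = 2 * (#|K|%:R - 1).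
Proof.
rewrite (aform_rooted rt); congr (_ * _).
rewrite -nsq_ind /nsq [in RHS](bigD1 r) //= [ind K r]/ind rK expr1n [1 + _]addrC addrK.
apply: eq_bigr => y yr; rewrite /ind; case yK: (y \in K).
  by rewrite K_par // expr1n mulr1.
by rewrite mul0r expr0n.
Qed.

Lemma nbKE u : (nbK u)%:R = \sum_v (e u v)%:R * ind K v.
Proof.
rewrite /nbK -sum1dep_card natr_sum big_mkcond /=; apply: eq_bigr => v _.
by rewrite /ind; case: (v \in K); case: (e u v); rewrite /= ?mulr1 ?mulr0 ?mul0r.
Qed.

Lemma sum_nbK : \sum_(u in K) (nbK u)%:R = 2 * (#|K|%:R - 1) :> R.
Proof.
rewrite -aform_indK aform_sum big_mkcond /=; apply: eq_bigr => u _.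
by rewrite -nbKE /ind; case: (u \in K); rewrite ?mul1r ?mul0r.
Qed.

Lemma radius_ge_average : 2 * (#|K|%:R - 1) <= rho * #|K|%:R.
Proof.
rewrite -aform_indK -nsq_ind; apply: K_form => t /negPf tK.
by rewrite /ind tK.
Qed.

Lemma sum_edges_ind u (F : T -> R) (N : {set T}) : (forall v, v \in N -> e u v) ->
  (forall v, 0 <= F v) -> \sum_(v in N) F v <= \sum_v (e u v)%:R * F v.
Proof.
move=> Nu F0; rewrite [leLHS]big_mkcond /=; apply: ler_sum => v _.
by case: ifP => [/Nu ->|_]; rewrite ?mul1r // mulr_ge0 ?ler0n.
Qed.

(** The weights are 2 at v, 1 at three neighbours and 1 at one more vertex attached to these: norm 8
    and form at least 2 (3 * 2 + 1) = 14. *)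
Lemma branching_radius v : v \in K -> (3 <= nbK v)%N -> (5 <= #|K|)%N -> 7 / 4 <= rho.
Proof.
move=> vK; rewrite /nbK => /card_geqP [s [us ss sub]] K5.
pose N := [set x in s]; have N3 : #|N| = 3%N by rewrite cardsE (card_uniqP us) ss.
have NK w : w \in N -> (w \in K) /\ e v w.
  by rewrite inE => /sub; rewrite inE => /andP[].
have vN : v \notin N by apply/negP => /NK[_]; rewrite (rooted_irr rt).
have XK : (v |: N) \subset K.
  by apply/fintype.subsetP => w; rewrite !inE => /orP[/eqP -> //|/sub]; rewrite inE => /andP[].
have [y0 y0K y0X] : exists2 y0, y0 \in K & y0 \notin v |: N.
  have : ~~ (K \subset v |: N).
    by apply/negP => /subset_leq_card; rewrite cardsU1 vN N3; lia.
  by move=> /subsetPn[y0 y0K y0X]; exists y0.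
have [z [y [zX yK yX ezy]]] := par_closed_boundary (setU11 v N) vK y0K y0X.
have yv : (y == v) = false by apply/negP => /eqP yv; rewrite yv setU11 in yX.
have yN : (y \in N) = false by apply/negP => yN; rewrite setU1r in yX.
pose V := ind [set v]; pose X w := 2 * V w + ind N w; pose Y := ind [set y].
have V0 w : 0 <= V w by exact: ler0n.
have N0 w : 0 <= ind N w by exact: ler0n.
have Y0 w : 0 <= Y w by exact: ler0n.
have X0 w : 0 <= X w by rewrite addr_ge0 // mulr_ge0.
pose x w := X w + Y w.
have nx : nsq x = 8.
  transitivity (4 * nsq V + nsq (ind N) + nsq Y).
    rewrite /nsq mulr_sumr -!big_split /=; apply: eq_bigr => w _.
    rewrite /x /X /V /Y /ind !inE; case: (eqVneq w y) => [->|_].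
      by rewrite yv; move: yN; rewrite inE => ->; rewrite /=; ring.
    case: (eqVneq w v) => [->|_]; last by rewrite /=; ring.
    by move: vN; rewrite inE => /negPf ->; rewrite /=; ring.
  by rewrite !nsq_ind !cards1 N3; ring.
have ax : 14 <= aform e x.
  pose bil (F G : T -> R) := \sum_u \sum_w (e u w)%:R * (F u * G w).
  have bilC F G : bil F G = bil G F.
    rewrite /bil exchange_big /=; apply: eq_bigr => u _; apply: eq_bigr => w _.
    by rewrite e_sym [F w * _]mulrC.
  have bil1 u F : bil (ind [set u]) F = \sum_w (e u w)%:R * F w.
    rewrite /bil (bigD1 u) //= [X in _ + X]big1 ?addr0 => [|t /negPf tu].
      by apply: eq_bigr => w _; rewrite /ind inE eqxx mul1r.
    by rewrite big1 // => w _; rewrite /ind inE tu mul0r mulr0.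
  have b1 : 3 <= bil V (ind N).
    rewrite bil1; apply: le_trans (sum_edges_ind (N := N) _ N0); last by move=> w /NK[].
    by rewrite (eq_bigr (fun=> 1)) => [|w wN]; [rewrite sumr_const N3 | rewrite /ind wN].
  have b2 : 1 <= bil Y X.
    rewrite bil1; apply: le_trans (sum_edges_ind (N := [set z]) _ X0); last first.
      by move=> w; rewrite inE => /eqP ->; rewrite e_sym.
    rewrite big_set1 /X /V /ind; case/setU1P: zX => [->|->].
      by rewrite set11 mulr1; have := ler0n R (v \in N); lra.
    by rewrite lerDr mulr_ge0 ?ler0n.
  apply: (@le_trans _ _ (4 * bil V (ind N) + 2 * bil Y X)); first by lra.
  have -> : 4 * bil V (ind N) + 2 * bil Y X =
      2 * bil V (ind N) + 2 * bil (ind N) V + bil Y X + bil X Y.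
    by rewrite (bilC (ind N)) (bilC X); ring.
  rewrite /bil !mulr_sumr -!big_split /=; apply: ler_sum => u _.
  rewrite !mulr_sumr -!big_split /=; apply: ler_sum => w _.
  have : 0 <= (e u w)%:R * (4 * (V u * V w) + ind N u * ind N w + Y u * Y w).
    by rewrite mulr_ge0 ?ler0n // !addr_ge0 ?mulr_ge0.
  by rewrite /x /X; lra.
have := K_form (x := x); rewrite nx => H.
have : aform e x <= rho * 8.
  apply: H => w wK; rewrite /x /X /V /Y /ind !inE.
  have /negPf -> : w != v by apply: contraNneq wK => ->.
  have /negPf -> : w != y by apply: contraNneq wK => ->.
  have : w \notin N by apply: contra wK => /NK[].
  by rewrite inE => /negPf ->; rewrite /=; ring.
lra.
Qed.

(** The test function is the degree in K: 2 inside, 1 at the two ends, with [l] marking the ends.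
    Its form is at least 8k - 16 and its norm is 4k - 6; the quotient reaches 7/4 from k = 6 on. *)
Lemma path_radius : (forall u, u \in K -> (nbK u <= 2)%N) -> (6 <= #|K|)%N -> 7 / 4 <= rho.
Proof.
move=> nb2 K6.
have nb1 u : u \in K -> (1 <= nbK u)%N.
  move=> uK; have [y yK yu] : exists2 y, y \in K & y \notin [set u].
    have : ~~ (K \subset [set u]).
      by apply/negP => /subset_leq_card; rewrite cards1; lia.
    by move=> /subsetPn[y yK yu]; exists y.
  have [z [w [zu wK _ ezw]]] := par_closed_boundary (set11 u) uK yK yu.
  apply/card_gt0P; exists w; rewrite inE wK; by move: zu ezw; rewrite inE => /eqP ->.
pose d u : R := (nbK u)%:R; pose l u := 2 - d u.
have lP u : u \in K -> [/\ 0 <= l u, l u * d u = l u & l u ^+ 2 = l u].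
  move=> uK; have := nb2 u uK; have := nb1 u uK; rewrite /l /d.
  by case: (nbK u) => [|[|[|//]]] // _ _; split; ring || lra.
pose k : R := #|K|%:R.
have sd : \sum_(u in K) d u = 2 * (k - 1) := sum_nbK.
have sl : \sum_(u in K) l u = 2.
  by rewrite /l sumrB sd sumr_const -mulr_natr -/k; ring.
pose x u := if u \in K then 2 - l u else 0.
have nx : nsq x = 4 * k - 6.
  transitivity (\sum_(u in K) (4 - 3 * l u)).
    rewrite /nsq [RHS]big_mkcond /=; apply: eq_bigr => u _; rewrite /x.
    case: ifP => [/lP[_ _ l2]|_]; last by rewrite expr0n.
    by transitivity (4 - 4 * l u + l u ^+ 2); [ring | rewrite l2; ring].
  by rewrite sumrB sumr_const -mulr_sumr sl -mulr_natr -/k; ring.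
have ax : 8 * k - 16 <= aform e x.
  pose lK u := if u \in K then l u else 0.
  have xE u : x u = 2 * ind K u - lK u.
    by rewrite /x /ind /lK; case: ifP => _; rewrite ?mulr1 ?mulr0 ?subr0.
  have S2 : \sum_u \sum_v (e u v)%:R * (lK u * ind K v) = 2.
    rewrite -sl [RHS]big_mkcond /=; apply: eq_bigr => u _; rewrite /lK.
    under eq_bigr => v _ do rewrite mulrCA.
    rewrite -mulr_sumr -nbKE -/(d u); case: ifP => [/lP[]//|_]; by rewrite mul0r.
  have S2' : \sum_u \sum_v (e u v)%:R * (ind K u * lK v) = 2.
    rewrite -S2 exchange_big /=; apply: eq_bigr => u _; apply: eq_bigr => v _.
    by rewrite e_sym [ind K v * _]mulrC.
  have S3 : 0 <= aform e lK.
    apply: sumr_ge0 => u _; apply: sumr_ge0 => v _; rewrite mulr_ge0 ?ler0n //.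
    by rewrite mulr_ge0 // /lK; case: ifP => // /lP[].
  have -> : aform e x = 4 * aform e (ind K) - 2 * 2 - 2 * 2 + aform e lK.
    rewrite -{2}S2 -{3}S2' /aform !mulr_sumr -!sumrB -big_split /=; apply: eq_bigr => u _.
    rewrite !mulr_sumr -!sumrB -big_split /=; apply: eq_bigr => v _.
    by rewrite !xE; ring.
  by rewrite aform_indK -/k; lra.
have : aform e x <= rho * nsq x by apply: K_form => u /negPf uK; rewrite /x uK.
rewrite nx; have k6 : 6 <= k by rewrite /k ler_nat.
rewrite leNgt; move=> H; apply/negP => r74; nra.
Qed.

(** A rational bound just above sqrt 3, the largest radius that a branch with 4 vertices can
    have. *)
Lemma radius_ge_7_4 : (6 <= #|K|)%N -> 7 / 4 <= rho.
Proof.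
move=> K6; have [/existsP[v /andP[vK v3]]|/existsPn H] :=
   boolP [exists v, (v \in K) && (3 <= nbK v)%N].
  by apply: (branching_radius vK v3); lia.
apply: path_radius => // u uK; have := H u; rewrite uK /=; lia.
Qed.
End LowerRadius.
End RootedBounds.

(** * Branches at the adjacency center *)

Lemma gdist_lt (T : finType) (e : rel T) x y : connect e x y -> gdist e x y < #|T|.
Proof.
move=> /connectP[p pp ->]; case: (shortenP pp) => p' pp' up' _.
apply: leq_ltn_trans (gdist_le pp') _.
by have := max_card (mem (x :: p')); rewrite (card_uniqP up').
Qed.

Lemma set_dist_le (T : finType) (e : rel T) (X Y : {set T}) x y :
  x \in X -> y \in Y -> set_dist e X Y <= gdist e x y.
Proof.
move=> xX yY; rewrite /set_dist -leEnat; apply: (@bigmin_inf _ _ _ _ x) => //.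
by apply: (@bigmin_inf _ _ _ _ y).
Qed.

(** Connectedness keeps distances below #|T|, so neither minimum is its default value. *)
Lemma set_dist_attained (T : finType) (e : rel T) (X Y : {set T}) x0 y0 :
  (forall x y, connect e x y) -> x0 \in X -> y0 \in Y ->
  exists x y, [/\ x \in X, y \in Y & set_dist e X Y = gdist e x y].
Proof.
move=> conn xX yY; have lt : set_dist e X Y < #|T|.
  exact: leq_ltn_trans (set_dist_le e xX yY) (gdist_lt (conn x0 y0)).
rewrite /set_dist in lt *.
have [E|[x xX' E]] := bigmin_attained (fun x => x \in X)
    (fun x => \big[Order.min/#|T|]_(y in Y) gdist e x y) #|T|.
  by rewrite E ltnn in lt.
rewrite E in lt *.
have [E'|[y yY' E']] := bigmin_attained (fun y => y \in Y) (gdist e x) #|T|.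
  by rewrite E' ltnn in lt.
by exists x, y; rewrite E'.
Qed.

Lemma induced_boundary (T : finType) (e : rel T) (B X : {set T}) x y :
  symmetric e -> connected_graph (induced e B) ->
  x \in B -> x \in X -> y \in B -> y \notin X ->
  exists u v, [/\ u \in B, u \in X, v \in B, v \notin X & e u v].
Proof.
move=> e_sym /andP[_ /forallP conn] xB xX yB yX; apply: contrapT => H.
have i_sym : connect_sym (induced e B).
  by apply: sym_connect_sym => u v; exact: e_sym.
have cl : closed (induced e B) [pred z | val z \in X].
  apply: (intro_closed i_sym) => u v euv; rewrite !inE => uX.
  apply: contrapT => /negP vX; apply: H; exists (val u), (val v).
  by split=> //; exact: valP.
have /forallP/(_ (Sub y yB)) := conn (Sub x xB).
by move=> /(closed_connect cl); rewrite !inE /= xX (negPf yX).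
Qed.

Section Rooted.
Variables (T : finType) (e : rel T) (r : T) (par : T -> T) (dep : T -> nat).
Hypothesis rt : rooted e r par dep.
Let e_sym := rooted_sym rt.
Local Notation desc := (desc par dep).

Lemma par_closed_connected (A : {set T}) : r \in A ->
  (forall y, y != r -> y \in A -> par y \in A) -> connected_graph (induced e A).
Proof.
move=> rA A_par; have H x (xA : x \in A) : connect (induced e A) (Sub x xA) (Sub r rA).
  elim/(rooted_ind rt): x xA => [|x xr IH] xA.
    by rewrite (bool_irrelevance xA rA) connect0.
  apply: connect_trans (IH (A_par x xr xA)); apply: connect1.
  exact: (par_edge rt xr).
apply/andP; split; first by apply/card_gt0P; exists (Sub r rA).
apply/forallP => -[x xA]; apply/forallP => -[y yA].
apply: connect_trans (H x xA) _.
have i_sym : connect_sym (induced e A) by apply: sym_connect_sym => u v; exact: e_sym.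
by rewrite i_sym; exact: H.
Qed.

Lemma desc_setC_par s y : y != r -> y \in ~: desc s -> par y \in ~: desc s.
Proof.
by move=> yr; rewrite !finset.in_setC; apply: contra => py; rewrite (desc_par rt) // py orbT.
Qed.

Lemma root_notin_desc s : s != r -> r \in ~: desc s.
Proof. by move=> sr; rewrite finset.in_setC (desc_root rt). Qed.

(** The edge from s to its parent is the only exit of [desc s], so the connected set Y, which
    contains s but not [par s], stays inside. A larger connected set would use that edge and contain
    s. *)
Lemma desc_setC_component (Y : {set T}) s : connected_graph (induced e Y) ->
  s \in Y -> s != r -> par s \notin Y -> is_component e (~: Y)%SET (~: desc s)%SET.
Proof.
move=> Yc sY sr psY; apply/maxsetP; split.
  have Kc : connected_graph (induced e (~: desc s)).
    by apply: par_closed_connected; [exact: root_notin_desc | exact: desc_setC_par].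
  rewrite /= Kc andbT; apply/fintype.subsetP => y; rewrite !finset.in_setC; apply: contra => yY.
  apply: contrapT => /negP ys.
  have [u [v [uY us vY vs euv]]] := induced_boundary e_sym Yc sY (desc_refl _ _ s) yY ys.
  by have [_ _ vp] := desc_boundary rt euv us vs; rewrite -vp vY in psY.
move=> B /= /andP[BY Bc] KB; apply/eqP; rewrite finset.eqEsubset KB andbT.
apply/fintype.subsetP => z zB; rewrite finset.in_setC; apply/negP => zs.
have rB : r \in B by apply: (fintype.subsetP KB); exact: root_notin_desc.
have rs : r \notin desc s by rewrite -finset.in_setC root_notin_desc.
have [u [v [uB us vB vs euv]]] := induced_boundary e_sym Bc zB zs rB rs.
have [_ us' _] := desc_boundary rt euv us vs.
by have := fintype.subsetP BY u uB; rewrite us' finset.in_setC sY.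
Qed.

Lemma gdist_desc x y : y \in desc x -> gdist e y x <= dep y - dep x.
Proof.
rewrite inE => /andP[_]; have := leq_subr (dep x) (dep y).
move: (dep y - dep x) => k ky /eqP yx; suff : exists2 p, path e y p & last y p = x /\ size p = k.
  by move=> [p pp [<- <-]]; exact: gdist_le.
elim: k y ky yx => [|k IH] y ky yx; first by exists [::].
have yr : y != r by apply/eqP => yr; move: ky; rewrite yr; case: rt => ->.
have [||p pp [lp sp]] := IH (par y); first by have := dep_par rt yr; lia.
  by rewrite -iterSr.
by exists (par y :: p); rewrite /= ?(par_edge rt yr) ?lp ?sp.
Qed.

Lemma desc_iter_par i y : i <= dep y -> y \in desc (iter i par y).
Proof.
elim: i => [|i IH] iy; first exact: desc_refl.
have {IH} IH := IH (ltnW iy); apply: (fintype.subsetP (desc_trans rt _)) IH => /=.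
have dy := dep_iter_par rt (ltnW iy).
rewrite /= (desc_par rt) ?desc_refl ?orbT //.
by apply/eqP => xr; move: dy; rewrite xr; case: rt => -> _ _; lia.
Qed.

Local Open Scope ring_scope.

Section HeavyChild.
Variables (R : realType) (s : T) (rho : R).

Let kids := [set t | (t != r) && (par t == s)].

Let kid_of y : y \in desc s -> y != s -> exists2 t, t \in kids & y \in desc t.
Proof.
elim/(rooted_ind rt): y => [|y yr IH].
  by rewrite (desc_root rt) => /eqP ->; rewrite eqxx.
rewrite (desc_par rt) // => /orP[->//|py _].
have [ps|ps] := eqVneq (par y) s.
  by exists y; rewrite ?desc_refl // inE yr ps eqxx.
have [t tk pt] := IH py ps; exists t => //.
by rewrite (desc_par rt) // pt orbT.
Qed.

Let kid_uniq y t t' : t \in kids -> t' \in kids -> y \in desc t -> y \in desc t' -> t = t'.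
Proof.
rewrite [t \in _]inE [t' \in _]inE => /andP[tr /eqP ts] /andP[tr' /eqP ts'] yt yt'.
apply/eqP/negPn/negP => tt'.
by have := desc_siblings rt tr tr' _ tt' yt; rewrite ts ts' yt' => /(_ erefl).
Qed.

Let sum_kids y (a : R) : y \in desc s -> y != s ->
  \sum_(t in kids) (y \in desc t)%:R * a = a.
Proof.
move=> ys yns; have [t tk yt] := kid_of ys yns.
rewrite (bigD1 t) //= yt mul1r big1 ?addr0 // => t' /andP[tk' tt'].
case yt': (y \in desc t'); last by rewrite mul0r.
by rewrite (kid_uniq tk' tk yt' yt) eqxx in tt'.
Qed.

(** A function vanishing at s splits over the branches below s, between which there are no edges, so
    the forms add up; one nonzero part gives strictness. *)
Lemma kids_form_lt : (forall t, t \in kids -> forall z : T -> R,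
     (forall y, y \notin desc t -> z y = 0) -> 0 < nsq z -> aform e z < rho * nsq z) ->
  forall x : T -> R, x s = 0 -> (forall y, y \notin desc s -> x y = 0) ->
  0 < nsq x -> aform e x < rho * nsq x.
Proof.
move=> H x xs x0 nx; pose z t y := (y \in desc t)%:R * x y.
have z0 t y : y \notin desc t -> z t y = 0 by move=> /negPf yt; rewrite /z yt mul0r.
have nz : nsq x = \sum_(t in kids) nsq (z t).
  rewrite exchange_big /=; apply: eq_bigr => y _.
  have [->|ys] := eqVneq y s.
    by rewrite xs expr0n big1 // => t _; rewrite /z xs mulr0 expr0n.
  have [yd|yd] := boolP (y \in desc s); last first.
    by rewrite x0 // expr0n big1 // => t _; rewrite /z x0 // mulr0 expr0n.
  rewrite -[LHS](sum_kids _ yd ys); apply: eq_bigr => t _.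
  by rewrite /z; case: (y \in desc t); rewrite ?mul1r ?mul0r ?expr0n.
have az : aform e x = \sum_(t in kids) aform e (z t).
  rewrite (aform_rooted rt) (eq_bigr _ (fun t _ => aform_rooted rt (z t))) -mulr_sumr.
  congr (_ * _); rewrite exchange_big /=; apply: eq_bigr => y yr.
  have triv : x (par y) = 0 -> x y * x (par y) = \sum_(t in kids) z t y * z t (par y).
    by move=> E; rewrite E mulr0 big1 // => t _; rewrite {2}/z E !mulr0.
  have [ps|ps] := eqVneq (par y) s; first by apply: triv; rewrite ps.
  have [pd|pd] := boolP (par y \in desc s); last by apply: triv; exact: x0.
  rewrite -[LHS](sum_kids _ pd ps); apply: eq_bigr => t _.
  rewrite /z (desc_par rt t yr); case: (par y \in desc t); first by rewrite orbT !mul1r.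
  by rewrite !mul0r mulr0.
have zle t : t \in kids -> aform e (z t) <= rho * nsq (z t).
  move=> tk; have [n0|n0] := eqVneq (nsq (z t)) 0; last first.
    by apply/ltW/(H t tk); [exact: z0 | rewrite lt_def n0 nsq_ge0].
  have zz := nsq_eq0 n0; rewrite n0 mulr0 /aform big1 // => u _.
  by rewrite big1 // => v _; rewrite zz mul0r mulr0.
have [t tk nt] : exists2 t, t \in kids & 0 < nsq (z t).
  apply: contrapT => N; move: nx; rewrite nz big1 ?ltxx // => t tk.
  apply/eqP; rewrite eq_le nsq_ge0 andbT leNgt; apply/negP => nt; apply: N.
  by exists t.
rewrite az nz mulr_sumr (bigD1 t) //= [ltRHS](bigD1 t) //=.
apply: ltr_leD; first by apply: (H t tk) => //; exact: z0.
by apply: ler_sum => t' /andP[tk' _]; exact: zle.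
Qed.
End HeavyChild.

(** If all child branches were strictly lighter than K, [lambda2_lt_cut] would give lambda_2 < rho,
    against the center condition. Y is arbitrary because for brooms this is applied to every set
    satisfying that condition. *)
Lemma heavy_child (R : realType) (Y : {set T}) s :
  center_condition R e Y -> s \in Y -> s != r -> par s \notin Y ->
  let K := (~: desc s)%SET in let rho := spectral_radius (adjacency R (induced e K)) in
  exists t, [/\ t != r, par t = s & exists z : T -> R,
    [/\ forall y, y \notin desc t -> z y = 0, 0 < nsq z & rho * nsq z <= aform e z]].
Proof.
move=> /andP[Yc /forallP Ycomp] sY sr ps K rho.
have rho_le : rho <= lambda2 R e.
  by have /implyP := Ycomp K; apply; exact: desc_setC_component.
apply: contrapT => N; suff : lambda2 R e < rho by rewrite ltNge rho_le.
have T1 : (1 < #|T|)%N by rewrite (cardD1 r) (cardD1 s) !inE sr.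
apply: (@lambda2_lt_cut R T e e_sym K s (par s)) => //.
- by rewrite /K finset.in_setC desc_refl.
- exact: (par_edge rt sr).
- move=> v; rewrite /K finset.in_setC => vs esv.
  by have [] := desc_boundary rt esv (desc_refl _ _ s) vs.
- move=> Z pZ Zcl; have rK : r \in K by exact: root_notin_desc.
  apply/fintype.subsetP => y yK; apply: contrapT => /negP yZ.
  have pK : par s \in K by rewrite /K finset.in_setC (par_notin_desc rt).
  have [u [v [uZ vK vZ euv]]] := par_closed_boundary rt (@desc_setC_par s) pZ pK yK yZ.
  by have := Zcl u v uZ vK euv; rewrite (negPf vZ).
- move=> u v; rewrite /K !finset.in_setC negbK => us vs vns; apply/negP => euv.
  rewrite e_sym in euv; have [_ vs' _] := desc_boundary rt euv vs us.
  by rewrite vs' eqxx in vns.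
- by move=> x x0; exact: aform_le_component.
move=> x xs xK; apply: kids_form_lt xs _ => [t|y ys]; last first.
  by apply: xK; rewrite /K finset.in_setC.
rewrite inE => /andP[tr /eqP ts] z z0 nz; rewrite ltNge; apply/negP => az.
by apply: N; exists t; split=> //; exists z.
Qed.

End Rooted.

(** * The characteristic set *)

Section CharacteristicSet.
Local Open Scope ring_scope.
Variables (R : realType) (T : finType) (e : rel T).
Hypotheses (e_sym : symmetric e) (e_conn : forall u v, connect e u v).
Hypothesis T_gt1 : (1 < #|T|)%N.

Lemma fiedler_colf (f : 'cV[R]_#|T|) : is_fiedler e f ->
  exists phi : T -> R, [/\ f = colf phi,
    forall t, \sum_v (e t v)%:R * (phi t - phi v) = mu2 R e * phi t,
    \sum_t phi t = 0 & exists t, phi t != 0].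
Proof.
move=> [f0 fE]; have [phi fphi] := colf_surj f; exists phi.
have E : forall t, \sum_v (e t v)%:R * (phi t - phi v) = mu2 R e * phi t.
  by apply: laplacian_eigen; rewrite -fphi.
split=> //; first exact: fiedler_sum0.
apply: contrapT => N; move/eqP: f0; apply; rewrite fphi; apply/colP => i.
rewrite !mxE; apply/eqP/negPn/negP => pi; apply: N; by exists (enum_val i).
Qed.

Variables (phi : T -> R) (mu : R).
Hypothesis phiE : forall t, \sum_v (e t v)%:R * (phi t - phi v) = mu * phi t.
Hypotheses (phi_sum : \sum_t phi t = 0) (phi0 : exists t, phi t != 0).
Let C := char_set_of e (colf phi).

Let CE : C = if [exists v, phi v == 0]
  then [set v | (phi v == 0) && [exists w, e v w && (phi w != 0)]]
  else \bigcup_(u | 0 < phi u) \bigcup_(v | e u v && (phi v < 0)) [set u; v].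
Proof.
have val v : colf phi (enum_rank v) 0 = phi v by rewrite mxE enum_rankK.
rewrite /C /char_set_of; under eq_existsb => v do rewrite val.
case: ifP => _.
  apply/setP => v; rewrite !inE val; congr (_ && _); apply: eq_existsb => w.
  by rewrite val.
apply: eq_big => u; first by rewrite val.
by move=> _; apply: eq_bigl => v; rewrite val.
Qed.

Let char2P c : [exists v, phi v == 0] = false ->
  reflect (exists w, e c w /\ phi c * phi w < 0) (c \in C).
Proof.
move=> no0; rewrite CE no0; apply: (iffP bigcupP).
  move=> [u pu /bigcupP[v /andP[euv pv]]]; rewrite !inE => /orP[] /eqP ->.
    by exists v; split=> //; nra.
  by exists u; rewrite e_sym; split=> //; nra.
move=> [w [ecw cw]]; have [pc|pc] := ltP 0 (phi c).
  by exists c => //; apply/bigcupP; exists w; rewrite ?set21 // ecw; nra.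
have pw : 0 < phi w by nra.
have pc' : phi c < 0 by nra.
by exists w => //; apply/bigcupP; exists c; rewrite ?set22 // e_sym ecw pc'.
Qed.

(** Where phi vanishes, the eigenvalue equation makes the neighbouring values sum to 0, so one
    nonzero neighbour implies neighbours of both signs. *)
Lemma char_set_sign c : c \in C ->
  (phi c = 0 /\ exists w1 w2, [/\ e c w1, e c w2, phi w1 < 0 & 0 < phi w2]) \/
  (exists w, [/\ e c w, phi c * phi w < 0 & w \in C]).
Proof.
case no0 : [exists v, phi v == 0]; last first.
  move=> cC; have [w [ecw cw]] := char2P c no0 cC; right; exists w; split=> //.
  by apply/(char2P w no0); exists c; rewrite e_sym mulrC.
rewrite CE no0 inE => /andP[/eqP c0 /existsP[w /andP[ecw w0]]]; left; split=> //.
have sum0 : \sum_v (e c v)%:R * phi v = 0.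
  have : \sum_v (e c v)%:R * (phi c - phi v) = - \sum_v (e c v)%:R * phi v.
    by rewrite -sumrN; apply: eq_bigr => v _; rewrite c0 sub0r mulrN.
  by rewrite phiE c0 mulr0 => /esym/eqP; rewrite oppr_eq0 => /eqP.
have [x ecx x0] : exists2 x, e c x & phi x < 0.
  apply: contrapT => N; have ge0 v : 0 <= (e c v)%:R * phi v.
    case ecv : (e c v); rewrite ?mul0r // mul1r leNgt; apply/negP => pv.
    by apply: N; exists v.
  have /eqP := sum0; rewrite psumr_eq0 // => /allP /(_ w (mem_index_enum _)).
  by rewrite ecw mul1r (negPf w0).
have [y ecy y0] : exists2 y, e c y & 0 < phi y.
  apply: contrapT => N; have ge0 v : 0 <= (e c v)%:R * - phi v.
    case ecv : (e c v); rewrite ?mul0r // mul1r oppr_ge0 leNgt; apply/negP => pv.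
    by apply: N; exists v.
  have : \sum_v (e c v)%:R * - phi v = 0.
    by under eq_bigr => v _ do rewrite mulrN; rewrite sumrN sum0 oppr0.
  move/eqP; rewrite psumr_eq0 // => /allP /(_ w (mem_index_enum _)).
  by rewrite ecw mul1r oppr_eq0 (negPf w0).
by exists x, y.
Qed.

Let crossing (P : pred T) x y : P x -> ~~ P y -> exists u v, [/\ P u, ~~ P v & e u v].
Proof.
move=> Px Py; apply: contrapT => N; have cl : closed e P.
  apply: (intro_closed (sym_connect_sym e_sym)) => u v euv Pu.
  by apply: contrapT => /negP Pv; apply: N; exists u, v.
have := closed_connect cl (e_conn x y).
by rewrite /in_mem /= Px (negPf Py).
Qed.

Lemma char_set_nonempty : exists c, c \in C.
Proof.
have [t pt] := phi0; case no0 : [exists v, phi v == 0].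
  have /existsP[v /eqP v0] := no0.
  have [||u [w [pu pw euw]]] := @crossing (fun v => phi v != 0) t v => //.
    by rewrite v0 eqxx.
  exists w; rewrite CE no0 inE; rewrite negbK in pw; rewrite pw /=.
  by apply/existsP; exists u; rewrite e_sym euw.
have nz v : phi v != 0 by move/existsPn: (negbT no0).
have pos : exists x, 0 < phi x.
  apply: contrapT => N; have ge0 v : 0 <= - phi v.
    by rewrite oppr_ge0 leNgt; apply/negP => pv; apply: N; exists v.
  have : \sum_v - phi v = 0 by rewrite sumrN phi_sum oppr0.
  move/eqP; rewrite psumr_eq0 // => /allP /(_ t (mem_index_enum _)).
  by rewrite oppr_eq0 (negPf pt).
have neg : exists x, ~~ (0 < phi x).
  apply: contrapT => N; have ge0 v : 0 <= phi v.
    by rewrite leNgt; apply/negP => pv; apply: N; exists v; rewrite -leNgt ltW.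
  have /eqP := phi_sum; rewrite psumr_eq0 // => /allP /(_ t (mem_index_enum _)).
  by rewrite (negPf pt).
have [x px] := pos; have [y py] := neg.
have [u [v [pu pv euv]]] := @crossing (fun v => 0 < phi v) x y px py.
exists u; apply/(char2P u no0); exists v; split=> //.
rewrite pmulr_rlt0 // lt_neqAle nz /=; by rewrite -leNgt in pv.
Qed.

(** The part of phi below y with the sign of phi y; the positive case is the negative one for
    -phi. *)
Lemma sign_branch r par dep y : rooted e r par dep -> y != r ->
  phi (par y) * phi y <= 0 -> phi y != 0 ->
  exists g : T -> R, [/\ forall t, 0 <= g t, forall t, t \notin desc par dep y -> g t = 0,
    0 < nsq g & lform e g <= mu * nsq g].
Proof.
move=> rt yr sg y0.
have [py|py] := ltP (phi y) 0.
  have [||g [g0 gs gy lg]] := lform_negative_part rt phiE yr => //; first by nra.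
  by exists g; split=> //; apply: (nsq_gt0 (t := y)); rewrite gt_eqF.
have {}py : 0 < phi y by rewrite lt_def y0.
have phiNE t : \sum_v (e t v)%:R * (- phi t - - phi v) = mu * - phi t.
  by rewrite mulrN -phiE -sumrN; apply: eq_bigr => v _; ring.
have [||g [g0 gs gy lg]] := lform_negative_part rt phiNE yr; [nra | lra |].
by exists g; split=> //; apply: (nsq_gt0 (t := y)); rewrite gt_eqF.
Qed.

End CharacteristicSet.

(** * Numerical bounds for short paths *)

Section SmallNumerics.
Local Open Scope ring_scope.
Variable R : realType.

(** The first eigenvalue of a path of m vertices with one fixed end is 2 - 2 cos(pi / (2m + 1)):
    about 0.1206, 0.38 and 1 for m = 4, 2, 1. The three values of mu lie below these; 12/100 also
    lies above 2/17, the bound of [ramp_test] for N = 3. *)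
Lemma useq_small (mu : R) m : 
  [\/ (m <= 4)%N /\ mu = 12 / 100, (m <= 2)%N /\ mu = 4^-1 | (m <= 1)%N /\ mu = 2^-1] ->
  forall i, (0 < i <= m)%N -> useq mu i < useq mu i.+1.
Proof.
by case=> -[m4 ->] [|[|[|[|[|i]]]]] // im; rewrite ?useqS ?useq1 ?useq0; lra || (exfalso; move: im; lia).
Qed.

Lemma dirichlet_contra (mu mu0 : R) v m : v 0%N = 0 -> mu <= mu0 ->
  (forall i, (0 < i <= m)%N -> useq mu0 i < useq mu0 i.+1) ->
  (exists2 i, (i <= m)%N & v i != 0) -> dirichlet v m <= mu * mass v m -> False.
Proof.
move=> v0 mm0 inc nz H; have := dirichlet_gt v0 inc nz.
rewrite ltNge; move/negP; apply; apply: le_trans H _.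
by rewrite ler_wpM2r ?mass_ge0.
Qed.
End SmallNumerics.

(** * Upper bound *)

Section TestFunctions.
Local Open Scope ring_scope.
Variables (R : realType) (mu N : R) (k : nat).
Hypothesis tied : forall v, v 0%N = 0 ->
  mu * (mass v k.+2 + N * v k.+2 ^+ 2) <= dirichlet v k.+2.

Let zero_prefix (v : nat -> R) : (forall i, (i <= k)%N -> v i = 0) ->
  mass v k = 0 /\ dirichlet v k = 0.
Proof.
move=> v0; split; apply: big1 => i _; rewrite !v0 ?subrr ?expr0n //.
by rewrite ltnW.
Qed.

(** Only the last two path vertices and the mass N below them are used, so the bound does not depend
    on the distance. *)
Lemma ramp_test : mu * (5 + 4 * N) <= 2.
Proof.
pose v i : R := (i - k)%N%:R; have v0 i : (i <= k)%N -> v i = 0.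
  by move=> ik; rewrite /v; have /eqP -> : (i - k == 0)%N by rewrite subn_eq0.
have [m0 d0] := zero_prefix v0.
have v1 : v k.+1 = 1 by rewrite /v subSnn.
have v2 : v k.+2 = 2 by rewrite /v subSn ?subSnn.
have := tied (v0 0%N (leq0n k)).
by rewrite !massS !dirichletS m0 d0 v1 v2 (v0 k (leqnn k)); lra.
Qed.

Lemma plateau_test : mu * (2 + N) <= 1.
Proof.
pose v i : R := (k < i)%N%:R; have v0 i : (i <= k)%N -> v i = 0.
  by move=> ik; rewrite /v ltnNge ik.
have [m0 d0] := zero_prefix v0.
have v1 : v k.+1 = 1 by rewrite /v ltnSn.
have v2 : v k.+2 = 1 by rewrite /v ltnS leqnSn.
have := tied (v0 0%N (leq0n k)).
by rewrite !massS !dirichletS m0 d0 v1 v2 (v0 k (leqnn k)); lra.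
Qed.
End TestFunctions.

Section UpperBound.
Local Open Scope ring_scope.
Variables (R : realType) (T : finType) (e : rel T).

(* c is the root; A' = desc t hangs below s on the side of s away from c, and
   desc w is the branch at c carrying the test function g. *)
Lemma rooted_bound c par dep s t w (rho : R) :
  rooted e c par dep -> s != c -> t != c -> par t = s ->
  w != c -> par w = c -> s \notin desc par dep w -> 0 < mu2 R e ->
  (forall x : T -> R, (forall y, y \notin (~: desc par dep s)%SET -> x y = 0) ->
     aform e x <= rho * nsq x) ->
  (exists z : T -> R, [/\ forall y, y \notin desc par dep t -> z y = 0,
     0 < nsq z & rho * nsq z <= aform e z]) ->
  (exists g : T -> R, [/\ forall y, 0 <= g y, forall y, y \notin desc par dep w -> g y = 0,
     0 < nsq g & lform e g <= mu2 R e * nsq g]) ->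
  (12 <= #|T|)%N /\ ((2 <= dep s)%N -> (2 * dep s + 11 <= #|T|)%N).
Proof.
move=> rt sc tc pt wc pw sw mu0 K_form [z [z0 nz az]] [g [g_ge0 g0 ng lg]].
have e_sym := rooted_sym rt; have e_conn := rooted_connect rt.
pose D := desc par dep; set d := dep s; set mu := mu2 R e in mu0 lg.
have dt : dep t = d.+1 by rewrite (dep_par rt tc) pt.
have d0 : (0 < d)%N by rewrite /d (dep_par rt sc).
have dw : dep w = 1%N by rewrite (dep_par rt wc) pw; case: rt => ->.
have T1 : (1 < #|T|)%N by rewrite (cardD1 c) (cardD1 s) !inE sc.
pose q := iter d par t.
have st : t \in D s by rewrite (desc_par rt) // pt desc_refl orbT.
have qE : q = iter d.-1 par s by rewrite /q -[d in LHS]prednK // iterSr pt.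
have dq : dep q = 1%N by rewrite qE (dep_iter_par rt) ?leq_pred // -/d; move: d0; clear; lia.
have qc : q != c by apply/eqP => qc; move: dq; rewrite qc; case: rt => ->.
have pq : par q = c by apply: (dep_eq0 rt); have := dep_par rt qc; rewrite dq => -[<-].
have sq : s \in D q by rewrite qE; apply: (desc_iter_par rt); exact: leq_pred.
have qw : q != w by apply: contraNneq sw => <-.
have disj y : y \in D q -> y \notin D w.
  by apply: (desc_siblings rt qc wc _ qw); rewrite pq pw.
have lform_ge (h : T -> R) : (forall y, y \notin D (iter (dep t).-1 par t) -> h y = 0) ->
    mu * nsq h <= lform e h.
  rewrite dt /= -/q => h0; apply: (mu2_separated e_sym e_conn T1 _ g_ge0 ng lg).
  split=> [u|u v euv].
    have [uq|uq] := boolP (u \in D q); last by rewrite h0 ?mulr0.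
    by rewrite g0 ?mul0r // disj.
  have [vq|vq] := boolP (v \in D q); last by rewrite h0 ?mulr0.
  have [uq|uq] := boolP (u \in D q); first by rewrite g0 ?mul0r // disj.
  rewrite e_sym in euv; have [_ _ ->] := desc_boundary rt euv vq uq.
  by rewrite pq g0 ?mul0r // (desc_root rt).
have gc : g c = 0 by apply: g0; rewrite (desc_root rt).
have [v [v0 mv lv vnz]] := rearrangement rt g_ge0 gc.
set m := #|[set u | g u != 0]| in mv lv vnz.
have mW : (m <= #|D w|)%N.
  apply/subset_leq_card/fintype.subsetP => y; rewrite inE.
  by apply: contraR => /g0 ->.
have m0 : (0 < m)%N.
  have [y gy] := nsq_neq0 ng; apply/card_gt0P; by exists y; rewrite inE.
have small_mu mu1 : mu <= mu1 ->
    (forall i, (0 < i <= m)%N -> useq mu1 i < useq mu1 i.+1) -> False.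
  move=> mm inc; apply: (dirichlet_contra v0 mm inc).
    by exists m => //; apply: vnz; rewrite m0 leqnn.
  by rewrite mv; apply: le_trans lv lg.
set K := (~: D s)%SET in K_form.
(* The d proper ancestors of s, up to the root, and the branch of w are disjoint parts of K. *)
have KW : (d + #|D w| <= #|K|)%N.
  pose p (i : 'I_d) := iter i.+1 par s.
  have dp (i : 'I_d) : dep (p i) = (d - i.+1)%N by rewrite (dep_iter_par rt).
  have p_inj : injective p.
    move=> i i' /(congr1 dep); rewrite !dp => H; apply: val_inj => /=.
    by move: H (ltn_ord i) (ltn_ord i'); clear; lia.
  have pD : [disjoint p @: [set: 'I_d] & D w].
    rewrite disjoint_subset; apply/fintype.subsetP => y /imsetP[i _ ->].
    rewrite inE; apply: contra sw => piw.
    by apply: (fintype.subsetP (desc_trans rt piw)); apply: (desc_iter_par rt).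
  have -> : d = #|p @: [set: 'I_d]| by rewrite card_imset // cardsT card_ord.
  have <- : (#|p @: [set: 'I_d] :|: D w| = #|p @: [set: 'I_d]| + #|D w|)%N.
    by rewrite cardsU (disjoint_setI0 pD) cards0 subn0.
  rewrite subset_leq_card // finset.subUset; apply/andP; split; apply/fintype.subsetP => y.
    move=> /imsetP[i _ ->]; rewrite finset.in_setC; apply/negP => /dep_desc.
    by rewrite dp -/d; move: (ltn_ord i); clear; lia.
  move=> yw; rewrite finset.in_setC; apply/negP => ys.
  have [|ws] := desc_comparable rt ys yw; first by move=> ws; move: sw; rewrite -/D ws.
  have := dep_desc ws; rewrite dw -/d => d1; move: ws; rewrite [w \in _]inE dw -/d d1 /=.
  have -> : (1 - d = 0)%N by move: d0; clear; lia.
  by move=> /eqP /= ws'; move: sw; rewrite -ws' desc_refl.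
set A := #|D t :\ t|.
(* Outside K there are s, t and the A vertices strictly below t. *)
have nK : (#|K| + A.+2 <= #|T|)%N.
  rewrite -(cardsC (D s)) addnC leq_add2r /A.
  rewrite (cardsD1 s (D s)) desc_refl add1n ltnS.
  have -> : (#|D t :\ t|.+1 = #|D t|)%N by rewrite [RHS](cardsD1 t) desc_refl.
  apply/subset_leq_card/fintype.subsetP => y yt; rewrite finset.in_setD1.
  rewrite (fintype.subsetP (desc_trans rt st) y yt) andbT.
  by apply: contraTneq yt => ->; rewrite -pt; exact: (par_notin_desc rt).
have rK : c \in K by exact: (root_notin_desc rt).
have K_par : forall y, y != c -> y \in K -> par y \in K by exact: (desc_setC_par rt).
have avg := radius_ge_average rt rK K_par K_form.
have r74 := radius_ge_7_4 rt rK K_par K_form.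
have K2 : (2 <= #|K|)%N by move: KW d0 m0 mW; clear; lia.
have k2 : 2 <= #|K|%:R :> R by rewrite ler_nat.
have rho0 : 0 <= rho by nra.
have rA := desc_radius_sq rt z0 nz rho0 az; rewrite -/A in rA.
have tied := chain_tied_bound rt (ltW mu0) lform_ge.
rewrite dt -/A -[d]prednK // in tied.
have ramp := ramp_test tied; have plateau := plateau_test tied.
have small3 : mu <= 12 / 100 -> (5 <= m)%N.
  move=> mu12; rewrite leqNgt; apply/negP => m5; apply: (small_mu _ mu12).
  by apply: useq_small; apply: Or31.
have [A4|A4] := leqP 4 A.
  have bb := chain_broom_bound rt (ltW mu0) lform_ge A4; rewrite dt in bb.
  have m5 : (5 <= m)%N.
    apply: small3; have : 4 <= A%:R :> R by rewrite ler_nat.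
    by move: ramp mu0; clear; nra.
  split; first by move: nK KW mW m5 A4 d0; clear; lia.
  (* The handle has j = d + 1 >= 3 vertices, so [useq] increases up to index d + 5, and this
     excludes m <= d + 4. *)
  move=> d2; suff : (d + 5 <= m)%N by move: nK KW mW A4; clear; lia.
  rewrite leqNgt; apply/negP => md; apply: (small_mu _ (lexx _)) => i /andP[i0 im].
  by apply: (broom_bound_useq mu0 _ bb); [exact: d2 | move: i0 im md; clear; lia].
(* For A = 3, m >= 5 gives rho >= 7/4 against rho^2 <= 3. For A = 2, m >= 3 gives rho >= 3/2 against
   rho^2 <= 2, and m <= 2 contradicts mu <= 1/4. For A <= 1, m >= 2 gives rho >= 4/3 against rho <=
   1, and m = 1 contradicts mu <= 1/2. *)
exfalso; have mK : (m < #|K|)%N by move: KW mW d0; clear; lia.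
have k_le (k : nat) : (k < #|K|)%N -> k.+1%:R <= #|K|%:R :> R by rewrite ler_nat.
have K5 : (3 <= #|K|)%N -> rho < 4 / 3 -> False.
  by move=> /k_le; move: avg; clear; nra.
have [A3|A3] := eqVneq A 3%N.
  rewrite A3 in rA ramp.
  have : (5 <= m)%N by apply: small3; move: ramp; clear; lra.
  move=> m5; have K6 : (6 <= #|K|)%N by exact: leq_trans mK.
  by have := r74 K6; move: rA; clear; nra.
have [A2|A2] := eqVneq A 2%N.
  rewrite A2 in rA plateau; have [m3|m3] := leqP 3 m.
    have /k_le : (3 < #|K|)%N by exact: leq_ltn_trans mK.
    by move: avg rA rho0; clear; nra.
  apply: (small_mu 4^-1); first by move: plateau; clear; lra.
  by apply: useq_small; apply: Or32.
have A1 : (A <= 1)%N by move: A4 A3 A2; clear; lia.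
have A1R : A%:R <= 1 :> R by rewrite lern1.
have [m2|m2] := leqP 2 m.
  apply: K5; first exact: leq_ltn_trans mK.
  by move: rA A1R rho0; clear; nra.
apply: (small_mu 2^-1).
  by have := ler0n R A; move: plateau mu0; clear; nra.
by apply: useq_small; apply: Or33.
Qed.
End UpperBound.

Section CenterDistance.
Local Open Scope ring_scope.
Variables (R : realType) (T : finType) (e : rel T).
Hypothesis e_tree : is_tree e.

Lemma tree_sym : symmetric e. Proof. by case: e_tree. Qed.

Lemma tree_connect x y : connect e x y.
Proof. by case: e_tree => _ _ /andP[_ /forallP/(_ x)/forallP/(_ y)]. Qed.

(** The whole vertex set leaves no component, since components are nonempty; so a minimal set exists
    and the default of [odflt] is not reached. *)
Lemma adj_center_minset : minset (center_condition R e) (adj_center R e).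
Proof.
have [r _] : exists r, r \in T.
  by case: e_tree => _ _ /andP[/card_gt0P].
have [par rt] := tree_rooted r e_tree.
have full : center_condition R e [set: T].
  apply/andP; split; first by apply: (par_closed_connected rt).
  apply/forallP => K; apply/implyP => /maxsetp /andP[].
  rewrite finset.setCT finset.subset0 => /eqP -> /andP[/card_gt0P[[x x0]] _].
  by rewrite inE in x0.
have [Y Ymin _] := minset_exists full.
by rewrite /adj_center; case: pickP => [Y' //|/(_ Y)]; rewrite Ymin.
Qed.

Hypothesis T_gt1 : (1 < #|T|)%N.

Lemma char_set_fiedler : exists phi : T -> R,
  [/\ char_set R e = char_set_of e (colf phi),
    forall t, \sum_v (e t v)%:R * (phi t - phi v) = mu2 R e * phi t,
    \sum_t phi t = 0 & exists t, phi t != 0].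
Proof.
have [f0 Ff0] := fiedler_exists R tree_sym T_gt1.
have Ff : is_fiedler e (xget 0 [set f | is_fiedler e f]%classic : 'cV[R]_#|T|).
  by apply: (@xgetPex _ 0 [set f | is_fiedler e f]%classic); exists f0.
have [phi [E1 E2 E3 E4]] := fiedler_colf tree_sym tree_connect T_gt1 Ff.
by exists phi; split=> //; rewrite -E1.
Qed.

Lemma tree_center_dist : let d := center_dist R e in (0 < d)%N ->
  (12 <= #|T|)%N /\ ((2 <= d)%N -> (2 * d + 11 <= #|T|)%N).
Proof.
have e_sym := tree_sym; have e_conn := tree_connect.
have [phi [CE phiE phi_sum phi0]] := char_set_fiedler.
have [c0 c0C] := char_set_nonempty e_sym e_conn phi_sum phi0; rewrite -CE in c0C.
have Ycond := minsetp adj_center_minset; set Y := adj_center R e in Ycond.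
have [s0 s0Y] : exists s0, s0 \in Y.
  by have /andP[/andP[/card_gt0P[[s0 s0Y] _] _] _] := Ycond; exists s0.
have [s [c [sY cC dE]]] := set_dist_attained e_conn s0Y c0C.
rewrite /center_dist -/Y dE => d0.
have dmin x y : x \in Y -> y \in char_set R e -> (gdist e s c <= gdist e x y)%N.
  by move=> xY yC; rewrite -dE; exact: set_dist_le.
have [par rt] := tree_rooted c e_tree.
have sc : s != c.
  apply/eqP => sc; move: d0; rewrite sc.
  by have := @gdist_le _ e c [::] isT; rewrite leqn0 => /eqP ->.
have ds : gdist e s c = gdist e c s by exact: gdistC.
have psY : par s \notin Y.
  apply/negP => psY; have := dmin _ _ psY cC.
  by rewrite ds (dep_par rt sc) (gdistC e_sym (e_conn _ _)) ltnn.
have [t [tc pt Hz]] := heavy_child rt Ycond sY sc psY.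
have nbr w : e c w -> w != c /\ par w = c.
  by rewrite (rootedE rt) eqxx /= => /andP[wc /eqP].
(* If phi c = 0, neighbours of opposite sign lie in different branches, and one of these misses s.
   On a characteristic edge, s below w would make w a point of the characteristic set nearer to s
   than c. *)
have [w [ecw sw pw w0]] : exists w, [/\ e c w, s \notin desc par (gdist e c) w,
    phi c * phi w <= 0 & phi w != 0].
  rewrite CE in cC; have [] := char_set_sign e_sym phiE cC.
    move=> [pc [w1 [w2 [e1 e2 p1 p2]]]].
    have w12 : w1 != w2 by apply/eqP => w12; move: p1 p2; rewrite w12; lra.
    have [[n1 q1] [n2 q2]] := (nbr _ e1, nbr _ e2).
    have [sw1|sw1] := boolP (s \in desc par (gdist e c) w1).
      exists w2; rewrite pc mul0r lexx gt_eqF //; split=> //.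
      by apply: (desc_siblings rt n1 n2 _ w12 sw1); rewrite q1 q2.
    by exists w1; rewrite pc mul0r lexx lt_eqF.
  move=> [w [ecw pw wC]]; exists w; split=> //; last 2 first.
  - exact: ltW.
  - by apply: contraTneq pw => ->; rewrite mulr0 ltxx.
  apply/negP => sw; have := gdist_desc rt sw; have [wc qw] := nbr _ ecw.
  have := dmin s w sY; rewrite CE => /(_ wC); rewrite (dep_par rt wc) -ds.
  by move: (gdist e s w) (gdist e s c) (gdist e c _) d0; clear; lia.
have [wc qw] := nbr _ ecw.
rewrite ds; apply: (rooted_bound rt sc tc pt wc qw sw) => //.
- exact: mu2_gt0.
- by move=> x x0; apply: aform_le_component => //; exact: x0.
- exact: Hz.
by apply: (sign_branch phiE rt wc) => //; rewrite qw.
Qed.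
End CenterDistance.

(** * Brooms *)

Section Broom.
Variables k l : nat.
Local Notation V := 'I_(k + l + 1).

Lemma broom_gt0 : 0 < k + l + 1. Proof. by rewrite addn1. Qed.
Definition broom_root : V := Ordinal broom_gt0.

Lemma broom_par_lt (i : V) : (if i <= k then i.-1 else k) < k + l + 1.
Proof.
apply: leq_ltn_trans (ltn_ord i); by case: (leqP i k) => ik; rewrite ?leq_pred // ltnW.
Qed.
Definition broom_par i : V := Ordinal (broom_par_lt i).
Definition broom_dep (i : V) := minn i k.+1.

Lemma broom_rooted : rooted (broom k l) broom_root broom_par broom_dep.
Proof.
split=> [|x|x y]; first by rewrite /broom_dep min0n.
  rewrite -val_eqE /broom_dep /=; move: (nat_of_ord x) => m m0.
  by case: (leqP m k) => mk; lia.
rewrite /broom /= -!val_eqE /= orbC; congr (_ || _).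
  by case: (leqP x k) => xk; apply/idP/idP; lia.
by case: (leqP y k) => xk; apply/idP/idP; lia.
Qed.

Lemma broom_tree : is_tree (broom k l).
Proof. exact: rooted_tree broom_rooted. Qed.

Lemma card_broom : #|V| = (k + l).+1.
Proof. by rewrite card_ord addn1. Qed.

Lemma broom_leaf_edge (x y : V) : k < x -> broom k l x y -> y = k :> nat.
Proof. by rewrite /broom /=; lia. Qed.

Lemma broom_dep_edge (x y : V) : broom k l x y ->
  broom_dep x = (broom_dep y).+1 \/ broom_dep y = (broom_dep x).+1.
Proof.
rewrite (rootedE broom_rooted) => /orP[] /andP[nr /eqP <-].
  by left; exact: (dep_par broom_rooted nr).
by right; exact: (dep_par broom_rooted nr).
Qed.

End Broom.

(** * The adjacency center of a broom *)

Section BroomCenter.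
Variables (R : realType) (k : nat).
Hypothesis k2 : 2 <= k.
Local Notation V := 'I_(k + 4 + 1).
Local Notation E := (broom k 4).
Local Notation rt := (broom_rooted k 4).
Let e_sym := rooted_sym rt.
Let e_conn := rooted_connect rt.

Lemma hub_lt : k < k + 4 + 1. Proof. by rewrite -addnA -{1}[k]addn0 ltn_add2l. Qed.
Definition hub : V := Ordinal hub_lt.
Definition neck : V := broom_par hub.

Let hub_neq_root : hub != broom_root k 4.
Proof. by rewrite -val_eqE /=; lia. Qed.
Let T_gt1 : 1 < #|{: V}|. Proof. by rewrite card_broom; lia. Qed.

Local Open Scope ring_scope.

(** Every vertex carrying mass has at most one child, so [lform] + [aform] <= 2 [nsq]; and [lform] >
    0, as a constant z would vanish along with its value at the hub. *)
Lemma path_form_lt (z : V -> R) : (forall y : V, (k <= y)%N -> z y = 0) -> 0 < nsq z ->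
  aform E z < 2 * nsq z.
Proof.
move=> z0 nz; have lz : 0 < lform E z.
  rewrite ltNge; apply/negP => lz; have zc := lform_eq0_const e_sym e_conn lz.
  move: nz; rewrite /nsq big1 ?ltxx // => y _.
  by rewrite (zc y hub) z0 ?expr0n /=.
suff : lform E z + aform E z <= 2 * nsq z by lra.
rewrite (lform_rooted rt) (aform_rooted rt) mulr_sumr -big_split /=.
rewrite (eq_bigr (fun y => z y ^+ 2 + z (broom_par y) ^+ 2)); last by move=> y _; ring.
rewrite big_split /= mulr_natl mulr2n; apply: lerD.
  by rewrite /nsq [leRHS](bigD1 (broom_root k 4)) //= ler_wpDl ?sqr_ge0.
rewrite (partition_big (@broom_par k 4) xpredT) //=; apply: ler_sum => x _.
have [xk|xk] := leqP k x.
  by rewrite big1 => [|y /andP[_ /eqP ->]]; rewrite z0 // expr0n.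
rewrite (eq_bigr (fun=> z x ^+ 2)) => [|y /andP[_ /eqP ->] //].
rewrite sumr_const -[leRHS]mulr1n ler_wpMn2l ?sqr_ge0 //.
apply/card_le1_eqP => y y' /andP[y0 yx] /andP[y0' yx']; apply: val_inj.
move: y0 y0' yx yx' xk; rewrite -!val_eqE /=; clear.
case: (leqP y k) => yk; case: (leqP y' k) => yk'; lia.
Qed.

(** The Perron vector of the star formed by the hub and its four leaves, with eigenvalue 2. *)
Definition star (x : V) : R := if x == k :> nat then 2 else if (k < x)%N then 1 else 0.

Lemma sum_leaves : \sum_(y : V) (k < y)%N%:R = 4 :> R.
Proof.
rewrite -natr_sum; congr _%:R; rewrite !big_split_ord /= big1 => [|i _].
  have lt_addr m : (k < k + m)%N = (0 < m)%N by rewrite -{1}[k]addn0 ltn_add2l.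
  have e0 : (k < k + 4 + 0)%N by rewrite addn0 lt_addr.
  by rewrite !big_ord_recl !big_ord0 /= e0 !lt_addr.
by rewrite ltnNge (ltnW (ltn_ord i)).
Qed.

Lemma star_forms : nsq star = 8 /\ aform E star = 16.
Proof.
split.
  rewrite /nsq (eq_bigr (fun y : V => (y == hub)%:R * 4 + (k < y)%N%:R)) => [|y _].
    rewrite big_split /= sum_leaves (bigD1 hub) //= eqxx big1 => [|y /negPf ->]; rewrite ?mul0r // mul1r; ring.
  rewrite /star -[y == k :> nat]/(val y == val hub) val_eqE; case: eqVneq => [->|_].
    by rewrite /= ltnn mul1r addr0; ring.
  by case: ltnP => _; rewrite mul0r add0r ?expr1n ?expr0n.
rewrite (aform_rooted rt) (eq_bigr (fun y : V => 2 * (k < y)%N%:R)) => [|y y0].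
  rewrite -mulr_sumr; have := sum_leaves; rewrite (bigD1 (broom_root k 4)) //= add0r => ->.
  ring.
rewrite /star /=; case: (ltngtP k y) => ky; rewrite ?eqxx /=; first by ring.
  by rewrite mul0r mulr0.
have lk : (k.-1 < k)%N by move: k2; clear; lia.
by rewrite -ky (ltn_eqF lk) (ltnNge k) (ltnW lk) !mulr0.
Qed.

(** Otherwise root at the hub and take s in Y nearest to it. The component containing the hub also
    contains its leaves, so [star] gives it radius at least 2; but the branch supplied by
    [heavy_child] lies in the handle, where quotients are below 2. *)
Lemma hub_in_center (Y : {set V}) : center_condition R E Y -> hub \in Y.
Proof.
move=> Yc; apply: contrapT => /negP hY.
have [par rth] := tree_rooted hub (broom_tree k 4).
have [s0 s0Y] : exists s0, s0 \in Y.
  by have /andP[/andP[/card_gt0P[[s0 s0Y] _] _] _] := Yc; exists s0.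
have [s sY smin] := @arg_minnP _ s0 (mem Y) (gdist E hub) s0Y.
have sh : s != hub by apply: contraNneq hY => <-.
have psY : par s \notin Y.
  by apply/negP => /smin; rewrite (dep_par rth sh) ltnn.
have [t [th pt [z [z0 nz az]]]] := heavy_child rth Yc sY sh psY.
have leaf_par (x : V) : (k < x)%N -> par x = hub.
  move=> kx; have xh : x != hub by rewrite -val_eqE /= gtn_eqF.
  by apply: val_inj; rewrite /= (broom_leaf_edge kx (par_edge rth xh)).
have leaf_desc (x y : V) : (k < x)%N -> y != hub -> x \in desc par (gdist E hub) y -> x = y.
  move=> kx yh; have xh : x != hub by rewrite -val_eqE /= gtn_eqF.
  rewrite (desc_par rth) // => /orP[/eqP //|]; rewrite leaf_par // (desc_root rth).
  by rewrite (negPf yh).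
have sk : (s < k)%N.
  rewrite ltn_neqAle -[s == k :> nat]/(val s == val hub) val_eqE sh /= leqNgt.
  apply/negP => ks; have := broom_leaf_edge ks (_ : E s t).
  rewrite e_sym -pt (par_edge rth th) => /(_ isT) tk.
  by move: th; rewrite -val_eqE /= tk eqxx.
have zk (y : V) : (k <= y)%N -> z y = 0.
  move=> ky; apply: z0; have [->|yh] := eqVneq y hub.
    by rewrite (desc_root rth).
  have ky' : (k < y)%N by rewrite ltn_neqAle ky eq_sym andbT; exact: yh.
  apply/negP => /(leaf_desc _ _ ky' th) yt; move: sk; rewrite -pt -yt leaf_par //=.
  by rewrite ltnn.
have := path_form_lt zk nz; apply/negP; rewrite -leNgt; apply: le_trans az.
rewrite ler_wpM2r ?nsq_ge0 //; have [ns as_] := star_forms.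
have := aform_le_component (K := (~: desc par (gdist E hub) s)%SET) e_sym (x := star).
rewrite ns as_ => H; suff : 16 <= spectral_radius
  (adjacency R (induced E (~: desc par (gdist E hub) s))) * 8 :> R by lra.
apply: H => y; rewrite finset.in_setC negbK => ys.
have yh : y != hub by apply: contraTneq ys => ->; rewrite (desc_root rth).
rewrite /star -[y == k :> nat]/(val y == val hub) val_eqE (negPf yh).
case: ltnP => // ky; have := leaf_desc _ _ ky sh ys => yE.
by move: sk; rewrite -yE ltnNge ltnW.
Qed.

(** Otherwise the component on the handle side of the hub has at least 2 vertices, hence radius at
    least 1, while the child supplied by [heavy_child] is a leaf, whose branch has radius 0. *)
Lemma neck_in_center (Y : {set V}) : center_condition R E Y -> neck \in Y.
Proof.
move=> Yc; apply: contrapT => /negP nY; have hY := hub_in_center Yc.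
have [t [tr pt [z [z0 nz az]]]] := heavy_child rt Yc hY hub_neq_root nY.
set K := (~: _)%SET in az.
have rK : broom_root k 4 \in K by exact: (root_notin_desc rt).
have nK : neck \in K by rewrite finset.in_setC (par_notin_desc rt).
have K_par : forall y, y != broom_root k 4 -> y \in K -> broom_par y \in K.
  exact: (desc_setC_par rt).
have K_form (x : V -> R) : (forall t, t \notin K -> x t = 0) ->
    aform E x <= spectral_radius (adjacency R (induced E K)) * nsq x.
  exact: (aform_le_component e_sym).
have avg := radius_ge_average rt rK K_par K_form.
have K2 : (2 <= #|K|)%N.
  have rn : broom_root k 4 != neck.
    by rewrite -val_eqE /= leqnn; move: k2; clear; case: (k) => [|[]].
  have c2 : (#|[set broom_root k 4; neck]| = 2)%N by rewrite cards2 rn.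
  apply: leq_trans (_ : #|[set broom_root k 4; neck]| <= _)%N; first by rewrite c2.
  by apply: subset_leq_card; rewrite finset.subUset !finset.sub1set rK.
have k2' : 2 <= #|K|%:R :> R by rewrite ler_nat.
have rho1 : 1 <= spectral_radius (adjacency R (induced E K)) :> R.
  by move: avg k2'; move: (#|K|%:R : R) (spectral_radius _ : R) => a b; nra.
have := desc_radius_sq rt z0 nz (le_trans ler01 rho1) az.
have -> : desc (@broom_par k 4) (@broom_dep k 4) t :\ t = finset.set0.
  apply/setP => y; rewrite finset.in_setD1 finset.in_set0; apply/negP => /andP[yt].
  rewrite inE => /andP[ty /eqP it]; move: yt.
  have kt : (k < t)%N.
    move/(congr1 val): pt tr; rewrite -val_eqE /=; move: (nat_of_ord t) k2; clear => m k2.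
    by case: leqP => //; lia.
  have dy : broom_dep y = broom_dep t.
    move: ty kt; rewrite /broom_dep; move: (nat_of_ord t) (nat_of_ord y); clear => m m'.
    by lia.
  by rewrite -it dy subnn /= eqxx.
by rewrite cards0; move: (spectral_radius _ : R) rho1 => a; nra.
Qed.

Let e_hn : E hub neck. Proof. exact: (par_edge rt hub_neq_root). Qed.

Let star_far (z : V -> R) : (forall y : V, (k.-1 <= y)%N -> z y = 0) -> separated E z star.
Proof.
move=> z0; have low (v : V) : (v < k)%N -> star v = 0.
  by move=> vk; rewrite /star ltn_eqF // ltnNge ltnW.
split=> [u|u v euv]; (have [ku|ku] := leqP k.-1 u; first by rewrite z0 ?mul0r);
  rewrite low ?mulr0 //.
  by apply: leq_trans ku _; exact: leq_pred.
have := broom_dep_edge euv; rewrite /broom_dep; move: ku k2.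
by move: (nat_of_ord u) (nat_of_ord v); clear => m m'; lia.
Qed.

(** The pair leaves single leaves, for which lambda_2 >= 0 suffices, and a piece of the handle of
    radius rho < 2. The maximizer on that piece and [star] are separated with quotients at least
    rho, so [lambda2_ge] applies. *)
Lemma center_condition_pair : center_condition R E [set neck; hub].
Proof.
have nh : neck != hub by rewrite -val_eqE /= leqnn; move: k2; clear; lia.
have i_sym : connect_sym (induced E [set neck; hub]).
  by apply: sym_connect_sym => u v; exact: e_sym.
have nP : neck \in [set neck; hub] by rewrite !inE eqxx.
have hP : hub \in [set neck; hub] by rewrite !inE eqxx orbT.
have [ns as_] := star_forms.
apply/andP; split.
  apply/andP; split; first by apply/card_gt0P; exists (Sub neck nP).
  have H x (xP : x \in [set neck; hub]) :
      connect (induced E [set neck; hub]) (Sub x xP) (Sub neck nP).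
    have /finset.set2P[xE|xE] := xP; subst x.
      by rewrite (bool_irrelevance xP nP) connect0.
    by apply: connect1; exact: e_hn.
  apply/forallP => -[x xP]; apply/forallP => -[y yP].
  by apply: connect_trans (H x xP) _; rewrite i_sym; exact: H.
apply/forallP => K; apply/implyP => /maxsetp /= /andP[Ksub Kc].
have K0 : K != finset.set0.
  by have /andP[/card_gt0P[[x xK] _] _] := Kc; apply/set0Pn; exists x.
have [x [x_ge0 x0 nx ax]] := component_radius_attained R e_sym K0.
set rho := spectral_radius _ in ax *.
have sep0 : separated E (fun y : V => (y == broom_root k 4)%:R) star.
  apply: star_far => y ky; rewrite -val_eqE /= gtn_eqF //; move: ky k2.
  by move: (nat_of_ord y); clear => m; lia.
have l2 : 0 <= lambda2 R E.
  apply: (lambda2_ge e_sym sep0); rewrite ?ns ?as_ ?mul0r //.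
    by apply: (nsq_gt0 (t := broom_root k 4)); rewrite eqxx oner_eq0.
  by apply: sumr_ge0 => u _; apply: sumr_ge0 => v _; rewrite !mulr_ge0 ?ler0n.
have notin (y : V) : y \in K -> (y != k :> nat) && (y != k.-1 :> nat).
  move=> /(fintype.subsetP Ksub); by rewrite !inE negb_or -!val_eqE /= leqnn andbC.
have [/existsP[y /andP[yK ky]]|/existsPn low] := boolP [exists y : V, (y \in K) && (k < y)%N].
  have Ky u : u \in K -> u = y.
    move=> uK; apply/eqP/negPn/negP => uy.
    have := @induced_boundary _ _ K [set y] y u e_sym Kc yK (set11 y) uK.
    rewrite inE uy => /(_ isT)[a [b [aK ay bK by_ eab]]].
    move: ay; rewrite inE => /eqP ay; rewrite ay in eab.
    by have := notin b bK; rewrite (broom_leaf_edge ky eab) eqxx.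
  have a0 : aform E x = 0.
    rewrite /aform big1 // => u _; rewrite big1 // => v _.
    have [uK|uK] := boolP (u \in K); last by rewrite x0 ?mul0r ?mulr0.
    have [vK|vK] := boolP (v \in K); last by rewrite (x0 v) ?mulr0.
    by rewrite (Ky u uK) (Ky v vK) (rooted_irr rt) mul0r.
  apply: le_trans l2; rewrite -(ler_pM2r nx) mul0r -a0; exact: ax.
have xk (y : V) : (k.-1 <= y)%N -> x y = 0.
  move=> ky; apply: x0; apply/negP => yK; have := notin y yK; have := low y.
  by rewrite yK /= -leqNgt; move: ky k2; move: (nat_of_ord y); clear => m; lia.
have rho2 : rho < 2.
  rewrite -(ltr_pM2r nx); apply: le_lt_trans ax _; apply: path_form_lt => // y ky.
  by apply: xk; apply: leq_trans ky; exact: leq_pred.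
apply: (lambda2_ge e_sym (star_far xk)) => //; rewrite ns //.
rewrite as_; lra.
Qed.

Lemma broom_center : adj_center R E = [set neck; hub].
Proof.
have /minsetP[Yc Ymin] := adj_center_minset R (broom_tree k 4).
apply/esym/Ymin; first exact: center_condition_pair.
by rewrite finset.subUset !finset.sub1set neck_in_center // hub_in_center.
Qed.

End BroomCenter.

(* Vertices 0, ..., b + j of the broom form the path; b cuts it into a path of
   b vertices and a broom with a handle of j vertices. *)
Section CutBroom.
Local Open Scope ring_scope.
Variables (R : realType) (b j : nat).
Local Notation V := 'I_(b + j + 4 + 1).
Local Notation E := (broom (b + j) 4).
Local Notation root := (broom_root (b + j) 4).
Local Notation par := (@broom_par (b + j) 4).
Local Notation rt := (broom_rooted (b + j) 4).

Lemma sum_nonroot (G : nat -> R) : \sum_(y : V | y != root) G y =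
  \sum_(i < b) G i.+1 + \sum_(i < j) G (b + i).+1 + \sum_(i < 4) G (b + j + i).+1.
Proof.
rewrite big_mkcond /= (eq_bigr (fun y : V => if (y : nat) != 0%N then G y else 0)) //.
rewrite -(big_mkord xpredT (fun i => if i != 0%N then G i else 0)) addn1.
by rewrite big_nat_recl //= add0r big_mkord !big_split_ord.
Qed.

Let ext (g : V -> R) i := oapp g 0 (insub i).

Let extE g y : g y = ext g (val y).
Proof. by rewrite /ext valK. Qed.

Lemma lform_broom (g : nat -> R) : lform E (fun y : V => g y) =
  dirichlet g b + \sum_(i < j) (g (b + i).+1 - g (b + i)%N) ^+ 2 +
  \sum_(i < 4) (g (b + j + i).+1 - g (b + j)%N) ^+ 2.
Proof.
rewrite (lform_rooted rt) /=.
rewrite (sum_nonroot (fun y => (g y - g (if (y <= b + j)%N then y.-1 else (b + j)%N)) ^+ 2)).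
congr (_ + _ + _); apply: eq_bigr => i _.
- by rewrite ltn_addr.
- by rewrite ltn_add2l ltn_ord.
by rewrite ltnNge leq_addr.
Qed.

Lemma nsq_broom (g : nat -> R) : nsq (fun y : V => g y) = g 0%N ^+ 2 +
  (mass g b + \sum_(i < j) g (b + i).+1 ^+ 2 + \sum_(i < 4) g (b + j + i).+1 ^+ 2).
Proof. by rewrite /nsq (bigD1 root) //= (sum_nonroot (fun y => g y ^+ 2)). Qed.

(** Read backwards, f i = v (b - i) puts the zero at the cut b and the free end at the root. *)
Lemma path_side (mu : R) : 0 <= mu ->
  (forall h : V -> R, (forall y : V, (b <= y)%N -> h y = 0) -> mu * nsq h <= lform E h) ->
  forall v, v 0%N = 0 -> mu * mass v b <= dirichlet v b.
Proof.
move=> mu0 H v v0; pose f i := v (b - i)%N.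
have z i : (b <= i)%N -> f i = 0 by rewrite /f -subn_eq0 => /eqP ->.
have zb i : f (b + i)%N = 0 by apply: z; exact: leq_addr.
have zbS i : f (b + i).+1 = 0 by apply: z; rewrite leqW ?leq_addr.
have {H} := H (fun y : V => f y) (fun y => z y); rewrite lform_broom nsq_broom.
rewrite (_ : \sum_(i < j) (f (b + i).+1 - f (b + i)%N) ^+ 2 = 0); last first.
  by rewrite big1 // => i _; rewrite zb zbS subrr expr0n.
rewrite (_ : \sum_(i < 4) (f (b + j + i).+1 - f (b + j)%N) ^+ 2 = 0); last first.
  by rewrite big1 // => i _; rewrite zb -addnA zbS subrr expr0n.
rewrite (_ : \sum_(i < j) f (b + i).+1 ^+ 2 = 0); last first.
  by rewrite big1 // => i _; rewrite zbS expr0n.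
rewrite (_ : \sum_(i < 4) f (b + j + i).+1 ^+ 2 = 0); last first.
  by rewrite big1 // => i _; rewrite -addnA zbS expr0n.
rewrite !addr0.
have -> : dirichlet f b = dirichlet v b.
  rewrite /dirichlet (reindex_inj rev_ord_inj) /=; apply: eq_bigr => i _.
  have ib := ltn_ord i; rewrite /f subnSK // !subKn ?(ltnW ib) //.
  by rewrite -sqrrN opprB.
apply: le_trans; rewrite ler_wpM2l // [mass f b]/mass.
rewrite -(big_mkord xpredT (fun i => f i.+1 ^+ 2)).
rewrite -(big_nat_recl b 0 (fun i => f i ^+ 2)) // big_mkord big_ord_recr /=.
rewrite z // expr0n addr0 /mass (reindex_inj rev_ord_inj) /=.
by apply: ler_sum => i _; rewrite /f -subSn ?subSS // ltn_ord.
Qed.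

(** [picone] on the handle, and a completed square at each leaf around the optimal value v_j / (1 -
    mu). The hub inequality makes the remaining coefficient of v_j^2 positive, so v_j, then the
    leaves, then the handle vanish. *)
Lemma broom_picone (mu : R) (v l : nat -> R) :
  0 < mu < 1 -> (0 < j)%N -> (forall i, (0 < i <= j)%N -> useq mu i < useq mu i.+1) ->
  4 * mu * useq mu j < (1 - mu) * (useq mu j.+1 - useq mu j) -> v 0%N = 0 ->
  dirichlet v j + \sum_(i < 4) (l i - v j) ^+ 2 <=
    mu * (mass v j + \sum_(i < 4) l i ^+ 2) ->
  (forall i, (i <= j)%N -> v i = 0) /\ (forall i : 'I_4, l i = 0).
Proof.
move=> /andP[mu0 mu1] j0 inc hub v0 H; have u_gt0 := useq_increasing_gt0 inc.
have pic : mu * mass v j + v j ^+ 2 * (useq mu j.+1 / useq mu j - 1) <= dirichlet v j.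
  case: (j) j0 u_gt0 => [//|j'] _ u_gt0; apply: picone => // i /andP[i0 ij].
  by apply: u_gt0; rewrite i0 leqW.
have uj : 0 < useq mu j by apply: u_gt0; rewrite j0 leqW.
have m1 : 0 < 1 - mu by lra.
have leaves : \sum_(i < 4) ((l i - v j) ^+ 2 - mu * l i ^+ 2) =
    (1 - mu) * (\sum_(i < 4) (l i - v j / (1 - mu)) ^+ 2) - 4 * (v j ^+ 2 * (mu / (1 - mu))).
  rewrite mulr_sumr; transitivity (\sum_(i < 4) ((1 - mu) * (l i - v j / (1 - mu)) ^+ 2 -
     v j ^+ 2 * (mu / (1 - mu)))).
    by apply: eq_bigr => i _; field; rewrite gt_eqF.
  by rewrite sumrB sumr_const card_ord mulr_natl.
rewrite sumrB -mulr_sumr in leaves.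
pose S := \sum_(i < 4) (l i - v j / (1 - mu)) ^+ 2.
have S0 : 0 <= (1 - mu) * S.
  by apply: mulr_ge0; [exact: ltW | apply: sumr_ge0 => i _; exact: sqr_ge0].
have key : v j ^+ 2 * (useq mu j.+1 / useq mu j - 1 - 4 * (mu / (1 - mu))) <= 0.
  by move: leaves S0 pic H; rewrite -/S; lra.
have pos : 0 < useq mu j.+1 / useq mu j - 1 - 4 * (mu / (1 - mu)).
  have -> : useq mu j.+1 / useq mu j - 1 - 4 * (mu / (1 - mu)) =
    ((1 - mu) * (useq mu j.+1 - useq mu j) - 4 * mu * useq mu j) / (useq mu j * (1 - mu)).
    by field; rewrite !gt_eqF.
  by rewrite divr_gt0 ?mulr_gt0 // subr_gt0.
have vj : v j = 0.
  apply/eqP; rewrite -sqrf_eq0 eq_le sqr_ge0 andbT.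
  by rewrite -(ler_pM2r pos) mul0r.
have l0 : \sum_(i < 4) l i ^+ 2 <= 0.
  move: H pic; rewrite vj expr0n mul0r addr0; under eq_bigr => i _ do rewrite subr0.
  by move=> H pic; rewrite -(ler_pM2l m1) mulr0; lra.
have lz (i : 'I_4) : l i = 0.
  have /eqP : \sum_(i < 4) l i ^+ 2 = 0.
    by apply/eqP; rewrite eq_le l0 sumr_ge0 // => i' _; exact: sqr_ge0.
  rewrite psumr_eq0 => [/allP/(_ i (mem_index_enum _))|i' _]; last exact: sqr_ge0.
  by rewrite /= sqrf_eq0 => /eqP.
split=> // i ij; apply/eqP/negPn/negP => vi.
have := dirichlet_gt v0 inc (ex_intro2 _ _ i ij vi); rewrite ltNge => /negP; apply.
move: H; rewrite vj !big1 ?addr0 // => i' _; rewrite lz ?subr0 expr0n //.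
Qed.

Lemma broom_side (mu : R) (g : V -> R) :
  0 < mu < 1 -> (0 < j)%N -> (forall i, (0 < i <= j)%N -> useq mu i < useq mu i.+1) ->
  4 * mu * useq mu j < (1 - mu) * (useq mu j.+1 - useq mu j) ->
  (forall y : V, (y <= b)%N -> g y = 0) -> lform E g <= mu * nsq g -> nsq g <= 0.
Proof.
move=> mu01 j0 inc hub g0; pose G := ext g.
have gE : g = (fun y : V => G y) by apply/funext => y; exact: extE.
have G0 i : (i <= b)%N -> G i = 0.
  move=> ib; rewrite /G /ext; case: insubP => //= y _ yi; apply: g0.
  by rewrite yi.
rewrite gE lform_broom nsq_broom (G0 0%N) // expr0n add0r.
have -> : dirichlet G b = 0.
  by rewrite /dirichlet big1 // => i _; rewrite !G0 ?subrr ?expr0n // ltnW.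
have -> : mass G b = 0 by rewrite /mass big1 // => i _; rewrite G0 ?expr0n.
rewrite !add0r => H.
have [vz lz] : (forall i, (i <= j)%N -> G (b + i)%N = 0) /\
    (forall i : 'I_4, G (b + j + i).+1 = 0).
  apply: (@broom_picone mu (fun i => G (b + i)%N) (fun i => G (b + j + i).+1)) => //.
    by rewrite addn0 G0.
  rewrite /dirichlet /mass; under eq_bigr => i _ do rewrite addnS.
  by under [X in mu * (X + _)]eq_bigr => i _ do rewrite addnS.
rewrite !big1 ?addr0 // => i _; first by rewrite lz expr0n.
by rewrite -addnS vz ?expr0n.
Qed.

End CutBroom.

(** * The characteristic set of a broom and its distance from the center *)

Section BroomDistance.
Local Open Scope ring_scope.
Variables (R : realType) (b j : nat).
Hypotheses (j0 : (0 < j)%N) (bj : (j + 4 <= b)%N \/ b = 5%N /\ j = 2%N).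
Local Notation V := 'I_(b + j + 4 + 1).
Local Notation E := (broom (b + j) 4).
Local Notation rt := (broom_rooted (b + j) 4).
Let e_tree := broom_tree (b + j) 4.
Let e_sym := rooted_sym rt.
Let e_conn := rooted_connect rt.
Let b5 : (5 <= b)%N. Proof. by case: bj => [|[-> _] //]; move: j0; clear; lia. Qed.
Let jb : (j < b)%N. Proof. by case: bj => [|[-> -> //]]; clear; lia. Qed.
Let T_gt1 : (1 < #|{: V}|)%N.
Proof. by rewrite card_broom; move: b5; clear; lia. Qed.

(** If y were beyond b, g would be separated from all functions on 0, ..., b - 1, so mu_2 is a lower
    bound for the path side. That bound implies the hub inequality, under which no nonzero function
    beyond b has quotient at most mu_2. *)
Lemma broom_branch_le (y : V) (g : V -> R) : (forall t, 0 <= g t) ->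
  (forall t, t \notin desc (@broom_par (b + j) 4) (@broom_dep (b + j) 4) y -> g t = 0) ->
  0 < nsq g -> lform E g <= mu2 R E * nsq g -> (y <= b)%N.
Proof.
move=> g_ge0 gsupp ng lg; rewrite leqNgt; apply/negP => by_.
have g0 (u : V) : (u <= b)%N -> g u = 0.
  move=> ub; apply: gsupp; apply/negP => /dep_desc; rewrite /broom_dep.
  by move: (nat_of_ord u) (nat_of_ord y) ub by_ j0; clear => m m'; lia.
have mu0 : 0 < mu2 R E := mu2_gt0 R e_sym e_conn T_gt1.
have path_ge (h : V -> R) : (forall u : V, (b <= u)%N -> h u = 0) ->
    mu2 R E * nsq h <= lform E h.
  move=> h0; apply: (mu2_separated e_sym e_conn T_gt1 _ g_ge0 ng lg).
  split=> [u|u v euv].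
    by have [ub|/ltnW ub] := leqP u b; [rewrite g0 ?mul0r | rewrite h0 ?mulr0].
  have [ub|ub] := leqP u b; first by rewrite g0 ?mul0r.
  have [bv|vb] := leqP b v; first by rewrite h0 ?mulr0.
  have := broom_dep_edge euv; rewrite /broom_dep.
  by move: (nat_of_ord u) (nat_of_ord v) ub vb j0; clear => m m'; lia.
have path := path_side (ltW mu0) path_ge.
have [mub _ _ inc] := path_bound_useq mu0 path.
have mu1 : mu2 R E < 1.
  by have : 5 <= b%:R :> R; [rewrite ler_nat | move: mub mu0; nra].
have hub_lt : 4 * mu2 R E * useq (mu2 R E) j <
    (1 - mu2 R E) * (useq (mu2 R E) j.+1 - useq (mu2 R E) j).
  case: bj => [jb4|[b_5 j_2]]; first exact: path_bound_hub path.
  move: (mu2 R E) mu0 path => mu mu_gt0 path; rewrite j_2.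
  by apply: path5_bound_hub => // v v0; have := path v v0; rewrite b_5.
have mu01 : 0 < mu2 R E < 1 by rewrite mu0.
have inc' i : (0 < i <= j)%N -> useq (mu2 R E) i < useq (mu2 R E) i.+1.
  by move=> /andP[i0 ij]; apply: inc; rewrite i0 (leq_ltn_trans ij).
by have := broom_side mu01 j0 inc' hub_lt g0 lg; rewrite leNgt ng.
Qed.

(** A branch carrying one sign of phi hangs at c itself or at a child of c, and its top is at most
    b. If phi c = 0, neighbours of both signs exist and only one of them can be the parent. *)
Lemma broom_char_le (c : V) : c \in char_set R E -> (c <= b)%N.
Proof.
have [phi [-> phiE phi_sum phi0]] := char_set_fiedler R e_tree T_gt1.
have bound (y : V) : y != broom_root (b + j) 4 -> phi (broom_par y) * phi y <= 0 ->
    phi y != 0 -> (y <= b)%N.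
  move=> yr yp y0; have [g [g_ge0 gs ng lg]] := sign_branch phiE rt yr yp y0.
  exact: broom_branch_le g_ge0 gs ng lg.
have kid_bound (w : V) : w != broom_root (b + j) 4 -> broom_par w = c -> (w <= b)%N -> (c <= b)%N.
  move=> wr <- wb; apply: leq_trans _ wb => /=.
  by case: (leqP w _) => [_|/ltnW //]; exact: leq_pred.
move=> /(char_set_sign e_sym phiE)[[pc [w1 [w2 [e1 e2 p1 p2]]]]|[w [ecw pw _]]].
  have kid w : E c w -> phi w != 0 -> w = broom_par c \/ (c <= b)%N.
    rewrite (rootedE rt) => /orP[/andP[_ /eqP <-]|/andP[wr /eqP wc]] w0; first by left.
    by right; apply: (kid_bound w wr wc); apply: bound => //; rewrite wc pc mul0r.
  have [w1E|//] := kid w1 e1 (ltr0_neq0 p1); have [w2E|//] := kid w2 e2 (lt0r_neq0 p2).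
  by move: p1 p2; rewrite w1E w2E => /lt_trans H /H; rewrite ltxx.
have w0 : phi w != 0 by apply: contraTneq pw => ->; rewrite mulr0 ltxx.
have c0 : phi c != 0 by apply: contraTneq pw => ->; rewrite mul0r ltxx.
move: ecw; rewrite (rootedE rt) => /orP[/andP[cr /eqP cw]|/andP[wr /eqP wc]].
  by apply: bound => //; rewrite cw mulrC ltW.
by apply: (kid_bound w wr wc); apply: bound => //; rewrite wc ltW.
Qed.

(** Depth changes by one along an edge; it is at least b + j - 1 on the center and at most b on the
    characteristic set. *)
Lemma broom_center_dist_ge : (j.-1 <= center_dist R E)%N.
Proof.
have k2 : (2 <= b + j)%N by move: b5; clear; lia.
rewrite /center_dist broom_center //.
have [phi [CE phiE phi_sum phi0]] := char_set_fiedler R e_tree T_gt1.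
have [c0 c0C] := char_set_nonempty e_sym e_conn phi_sum phi0; rewrite -CE in c0C.
have hY : hub (b + j) \in [set neck (b + j); hub (b + j)] by rewrite finset.set22.
have [y [c [yY cC ->]]] := set_dist_attained e_conn hY c0C.
have cb := broom_char_le cC.
have := gdist_lipschitz (f := @broom_dep (b + j) 4) _ (e_conn c y).
rewrite (gdistC e_sym (e_conn c y)) => H.
have {}H : (broom_dep y <= broom_dep c + gdist E y c)%N.
  by apply: H => u v /broom_dep_edge; clear; lia.
have yk : ((b + j).-1 <= y)%N.
  by have /finset.set2P[->|->] := yY; rewrite /= ?leqnn // leq_pred.
move: H yk cb j0; rewrite /broom_dep.
by move: (gdist _ _ _) (nat_of_ord y) (nat_of_ord c); clear => d m m'; lia.
Qed.
End BroomDistance.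

Theorem theorem1p1 (R : realType) (n : nat) (hn : 3 <= n) :
  let Delta := if n <= 11 then 0 else if n == 12 then 1 else (n - 11) %/ 2 in
  is_maximum (center_dists R n) Delta /\
  (12 <= n -> center_dist R (broom (n - 5) 4) = Delta).
Proof.
move=> Delta; have upper d : center_dists R n d -> d <= Delta.
  move=> [T [e [e_tree cT ->]]]; have T_gt1 : 1 < #|T| by rewrite cT ltnW.
  have [->//|d0] := posnP (center_dist R e).
  have [n12 n2d] := tree_center_dist e_tree T_gt1 d0.
  rewrite cT in n12 n2d; rewrite /Delta; move: (center_dist R e) n12 n2d d0 hn.
  clear=> d n12 n2d d0 hn.
  by case: (leqP n 11) => n11; [lia | case: (eqVneq n 12) => n_12; lia].
have broom_dist : 12 <= n -> center_dist R (broom (n - 5) 4) = Delta.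
  move=> n12; apply/eqP; rewrite eqn_leq; apply/andP; split.
    apply: upper; exists 'I_(n - 5 + 4 + 1), (broom (n - 5) 4); split=> //.
      exact: broom_tree.
    by rewrite card_ord; move: n12; clear; lia.
  (* With k = n - 5, n / 2 is the least b with j + 4 <= b. At n = 12 this cut has j = 1 and yields
     only the bound 0, so the exceptional cut 5 + 2 is taken. *)
  pose b := if n == 12 then 5 else n %/ 2; pose j := n - 5 - b.
  have [nbj j0 bj jD] : [/\ n - 5 = b + j, 0 < j, j + 4 <= b \/ b = 5 /\ j = 2 & Delta = j.-1].
    rewrite /j /b /Delta; move: n12; clear => n12.
    by case: (leqP n 11) => n11; case: (eqVneq n 12) => [->|n_12]; split; lia.
  by rewrite jD nbj; apply: broom_center_dist_ge.
split=> //; split=> //; have [n12|n11] := leqP 12 n.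
  exists 'I_(n - 5 + 4 + 1), (broom (n - 5) 4); split; first exact: broom_tree.
    by rewrite card_ord; move: n12; clear; lia.
  by rewrite broom_dist.
have D0 : Delta = 0 by rewrite /Delta -ltnS n11.
(* This broom is the path on n vertices; for n <= 11 any tree would serve, by the upper bound. *)
exists 'I_(n - 2 + 1 + 1), (broom (n - 2) 1); split; first exact: broom_tree.
  by rewrite card_ord; move: hn; clear; lia.
suff : center_dist R (broom (n - 2) 1) <= Delta by rewrite D0 leqn0 => /eqP.
apply: upper; exists 'I_(n - 2 + 1 + 1), (broom (n - 2) 1).
split=> //; first exact: broom_tree.
by rewrite card_ord; move: hn; clear; lia.
Qed.
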